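(* Let $\Phi$ be a growth function of lower type. For every $G\in H^{\Phi}(\mathbb{D})$ with $G\not\equiv0$, there exists a unique decomposition of the form $G=I_GO_G$, where $I_G$ is an inner function and $O_G$ is an outer function belonging to $H^{\Phi}(\mathbb{D})$. Moreover, $$\|G\|_{H^{\Phi}}^{lux}\approx\|O_G\|_{H^{\Phi}}^{lux},$$ with constants independent of $G$.
   Context: $\mathbb{D}=\{z\in\mathbb{C}:|z|<1\}$, $\mathbb{T}=\{z\in\mathbb{C}:|z|=1\}$. A growth function is a nondecreasing function $\Phi:[0,\infty)\to[0,\infty)$ with $\lim_{t\to0}\Phi(t)=\Phi(0)=0$, $\Phi(t)>0$ for $t>0$, and $\lim_{t\to\infty}\Phi(t)=\infty$. It is of lower type $p\in(0,\infty)$ if there is a constant $C>1$ with $\Phi(st)\le Ct^{p}\Phi(s)$ for all $t\in[0,1]$, $s\in[0,\infty)$; it is of lower type if it is of lower type $p$ for some $p\in(0,\infty)$. For measurable $g:\mathbb{T}\to\mathbb{C}$, $\|g\|_{L^{\Phi}}^{lux}=\inf\{\lambda>0:\int_0^{2\pi}\Phi(|g(e^{i\theta})|/\lambda)\frac{d\theta}{2\pi}\le1\}$. $H^{\Phi}(\mathbb{D})$ is the space of holomorphic functions $G$ on $\mathbb{D}$ with $\|G\|_{H^{\Phi}}^{lux}:=\sup_{0\le r<1}\|G_r\|_{L^{\Phi}}^{lux}<\infty$, where $G_r(e^{i\theta})=G(re^{i\theta})$. An analytic function $G$ on $\mathbb{D}$ is inner if it is bounded and $|\lim_{r\to1}G(re^{it})|=1$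 for almost all $t\in\mathbb{R}$. It is outer if $$G(z)=\exp\left\{\frac1{2\pi}\int_{-\pi}^{\pi}\frac{e^{it}+z}{e^{it}-z}\log|g(e^{it})|\,dt\right\},\quad z\in\mathbb{D},$$ for some measurable $g$ on $\mathbb{T}$ with $\log|g|\in L^1(\mathbb{T})$ (no unimodular constant factor is allowed). $A\approx A'$ means that $c^{-1}A'\le A\le cA'$ for a constant $c>0$ independent of the main parameters (here depending only on $\Phi$). *)

(* Defs.v *)
From HB Require Import structures.
From mathcomp Require Import all_boot all_order all_algebra.
From mathcomp Require Import all_classical all_reals all_analysis.
From mathcomp Require Import complex.

Set Implicit Arguments.
Unset Strict Implicit.
Unset Printing Implicit Defensive.

Import Order.TTheory GRing.Theory Num.Theory.
Import numFieldNormedType.Exports.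
Import Normc.

Local Open Scope classical_set_scope.
Local Open Scope ring_scope.
Local Open Scope complex_scope.

(* Functions on the open unit disc, and on the unit circle, are represented by
   total functions on [R[i]] of which only the values on the disc, resp. the
   circle, are ever used; equality of functions on the disc is accordingly
   pointwise equality on the disc.  [R[i]^o] is [R[i]] as a one-dimensional
   normed space over itself. *)

Section InnerOuter.
Variable R : realType.
Local Notation mu := (@lebesgue_measure R).

Definition unit_disc : set R[i] := [set z | normc z < 1].

Definition expi (t : R) : R[i] := cos t +i* sin t.

Definition cexp (z : R[i]) : R[i] :=
  (expR (complex.Re z))%:C * expi (complex.Im z).

Definition growth_function (Phi : R -> R) : Prop :=
  [/\ forall s t : R, 0 <= s -> s <= t -> Phi s <= Phi t,
      Phi 0 = 0,
      Phi t @[t --> 0^'+] --> (0 : R),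
      forall t : R, 0 < t -> 0 < Phi t &
      Phi t @[t --> +oo] --> +oo].

Definition of_lower_type_exponent (Phi : R -> R) (p : R) : Prop :=
  exists2 C : R, 1 < C & forall s t : R, 0 <= s -> 0 <= t -> t <= 1 ->
    Phi (s * t) <= C * t `^ p * Phi s.

Definition of_lower_type (Phi : R -> R) : Prop :=
  exists2 p : R, 0 < p & of_lower_type_exponent Phi p.

(* The Luxemburg functional with respect to the normalized arc length; it is
   [+oo] when no admissible [l] exists. *)
Definition lux_norm (Phi : R -> R) (g : R[i] -> R[i]) : \bar R :=
  ereal_inf [set l%:E | l in [set l : R | 0 < l /\
    (((2 * pi)^-1)%:E *
       \int[mu]_(t in `[0%R, (2 * pi)%R]) (Phi (normc (g (expi t)) / l))%:E
     <= 1)%E]].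

Definition dilation (G : R[i] -> R[i]) (r : R) : R[i] -> R[i] :=
  fun z => G (r%:C * z).

Definition hardy_lux_norm (Phi : R -> R) (G : R[i] -> R[i]) : \bar R :=
  ereal_sup [set lux_norm Phi (dilation G r) | r in [set r : R | 0 <= r < 1]].

(* [derivable] over the field [R[i]]: the difference quotient is taken over
   complex increments. *)
Definition holomorphic_disc (G : R[i] -> R[i]) : Prop :=
  forall z, unit_disc z -> derivable (G : R[i]^o -> R[i]^o) z 1.

Definition hardy_orlicz (Phi : R -> R) (G : R[i] -> R[i]) : Prop :=
  holomorphic_disc G /\ (hardy_lux_norm Phi G < +oo)%E.

Definition inner_function (G : R[i] -> R[i]) : Prop :=
  [/\ holomorphic_disc G,
      exists M : R, forall z, unit_disc z -> normc (G z) <= M &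
      {ae mu, forall t : R, exists2 l : R[i]^o,
         (G (r%:C * expi t) : R[i]^o) @[r --> (1 : R)^'-] --> l &
         normc l = 1}].

Definition measurable_circle (g : R[i] -> R[i]) : Prop :=
  forall U : set R[i]^o, open U -> measurable [set t : R | U (g (expi t))].

Definition cintegral (D : set R) (f : R -> R[i]) : R[i] :=
  Rintegral mu D (fun t => complex.Re (f t)) +i*
  Rintegral mu D (fun t => complex.Im (f t)).

(* [lne 0 = -oo], so that integrability of [log_modulus g] forces [g] to be
   nonzero at almost every point of the circle. *)
Definition log_modulus (g : R[i] -> R[i]) (t : R) : \bar R :=
  lne (normc (g (expi t)))%:E.

Definition herglotz_kernel (z : R[i]) (t : R) : R[i] :=
  (expi t + z) / (expi t - z).

Definition outer_function (O : R[i] -> R[i]) : Prop :=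
  exists g : R[i] -> R[i],
    [/\ measurable_circle g,
        mu.-integrable `[- pi, pi] (log_modulus g) &
        forall z, unit_disc z ->
          O z = cexp (((2 * pi)^-1)%:C *
            cintegral `[- pi, pi] (fun t =>
              herglotz_kernel z t * (fine (log_modulus g t))%:C))].

Definition inner_outer_factorization (Phi : R -> R) (G I O : R[i] -> R[i]) :
    Prop :=
  [/\ inner_function I, outer_function O, hardy_orlicz Phi O &
      forall z, unit_disc z -> G z = I z * O z].

End InnerOuter.

(* Main.v *)
(* Let [F] be [G] divided by a number larger than its norm.  The lower type of [Phi]
   provides a Jensen inequality [Phi (exp (P[u] - 1)) <= (K / p) P[Phi (exp u)]] for
   Poisson integrals.  Combined with the weak-type inequality for Poisson integrals,
   it shows that [w(t) = sup_n log^+ |F(r_n e^(it))|] is integrable, so that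
   [|F| <= exp P[w]] and division by the outer function with boundary modulus [exp w]
   leaves a bounded function [f].  A bounded function has radial limits almost
   everywhere (Fatou), the logarithm [v] of the boundary modulus is integrable, and
   dividing [f] by the outer function of [v] leaves an inner function [I]; the outer
   factor [O] of [G] has boundary modulus [exp u], where [u = v + w] up to a constant.
   For the norms, [|G| <= |O|] since [|I| <= 1]; conversely [exp u] is the boundary
   modulus of [G], so Fatou's lemma bounds the Luxemburg norm of [exp u] by that of [G],
   and averaging the Jensen inequality over circles carries the bound over to [O].
   For uniqueness, every factorization satisfies [|O| = |G|] almost everywhere on the
   circle, and an outer function is determined by its boundary modulus. *)
Require Import Defs.
From HB Require Import structures.
From mathcomp Require Import all_boot all_order all_algebra.
From mathcomp Require Import all_classical all_reals all_analysis.
From mathcomp Require Import complex measurable_realfun.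
From mathcomp Require Import ring lra.

Set Implicit Arguments.
Unset Strict Implicit.
Unset Printing Implicit Defensive.

Import Order.TTheory GRing.Theory Num.Theory.
Import numFieldNormedType.Exports.
Import Normc.

Local Open Scope classical_set_scope.
Local Open Scope ring_scope.
Local Open Scope complex_scope.

(** * Complex differentiability *)

Section complex_topology.
Variable R : realType.
Local Notation C := R[i].
Implicit Types (z w : C) (x y : R).

(** A bound on the circle means of [log^+ |G|] alone would give only the Poisson integral of a
    measure as majorant, and its singular part could put a singular inner factor into the
    denominator. Bounding the supremum over the radii instead makes the majorant the Poisson
    integral of an integrable function, and no weak limits are taken. Integrability of that supremum
    comes from the exponential growth of [s -> Phi (expR s)]: the set where it exceeds [k + 1] has
    measure at most a constant times [expR (- k * p)]. Zeros of [G] are never factored out. Both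
    divisions are by zero-free outer functions, so the zeros stay in the inner factor; one point
    where [G] is nonzero suffices to keep the logarithm of the boundary modulus integrable. [Phi] is
    assumed neither convex nor continuous. Supporting lines up to a factor stand in for convexity,
    and passing to a slightly smaller Luxemburg constant stands in for continuity. *)

Lemma normcE z : normc z = Num.sqrt (complex.Re z ^+ 2 + complex.Im z ^+ 2).
Proof. by case: z. Qed.

Lemma normc_ge0 z : 0 <= normc z.
Proof. by rewrite normcE sqrtr_ge0. Qed.

Lemma sqr_normcE z : normc z ^+ 2 = complex.Re z ^+ 2 + complex.Im z ^+ 2.
Proof. by rewrite normcE sqr_sqrtr// addr_ge0// sqr_ge0. Qed.

Lemma normr_Re_le z : `|complex.Re z| <= normc z.
Proof.
rewrite -(@ler_pXn2r _ 2) ?nnegrE ?normc_ge0//.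
by rewrite sqr_normcE real_normK ?num_real// lerDl sqr_ge0.
Qed.

Lemma normr_Im_le z : `|complex.Im z| <= normc z.
Proof.
rewrite -(@ler_pXn2r _ 2) ?nnegrE ?normc_ge0//.
by rewrite sqr_normcE real_normK ?num_real// lerDr sqr_ge0.
Qed.

Lemma Re_le_normc z : complex.Re z <= normc z.
Proof. exact: le_trans (ler_norm _) (normr_Re_le z). Qed.

Lemma normc_real x : normc x%:C = `|x|.
Proof. by rewrite normcE /= expr0n/= addr0 sqrtr_sqr. Qed.

Lemma normc_le_ReIm z : normc z <= `|complex.Re z| + `|complex.Im z|.
Proof.
rewrite -(@ler_pXn2r _ 2) ?nnegrE ?normc_ge0 ?addr_ge0//.
rewrite sqr_normcE sqrrD !real_normK ?num_real// lerD2r lerDl.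
by rewrite mulrn_wge0// mulr_ge0.
Qed.

Lemma normc_eq0 z : (normc z == 0) = (z == 0).
Proof.
by apply/eqP/eqP => [/eq0_normc//|->]; rewrite normc_real normr0.
Qed.

Lemma normc_gt0 z : (0 < normc z) = (z != 0).
Proof. by rewrite lt_neqAle normc_ge0 andbT eq_sym normc_eq0. Qed.

Lemma normcB z w : normc (z - w) = normc (w - z).
Proof. by rewrite -normcN opprB. Qed.

Lemma ler_normcB_dist z w : `|normc z - normc w| <= normc (z - w).
Proof.
rewrite ler_norml; apply/andP; split.
  by have := le_normcD (w - z) z; rewrite subrK normcB lerNl opprB lerBlDr.
by have := le_normcD (z - w) w; rewrite subrK lerBlDr.
Qed.

Lemma normcJ z : normc (conjc z) = normc z.
Proof. by case: z => a b; rewrite !normcE /= sqrrN. Qed.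

Lemma cReD z w : complex.Re (z + w) = complex.Re z + complex.Re w.
Proof. by case: z w => [a b] [c d]. Qed.
Lemma cImD z w : complex.Im (z + w) = complex.Im z + complex.Im w.
Proof. by case: z w => [a b] [c d]. Qed.
Lemma cReN z : complex.Re (- z) = - complex.Re z.
Proof. by case: z. Qed.
Lemma cImN z : complex.Im (- z) = - complex.Im z.
Proof. by case: z. Qed.
Lemma cReM z w : complex.Re (z * w) =
  complex.Re z * complex.Re w - complex.Im z * complex.Im w.
Proof. by case: z w => [a b] [c d]. Qed.
Lemma cImM z w : complex.Im (z * w) =
  complex.Re z * complex.Im w + complex.Im z * complex.Re w.
Proof. by case: z w => [a b] [c d]. Qed.
Lemma complexP z w : complex.Re z = complex.Re w ->
  complex.Im z = complex.Im w -> z = w.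
Proof. by case: z w => [a b] [c d] /= -> ->. Qed.

Section filters.
Variables (T : Type) (F : set_system T).
Context {FF : Filter F}.
Implicit Type f : T -> C.

(** The norm of [C^o] takes values in [R[i]], where a positive element is real; an epsilon of [C]
    thus reduces to a real one, and the real modulus [normc] can be used throughout. *)
Lemma cvg_normcP f z :
  (f : T -> C^o) @ F --> (z : C^o) <-> normc (f t - z) @[t --> F] --> (0 : R).
Proof.
split=> [/cvgrPdist_lt fz|/cvgrPdist_lt fz].
  apply/cvgrPdist_lt => e e0.
  have := fz e%:C; rewrite ltcR => /(_ e0); apply: filterS => t /=.
  by rewrite ltcR sub0r normrN ger0_norm ?normc_ge0// normcB.
apply/cvgrPdist_lt => -[e e']; rewrite ltcE /= => /andP[/eqP -> e0].
have := fz e e0; apply: filterS => t /=.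
by rewrite ltcR sub0r normrN ger0_norm ?normc_ge0// normcB.
Qed.

Lemma cvg_ReIm f z : (f : T -> C^o) @ F --> (z : C^o) <->
  complex.Re (f t) @[t --> F] --> complex.Re z /\
  complex.Im (f t) @[t --> F] --> complex.Im z.
Proof.
rewrite cvg_normcP; split=> [fz|[fRe fIm]].
  split; apply/cvgrPdist_lt => e e0; have /cvgrPdist_lt/(_ e e0) := fz;
  apply: filterS => t /=; apply: le_lt_trans; rewrite sub0r normrN;
  rewrite (ger0_norm (normc_ge0 _)) normcB -?cReN -?cReD -?cImN -?cImD.
    exact: normr_Re_le.
  exact: normr_Im_le.
apply: (@squeeze_cvgr _ _ _ _ (cst 0) (fun t => `|complex.Re (f t) - complex.Re z| +
  `|complex.Im (f t) - complex.Im z|)).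
- apply: nearW => t /=; rewrite normc_ge0/=.
  by apply: le_trans (normc_le_ReIm _) _; rewrite cReD cImD cReN cImN.
- exact: cvg_cst.
- have h (u : T -> R) l : u t @[t --> F] --> l -> `|u t - l| @[t --> F] --> (0 : R).
    move=> ul; rewrite -(@normr0 _ R) -(subrr l); apply: cvg_norm.
    by apply: cvgB => //; exact: cvg_cst.
  by rewrite -[X in _ --> X]addr0; apply: cvgD; exact: h.
Qed.

Lemma cvg_normc f z : (f : T -> C^o) @ F --> (z : C^o) ->
  normc (f t) @[t --> F] --> normc z.
Proof.
move=> /cvg_normcP/cvgrPdist_lt fz; apply/cvgrPdist_lt => e e0.
have := fz e e0; apply: filterS => t /=; apply: le_lt_trans.
by rewrite sub0r normrN (ger0_norm (normc_ge0 _)) normcB ler_normcB_dist.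
Qed.

End filters.

Lemma continuousCP (f : C -> C) z : {for z, continuous (f : C^o -> C^o)} <->
  forall e : R, 0 < e -> exists2 d : R, 0 < d &
    forall w, normc (w - z) < d -> normc (f w - f z) < e.
Proof.
split=> [/cvgrPdist_lt fz e e0|fz].
  have := fz e%:C; rewrite ltcR => /(_ e0) /nbhs_ballP[[d d'] /=].
  rewrite ltcE /= => /andP[/eqP -> d0] H; exists d => // w wz.
  have : `|f z - f w| < e%:C.
    by apply: H; rewrite /ball /= normc_def ltcR -normcE normcB.
  by rewrite normc_def ltcR -normcE normcB.
apply/(@cvgrPdist_lt _ C^o _ (nbhs (z : C^o))) => -[e e']; rewrite ltcE /= => /andP[/eqP -> e0].
have [d d0 H] := fz e e0.
apply/nbhs_ballP; exists d%:C => /=; first by rewrite ltcR.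
move=> w; rewrite /ball /= normc_def ltcR -normcE normcB => /H.
by rewrite normc_def ltcR -normcE normcB.
Qed.

End complex_topology.

Section expansion.
Variable K : numFieldType.
Implicit Types (f : K^o -> K^o) (x l : K^o).

(** Multiplied out, the difference quotient estimate also covers [w = x]. A general [numFieldType]
    serves both complex functions and the real functions [expR], [cos] and [sin]. *)
Lemma derive_expansion f x l : is_derive x 1 f l -> forall e : K, 0 < e ->
  \forall w \near x, `|f w - f x - l * (w - x)| <= e * `|w - x|.
Proof.
move=> [df dl] e e0; move: df; rewrite /derivable -/(derive f x 1) => df.
have : h^-1 *: (f (h *: 1 + x) - f x) @[h --> 0^'] --> l.
  by rewrite -dl; exact: df.
move=> /cvgrPdist_lt/(_ _ e0).
rewrite near_withinE => /nbhs_ballP[d /= d0 H].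
apply/nbhs_ballP; exists d => // w xw.
have [->|wx] := eqVneq w x; first by rewrite !subrr mulr0 subrr normr0 mulr0.
have wx0 : w - x != 0 by rewrite subr_eq0.
have := H (w - x); rewrite /ball /= sub0r normrN -[X in X < d]normrN opprB => /(_ xw wx0).
rewrite [_ *: 1]mulr1 subrK => /ltW K1.
rewrite -ler_pdivrMr ?normr_gt0// -normf_div.
by apply: le_trans K1; rewrite -[X in _ <= X]normrN opprB mulrBl mulfK// mulrC.
Qed.

Lemma expansion_derive f x l : (forall e : K, 0 < e ->
  \forall w \near x, `|f w - f x - l * (w - x)| <= e * `|w - x|) ->
  is_derive x 1 f l.
Proof.
move=> H.
have L : h^-1 *: (f (h *: 1 + x) - f x) @[h --> 0^'] --> l.
  apply/cvgrPdist_le => e e0; rewrite near_withinE.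
  have /nbhs_ballP[d /= d0 {}H] := H e e0.
  apply/nbhs_ballP; exists d => // h; rewrite /ball /= sub0r normrN => hd h0.
  have := H (h + x); rewrite /ball /= opprD addrCA subrr addr0 normrN => /(_ hd).
  rewrite addrK -ler_pdivrMr ?normr_gt0// -normf_div [_ *: 1]mulr1.
  by move=> K1; apply: le_trans K1; rewrite -[X in X <= _]normrN opprB mulrBl mulfK// [_ / h]mulrC.
by split; [apply/cvg_ex; exists l|exact: cvg_lim].
Qed.

End expansion.

Lemma near_normr (R : realType) (x : R) (P : R -> Prop) :
  (\forall w \near x, P w) ->
  exists2 d : R, 0 < d & forall w, `|w - x| < d -> P w.
Proof.
by move=> /nbhs_ballP[d /= d0 H]; exists d => // w wx; apply: H;
  rewrite /ball /= distrC.
Qed.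

Section holomorphic.
Variable R : realType.
Local Notation C := R[i].
Implicit Types (z w h : C) (f g : C -> C).

Definition cdiff f z := differentiable (f : C^o -> C^o) (z : C^o).

Lemma holomorphic_discP f :
  holomorphic_disc f <-> forall z, normc z < 1 -> cdiff f z.
Proof. by split=> H z z1; apply/derivable1_diffP; apply: H. Qed.

(** With real epsilon and delta the expansion passes directly through conjugation and to the
    differentials of the real and imaginary parts. *)
Lemma cdiffP f z : cdiff f z <-> exists l : C, forall e : R, 0 < e ->
  exists2 d : R, 0 < d & forall w, normc (w - z) < d ->
    normc (f w - f z - l * (w - z)) <= e * normc (w - z).
Proof.
split=> [/derivable1_diffP/derivableP|[l H]].
  move=> /derive_expansion H; exists ('D_1 (f : C^o -> C^o) z) => e e0.
  have := H e%:C; rewrite ltcR => /(_ e0) /nbhs_ballP[[d d'] /=].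
  rewrite ltcE /= => /andP[/eqP -> d0] {}H; exists d => // w wz.
  have : ball (z : C^o) d%:C w by rewrite /ball /= normc_def ltcR -normcE normcB.
  by move=> /H; rewrite -lecR /= !normc_def -!normcE rmorphM.
apply/derivable1_diffP.
have : is_derive (z : C^o) 1 (f : C^o -> C^o) l.
  apply: expansion_derive => -[e e']; rewrite ltcE /= => /andP[/eqP -> e0].
  have [d d0 {}H] := H e e0.
  apply/nbhs_ballP; exists d%:C => /=; first by rewrite ltcR.
  move=> w; rewrite /ball /= normc_def ltcR -normcE normcB => /H.
  by rewrite -lecR !normc_def -!normcE rmorphM.
by case.
Qed.

Lemma cdiff_continuous f z : cdiff f z -> {for z, continuous (f : C^o -> C^o)}.
Proof. exact: differentiable_continuous. Qed.

Lemma cdiff_cst (c : C) z : cdiff (fun=> c) z.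
Proof. exact: differentiable_cst. Qed.

Lemma cdiff_id z : cdiff id z.
Proof. by apply/derivable1_diffP; exact: derivable_id. Qed.

Lemma cdiffD f g z : cdiff f z -> cdiff g z -> cdiff (fun w => f w + g w) z.
Proof. exact: differentiableD. Qed.

Lemma cdiffB f g z : cdiff f z -> cdiff g z -> cdiff (fun w => f w - g w) z.
Proof. exact: differentiableB. Qed.

Lemma cdiffM f g z : cdiff f z -> cdiff g z -> cdiff (fun w => f w * g w) z.
Proof. exact: differentiableM. Qed.

Lemma cdiffV f z : f z != 0 -> cdiff f z -> cdiff (fun w => (f w)^-1) z.
Proof. by move=> f0 df; apply: (@differentiableV _ _ (f : C^o -> C^o)). Qed.

Lemma cdiff_comp f g z : cdiff f z -> cdiff g (f z) -> cdiff (g \o f) z.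
Proof. exact: differentiable_comp. Qed.

(** Reflection in the real axis: the linear coefficient is conjugated along. This brings conjugates
    of [f] into contour arguments, as in [sqmean_cross]. *)
Lemma cdiff_conj f z : cdiff f (conjc z) -> cdiff (fun w => (conjc (f (conjc w)))) z.
Proof.
move=> /cdiffP[l H]; apply/cdiffP; exists (conjc l) => e e0.
have [d d0 {}H] := H e e0; exists d => // w wz.
have wz' : (conjc w) - (conjc z) = (conjc (w - z)) by rewrite rmorphB.
have := H (conjc w); rewrite wz' normcJ => /(_ wz).
by rewrite -[X in X <= _ -> _]normcJ 2!rmorphB rmorphM/= !conjcK.
Qed.

Lemma eq_cdiff f g z (d : R) : 0 < d ->
  (forall w, normc (w - z) < d -> f w = g w) -> cdiff f z -> cdiff g z.
Proof.
move=> d0 fg /cdiffP[l H]; apply/cdiffP; exists l => e e0.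
have [d' d'0 {}H] := H e e0; exists (Num.min d d').
  by rewrite lt_min d0.
move=> w; rewrite lt_min => /andP[wd wd']; rewrite -!fg ?H//.
by rewrite subrr normc_real normr0.
Qed.

Lemma expiD (s t : R) : expi (s + t) = expi s * expi t.
Proof.
by rewrite /expi cosD sinD; apply: complexP; rewrite ?cReM ?cImM /=//; ring.
Qed.

Lemma normc_expi (t : R) : normc (expi t) = 1.
Proof. by rewrite normcE /= cos2Dsin2 sqrtr1. Qed.

Lemma expi0 : expi 0 = 1 :> C.
Proof. by rewrite /expi cos0 sin0. Qed.

Lemma expiN (t : R) : expi (- t) = (conjc (expi t)).
Proof. by rewrite /expi cosN sinN. Qed.

Lemma expi_neq0 (t : R) : expi t != 0.
Proof. by rewrite -normc_gt0 normc_expi. Qed.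

Lemma cexpD z w : cexp (z + w) = cexp z * cexp w.
Proof.
rewrite /cexp cReD cImD expRD expiD !rmorphM /=; ring.
Qed.

Lemma normc_cexp z : normc (cexp z) = expR (complex.Re z).
Proof. by rewrite normcM normc_real normc_expi mulr1 ger0_norm ?expR_ge0. Qed.

(** The addition law reduces the claim to the expansion of [cexp] at 0, which follows from those of
    [expR], [cos] and [sin]. *)
Lemma cdiff_cexp z : cdiff (@cexp R) z.
Proof.
apply/cdiffP; exists (cexp z) => e e0.
set M := normc (cexp z); have M0 : 0 < M by rewrite /M normc_cexp expR_gt0.
(* The errors [t1] to [t4] below contribute 1, 2, 2 and 1 times [e1 * normc h], hence the 6. *)
pose e1 := Num.min 1 (e / (6 * M)).
have e10 : 0 < e1 by rewrite lt_min ltr01 divr_gt0// mulr_gt0.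
have e11 : e1 <= 1 by rewrite ge_min lexx.
have e12 : 6 * e1 * M <= e.
  have : e1 <= e / (6 * M) by rewrite ge_min lexx orbT.
  by rewrite ler_pdivlMr ?mulr_gt0//; nra.
have H1 := @derive_expansion _ _ _ _ (is_derive_expR (0 : R)) e1 e10.
have H2 := @derive_expansion _ _ _ _ (is_derive_cos (0 : R)) e1 e10.
have H3 := @derive_expansion _ _ _ _ (is_derive_sin (0 : R)) e1 e10.
have H4 : \forall w \near (0 : R), `|expR 0 - expR w| < e1.
  have /cvgrPdist_lt/(_ _ e10) := @continuous_expR R 0; exact.
have : \forall w \near (0 : R), `|w| < e1.
  have /cvgrPdist_lt/(_ _ e10) := @cvg_id _ (nbhs (0 : R)).
  by apply: filterS => t; rewrite sub0r normrN.
near_simpl.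
move=> H5; have [d d0 H] := near_normr (filterI (filterI (filterI H1 H2) (filterI H3 H4)) H5).
exists d => // w wz; rewrite -(subrK z w) [in cexp (_ + z)]addrC cexpD addrK.
set h := w - z in wz *.
rewrite -{2}[cexp z]mulr1 -!mulrBr normcM -/M.
have B (x : R) : `|x| <= normc h -> `|x - 0| < d.
  by move=> xh; rewrite subr0 (le_lt_trans xh).
have [[[/= Hx1 Hx2] [Hx3 Hx4]] Hx5] := H _ (B _ (normr_Re_le h)).
have [[[/= Hy1 Hy2] [Hy3 Hy4]] Hy5] := H _ (B _ (normr_Im_le h)).
move: Hx1 Hx4 Hx5 Hy2 Hy3 Hy4 {Hx2 Hx3 Hy1 Hy5 H1 H2 H3 H4 H5}.
rewrite /= expR0 cos0 sin0 !subr0 oppr0 !mul1r !mul0r subr0 => Hx1 Hx4 Hx5 Hy2 Hy3 Hy4.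
suff S : normc (cexp h - 1 - h) <= 6 * e1 * normc h.
  apply: le_trans (ler_wpM2l (ltW M0) S) _.
  by rewrite mulrA ler_wpM2r ?normc_ge0// mulrC.
apply: le_trans (normc_le_ReIm _) _.
rewrite !cReD !cImD !cReN !cImN /cexp cReM cImM /= !mul0r !subr0 addr0 ?oppr0 ?addr0.
set x := complex.Re h in Hx1 Hx4 Hx5 *; set y := complex.Im h in Hy2 Hy3 Hy4 *.
have hx : `|x| <= normc h := normr_Re_le h.
have hy : `|y| <= normc h := normr_Im_le h.
have -> : expR x * cos y - 1 - x = (expR x - 1 - x) * cos y + (1 + x) * (cos y - 1) by ring.
have -> : expR x * sin y - y = expR x * (sin y - y) + (expR x - 1) * y by ring.
have t1 : `|(expR x - 1 - x) * cos y| <= e1 * normc h.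
  rewrite normrM -[leRHS]mulr1 ler_pM// ?cos_max// (le_trans Hx1)// ler_wpM2l//; exact: ltW.
have t2 : `|(1 + x) * (cos y - 1)| <= 2 * (e1 * normc h).
  rewrite normrM ler_pM//; last by rewrite (le_trans Hy2)// ler_wpM2l// ltW.
  by rewrite (le_trans (ler_normD _ _))// normr1 -[2]/(1+1)%R lerD2l (le_trans (ltW Hx5)).
have t3 : `|expR x * (sin y - y)| <= 2 * (e1 * normc h).
  rewrite normrM ler_pM//; last by rewrite (le_trans Hy3)// ler_wpM2l// ltW.
  by move: Hx4; rewrite distrC => Hx4; rewrite -(subrK 1 (expR x)) (le_trans (ler_normD _ _))// normr1 -[2]/(1+1)%R lerD2r (le_trans (ltW Hx4)).
have t4 : `|(expR x - 1) * y| <= e1 * normc h.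
  by rewrite normrM ler_pM// distrC ltW.
have := ler_normD ((expR x - 1 - x) * cos y) ((1 + x) * (cos y - 1)).
have := ler_normD (expR x * (sin y - y)) ((expR x - 1) * y).
lra.
Unshelve. all: by end_near. Qed.

End holomorphic.

(** * Goursat's lemma for closed forms on rectangles *)

Section real_integrals.
Variable R : realType.
Local Notation mu := (@lebesgue_measure R).
Implicit Types (f g : R -> R) (a b m : R).

(** Continuity is taken in the whole line, so the end points carry no one-sided conditions and
    restriction to subintervals is immediate. *)
Definition ccont f a b := forall x, a <= x <= b -> {for x, continuous f}.

Lemma ccontS f a b a' b' : a <= a' -> b' <= b -> ccont f a b -> ccont f a' b'.
Proof.
move=> aa bb fc x /andP[ax xb]; apply: fc.
by rewrite (le_trans aa)//= (le_trans xb).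
Qed.

Lemma ccontB f g a b : ccont f a b -> ccont g a b ->
  ccont (fun x => f x - g x) a b.
Proof. by move=> fc gc x xab; apply: cvgB; [exact: fc|exact: gc]. Qed.

Lemma ccont_integrable f a b : ccont f a b ->
  mu.-integrable `[a, b] (EFin \o f).
Proof.
move=> fc; apply: continuous_compact_integrable; first exact: segment_compact.
apply: continuous_in_subspaceT => x; rewrite inE /= in_itv/=; exact: fc.
Qed.

Lemma Rint_cst a b (r : R) : a <= b ->
  \int[mu]_(x in `[a, b]) r = r * (b - a).
Proof.
move=> ab; rewrite Rintegral_cst//= lebesgue_measure_itv/= lte_fin.
move: ab; rewrite le_eqVlt => /predU1P[->|->//].
by rewrite ltxx subrr.
Qed.

Lemma Rint_near_cst f a b (r e : R) : a <= b -> ccont f a b ->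
  (forall x, a <= x <= b -> `|f x - r| <= e) ->
  `|\int[mu]_(x in `[a, b]) f x - r * (b - a)| <= e * (b - a).
Proof.
move=> ab fc fr.
have icst0 (s : R) : ccont (cst s) a b by move=> x _; exact: cvg_cst.
have icst (s : R) : mu.-integrable `[a, b] (EFin \o cst s).
  exact: ccont_integrable.
have ifr : mu.-integrable `[a, b] (EFin \o (fun x => f x - r)).
  by apply: ccont_integrable; apply: ccontB => //; exact: (icst0 r).
have iff := ccont_integrable fc.
rewrite -Rint_cst// -(RintegralB _ iff (icst r))//.
apply: le_trans (le_normr_Rintegral _ ifr) _ => //.
rewrite -Rint_cst//; apply: le_Rintegral => //.
- by apply: (integrable_norm ifr).
- exact: (icst e).
Qed.

Lemma Rint_split f a m b : a <= m -> m <= b -> ccont f a b ->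
  \int[mu]_(x in `[a, b]) f x =
  \int[mu]_(x in `[a, m]) f x + \int[mu]_(x in `[m, b]) f x.
Proof.
move=> am mb fc.
apply/eqP; rewrite addrC -subr_eq; apply/eqP.
rewrite Rintegral_itvB ?bnd_simp//; last exact: ccont_integrable.
rewrite Rintegral_itv_obnd_cbnd//.
apply: (@integrableS _ _ _ mu `[m, b]) => //.
  by apply: subset_itvr; rewrite bnd_simp.
by apply: ccont_integrable; apply: ccontS fc.
Qed.

End real_integrals.

Section goursat.
Variable R : realType.
Local Notation mu := (@lebesgue_measure R).
Variables A B : R -> R -> R.

(** [A] and [B] are differentiable at the point, and the coefficient [q] they share expresses dA/dy
    = dB/dx: the form A dx + B dy is closed there. No continuity of the derivatives is asked for. *)
Definition closed_form_at (x y : R) := exists p q r : R,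
  forall e : R, 0 < e -> exists2 d : R, 0 < d & forall h k : R,
    `|h| < d -> `|k| < d ->
    `|A (x + h) (y + k) - A x y - p * h - q * k| <= e * (`|h| + `|k|) /\
    `|B (x + h) (y + k) - B x y - q * h - r * k| <= e * (`|h| + `|k|).

Lemma closed_form_cont x y : closed_form_at x y ->
  [/\ {for x, continuous (A^~ y)}, {for y, continuous (A x)},
      {for x, continuous (B^~ y)} & {for y, continuous (B x)}].
Proof.
move=> [p [q [r H]]].
have [d d0 {}H] := H 1 ltr01.
have K (f : R -> R) z (c : R) : (forall h, `|h| < d -> `|f (z + h) - f z| <= c * `|h|) ->
    {for z, continuous f}.
  move=> Hf; apply/cvgrPdist_lt => e e0.
  have c1 : 0 < `|c| + 1 by rewrite ltr_wpDl.
  have : 0 < Num.min d (e / (`|c| + 1)) by rewrite lt_min d0 divr_gt0.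
  move=> m0; apply/nbhs_ballP; exists (Num.min d (e / (`|c| + 1))) => //.
  move=> w; rewrite /ball /= lt_min distrC => /andP[wd we].
  have := Hf (w - z) wd; rewrite [z + _]addrC subrK distrC => /le_lt_trans; apply.
  move: we; rewrite ltr_pdivlMr// => we.
  apply: le_lt_trans we; rewrite mulrC ler_wpM2l//.
  by rewrite (le_trans (ler_norm _))// lerDl.
split; [apply: (K _ _ (1 + `|p|))|apply: (K _ _ (1 + `|q|))|
  apply: (K _ _ (1 + `|q|))|apply: (K _ _ (1 + `|r|))] => h hd.
- have [] := H h 0 hd; rewrite ?normr0// !addr0 !mulr0 !subr0 mul1r => H1 _.
  by rewrite mulrDl mul1r -normrM -lerBlDr (le_trans (lerB_dist _ _)).
- have [] := H 0 h; rewrite ?normr0// !addr0 !mulr0 !subr0 mul1r add0r => H1 _.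
  by rewrite mulrDl mul1r -normrM -lerBlDr (le_trans (lerB_dist _ _)).
- have [] := H h 0 hd; rewrite ?normr0// !addr0 !mulr0 !subr0 mul1r => _ H1.
  by rewrite mulrDl mul1r -normrM -lerBlDr (le_trans (lerB_dist _ _)).
- have [] := H 0 h; rewrite ?normr0// !addr0 !mulr0 !subr0 mul1r add0r => _ H1.
  by rewrite mulrDl mul1r -normrM -lerBlDr (le_trans (lerB_dist _ _)).
Qed.

(** For [a <= b] and [c <= d], the counterclockwise boundary integral of A dx + B dy, with opposite
    sides paired. *)
Definition rect_int a b c d := \int[mu]_(x in `[a, b]) (A x c - A x d) +
  \int[mu]_(y in `[c, d]) (B b y - B a y).

Definition closed_form_on a b c d := forall x y, a <= x <= b -> c <= y <= d ->
  closed_form_at x y.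

Lemma closed_form_ccont a b c d : closed_form_on a b c d ->
  (forall y, c <= y <= d -> ccont (A^~ y) a b) /\
  (forall x, a <= x <= b -> ccont (B x) c d).
Proof.
move=> H; split=> [y yc x xa|x xa y yc].
  by have [] := closed_form_cont (H x y xa yc).
by have [] := closed_form_cont (H x y xa yc).
Qed.

Lemma rect_int_splith a m b c d : a <= m <= b -> c <= d ->
  closed_form_on a b c d ->
  rect_int a b c d = rect_int a m c d + rect_int m b c d.
Proof.
move=> /andP[am mb] cd H; have ab := le_trans am mb.
have [HA HB] := closed_form_ccont H.
rewrite /rect_int (Rint_split am mb); last first.
  by apply: ccontB; apply: HA; rewrite lexx ?cd.
have -> : \int[mu]_(y in `[c, d]) (B b y - B a y) =
    \int[mu]_(y in `[c, d]) (B m y - B a y) +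
    \int[mu]_(y in `[c, d]) (B b y - B m y).
  rewrite -RintegralD//; last 2 first.
  - by apply: ccont_integrable; apply: ccontB; apply: HB; rewrite ?lexx ?am ?mb ?ab.
  - by apply: ccont_integrable; apply: ccontB; apply: HB; rewrite ?lexx ?am ?mb ?ab.
  by apply: eq_Rintegral => y _; ring.
ring.
Qed.

Lemma rect_int_splitv a b c m d : a <= b -> c <= m <= d ->
  closed_form_on a b c d ->
  rect_int a b c d = rect_int a b c m + rect_int a b m d.
Proof.
move=> ab /andP[cm md] H; have cd := le_trans cm md.
have [HA HB] := closed_form_ccont H.
rewrite /rect_int (Rint_split cm md); last first.
  by apply: ccontB; apply: HB; rewrite lexx ?ab.
have -> : \int[mu]_(x in `[a, b]) (A x c - A x d) =
    \int[mu]_(x in `[a, b]) (A x c - A x m) +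
    \int[mu]_(x in `[a, b]) (A x m - A x d).
  rewrite -RintegralD//; last 2 first.
  - by apply: ccont_integrable; apply: ccontB; apply: HA; rewrite ?lexx ?cm ?md ?cd.
  - by apply: ccont_integrable; apply: ccontB; apply: HA; rewrite ?lexx ?cm ?md ?cd.
  by apply: eq_Rintegral => y _; ring.
ring.
Qed.

(* The linear parts of [A] and [B] contribute [q] times the area with opposite
   signs, so that only the errors of the first-order expansion remain. *)
Lemma rect_int_small x y (e : R) : closed_form_at x y -> 0 < e ->
  exists2 d0 : R, 0 < d0 & forall a b c d,
    a <= x <= b -> c <= y <= d -> b - a < d0 -> d - c < d0 ->
    closed_form_on a b c d ->
    `|rect_int a b c d| <= e * ((b - a) + (d - c)) ^+ 2.
Proof.
move=> [p [q [r H]]] e0; have e20 : 0 < e / 2 by rewrite divr_gt0.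
have [d0 d00 {}H] := H _ e20; exists d0 => // a b c d /andP[ax xb] /andP[cy yd] bad dcd K.
have [HA HB] := closed_form_ccont K.
have ab := le_trans ax xb; have cd := le_trans cy yd.
have KA x' y' : a <= x' <= b -> c <= y' <= d ->
    `|A x' y' - A x y - p * (x' - x) - q * (y' - y)| <= e / 2 * ((b - a) + (d - c)) /\
    `|B x' y' - B x y - q * (x' - x) - r * (y' - y)| <= e / 2 * ((b - a) + (d - c)).
  move=> /andP[ax' xb'] /andP[cy' yd'].
  have hx : `|x' - x| <= b - a by rewrite ler_norml; apply/andP; split; lra.
  have hy : `|y' - y| <= d - c by rewrite ler_norml; apply/andP; split; lra.
  have [] := H (x' - x) (y' - y) (le_lt_trans hx bad) (le_lt_trans hy dcd).
  rewrite [x + _]addrC [y + _]addrC !subrK => H1 H2.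
  have L : e / 2 * (`|x' - x| + `|y' - y|) <= e / 2 * ((b - a) + (d - c)).
    by rewrite ler_wpM2l ?lerD// ltW.
  by split; [apply: le_trans L|apply: le_trans L].
set s := (b - a) + (d - c) in KA *.
have I1 : `|\int[mu]_(x in `[a, b]) (A x c - A x d) - (q * (c - d)) * (b - a)| <=
    e * s * (b - a).
  apply: Rint_near_cst => //; first by apply: ccontB; apply: HA; rewrite lexx ?cd.
  move=> x' x'ab.
  have cc : c <= c <= d by rewrite lexx.
  have dd : c <= d <= d by rewrite lexx cd.
  have [H1 _] := KA x' c x'ab cc.
  have [H2 _] := KA x' d x'ab dd.
  have := le_trans (ler_normB _ _) (lerD H1 H2).
  rewrite -mulrDl -splitr.
  by congr (`|_| <= _); ring.
have I2 : `|\int[mu]_(y in `[c, d]) (B b y - B a y) - (q * (b - a)) * (d - c)| <=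
    e * s * (d - c).
  apply: Rint_near_cst => //; first by apply: ccontB; apply: HB; rewrite lexx ?ab.
  move=> y' y'cd.
  have aa : a <= a <= b by rewrite lexx.
  have bb : a <= b <= b by rewrite lexx ab.
  have [_ H1] := KA b y' bb y'cd.
  have [_ H2] := KA a y' aa y'cd.
  have := le_trans (ler_normB _ _) (lerD H1 H2).
  rewrite -mulrDl -splitr.
  by congr (`|_| <= _); ring.
have := le_trans (ler_normD _ _) (lerD I1 I2).
have -> : e * s * (b - a) + e * s * (d - c) = e * s ^+ 2 by rewrite /s; ring.
rewrite /rect_int.
by congr (`|_| <= _); ring.
Qed.

(** Bisection in both coordinates at once, for a predicate on the generation and the lower left
    corner of a rectangle. The corners chosen in succession are nondecreasing in each coordinate,
    and the common point is their supremum. *)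
Lemma quadrisection (bad : nat -> R -> R -> Prop) (a c w0 h0 : R) :
  0 < w0 -> 0 < h0 -> bad 0 a c ->
  (forall n x y, bad n x y -> exists2 ij : bool * bool, True &
    bad n.+1 (x + ij.1%:R * (w0 / 2 ^+ n.+1)) (y + ij.2%:R * (h0 / 2 ^+ n.+1))) ->
  exists x y, forall d : R, 0 < d -> exists n x0 y0,
    [/\ bad n x0 y0,
      [/\ a <= x0 & x0 + w0 / 2 ^+ n <= a + w0],
      [/\ c <= y0 & y0 + h0 / 2 ^+ n <= c + h0],
      x0 <= x <= x0 + w0 / 2 ^+ n /\ y0 <= y <= y0 + h0 / 2 ^+ n &
      w0 / 2 ^+ n < d /\ h0 / 2 ^+ n < d].
Proof.
move=> w00 h00 bad0 step.
have /choice[f fP] (t : nat * (R * R)) : exists ij : bool * bool,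
    bad t.1 t.2.1 t.2.2 -> bad t.1.+1 (t.2.1 + ij.1%:R * (w0 / 2 ^+ t.1.+1))
      (t.2.2 + ij.2%:R * (h0 / 2 ^+ t.1.+1)).
  case: t => n [x y] /=.
  have [/step[ij _ H]|nb] := pselect (bad n x y); first by exists ij.
  by exists (false, false).
pose fix p n : R * R := if n is m.+1 then
  ((p m).1 + (f (m, p m)).1%:R * (w0 / 2 ^+ m.+1),
   (p m).2 + (f (m, p m)).2%:R * (h0 / 2 ^+ m.+1)) else (a, c).
have pbad n : bad n (p n).1 (p n).2.
  by elim: n => [//|n IH]; exact: (fP (n, p n) IH).
have H (u : nat -> R) (b : nat -> bool) s : 0 < s ->
    (forall n, u n.+1 = u n + (b n)%:R * (s / 2 ^+ n.+1)) ->
    exists x, forall n, u 0%N <= u n /\ u n + s / 2 ^+ n <= u 0%N + s /\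
      u n <= x <= u n + s / 2 ^+ n.
  move=> s0 uS.
  have half n : s / 2 ^+ n = s / 2 ^+ n.+1 + s / 2 ^+ n.+1.
    by rewrite exprS invfM; field; rewrite expf_neq0.
  have s1 n : 0 < s / 2 ^+ n by rewrite divr_gt0// exprn_gt0.
  have und : nondecreasing_seq u.
    apply/nondecreasing_seqP => n; rewrite uS lerDl mulr_ge0//; exact: ltW.
  have vni : nonincreasing_seq (fun n => u n + s / 2 ^+ n).
    apply/nonincreasing_seqP => n; rewrite uS (half n); have := s1 n.+1.
    by case: (b n) => /=; lra.
  have uv m n : u m <= u n + s / 2 ^+ n.
    apply: (le_trans (und _ _ (leq_maxl m n))).
    apply: le_trans (vni _ _ (leq_maxr m n)).
    by rewrite lerDl ltW.
  have hs : has_sup (range u).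
    split; first by exists (u 0%N), 0%N.
    by exists (u 0%N + s / 2 ^+ 0) => _ [n _ <-].
  exists (sup (range u)) => n; split; first exact: und.
  split; first by have := vni 0%N n (leq0n _); rewrite expr0 divr1.
  apply/andP; split; first by apply: ub_le_sup; [case: hs|exists n].
  by apply: ge_sup; [case: hs|move=> _ [m _ <-]].
have [x xP] := H (fun n => (p n).1) (fun n => (f (n, p n)).1) w0 w00 (fun n => erefl).
have [y yP] := H (fun n => (p n).2) (fun n => (f (n, p n)).2) h0 h00 (fun n => erefl).
exists x, y => d d0.
have L s : 0 < s -> \forall n \near \oo, s / 2 ^+ n < d.
  move=> s0; have : s / 2 ^+ n @[n --> \oo] --> (0 : R).
    rewrite -(mulr0 s); apply: cvgM; first exact: cvg_cst.
    under eq_fun do rewrite -exprVn.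
    apply: cvg_expr; rewrite ger0_norm ?invr_ge0// invf_lt1//; lra.
  move=> /cvgrPdist_lt/(_ _ d0); apply: filterS => n.
  by rewrite sub0r normrN; apply: le_lt_trans; exact: ler_norm.
have [n [Hn1 Hn2]] : exists n, w0 / 2 ^+ n < d /\ h0 / 2 ^+ n < d.
  by have [n _ Hn] := filterI (L _ w00) (L _ h00); exists n; apply: (Hn n) => /=.
exists n, (p n).1, (p n).2.
by have [? [? ?]] := xP n; have [? [? ?]] := yP n; split.
Qed.

(** Quartering keeps at least a quarter of the modulus of the integral, whereas near the limit point
    [rect_int_small] makes it arbitrarily small against the square of the side lengths. *)
Lemma goursat a b c d : a <= b -> c <= d -> closed_form_on a b c d ->
  rect_int a b c d = 0.
Proof.
move=> ab cd H; apply: contrapT => J0.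
have {J0} J0 : 0 < `|rect_int a b c d| by rewrite normr_gt0; apply/eqP.
(* Degenerate rectangles are settled directly, since [quadrisection] needs positive sides. *)
move: ab; rewrite le_eqVlt => /predU1P[E|ab].
  move: J0; rewrite /rect_int E set_itv1 Rintegral_set1 add0r.
  under eq_Rintegral do rewrite subrr.
  by rewrite Rint_cst// mul0r normr0 ltxx.
move: cd; rewrite le_eqVlt => /predU1P[E|cd].
  move: J0; rewrite /rect_int E set_itv1 Rintegral_set1 addr0.
  under eq_Rintegral do rewrite subrr.
  by rewrite Rint_cst ?ltW// mul0r normr0 ltxx.
set j := `|_| in J0; pose w0 := b - a; pose h0 := d - c.
have w00 : 0 < w0 by rewrite subr_gt0.
have h00 : 0 < h0 by rewrite subr_gt0.
have bE : b = a + w0 by rewrite /w0 addrC subrK.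
have dE : d = c + h0 by rewrite /h0 addrC subrK.
pose bad n x y := [/\ a <= x, x + w0 / 2 ^+ n <= b, c <= y, y + h0 / 2 ^+ n <= d &
  j / 4 ^+ n <= `|rect_int x (x + w0 / 2 ^+ n) y (y + h0 / 2 ^+ n)|].
have sub x x' y y' : a <= x -> x' <= b -> c <= y -> y' <= d -> closed_form_on x x' y y'.
  move=> ? ? ? ? s t /andP[? ?] /andP[? ?]; apply: H; apply/andP; split; lra.
have [|n x y [n1 n2 n3 n4 n5]|x [y xyP]] := @quadrisection bad a c w0 h0 w00 h00.
- by split; rewrite ?expr0 ?divr1 -?bE -?dE.
- set w := w0 / 2 ^+ n.+1; set h := h0 / 2 ^+ n.+1.
  have w2 : w0 / 2 ^+ n = w + w.
    by rewrite /w exprS invfM; field; rewrite expf_neq0.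
  have h2 : h0 / 2 ^+ n = h + h.
    by rewrite /h exprS invfM; field; rewrite expf_neq0.
  have wp : 0 < w by rewrite divr_gt0// exprn_gt0.
  have hp : 0 < h by rewrite divr_gt0// exprn_gt0.
  rewrite w2 in n2 n5; rewrite h2 in n4 n5.
  set J := fun i k : bool => rect_int (x + i%:R * w) (x + i%:R * w + w)
    (y + k%:R * h) (y + k%:R * h + h).
  have EJ : rect_int x (x + (w + w)) y (y + (h + h)) =
      J false false + J true false + J false true + J true true.
    have S0 : closed_form_on x (x + (w + w)) y (y + (h + h)) by apply: sub; lra.
    have S1 : closed_form_on x (x + w) y (y + (h + h)) by apply: sub; lra.
    have S2 : closed_form_on (x + w) (x + (w + w)) y (y + (h + h)).
      by apply: sub; lra.
    have xm : x <= x + w <= x + (w + w) by apply/andP; split; lra.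
    have ym : y <= y + h <= y + (h + h) by apply/andP; split; lra.
    have [xw1 xw2] := andP xm; have [yh1 yh2] := andP ym.
    rewrite (rect_int_splith xm (le_trans yh1 yh2) S0).
    rewrite (rect_int_splitv xw1 ym S1) (rect_int_splitv xw2 ym S2).
    rewrite /J !mul0r !mul1r !addr0 -!(addrA x) -!(addrA y).
    by rewrite addrACA !addrA.
  have [k jk] : exists ij : bool * bool, j / 4 ^+ n.+1 <= `|J ij.1 ij.2|.
    apply: contrapT => /forallNP K.
    have {}K i k : `|J i k| < j / 4 ^+ n.+1.
      by rewrite ltNge; apply/negP; exact: (K (i, k)).
    have j4 : j / 4 ^+ n = 4 * (j / 4 ^+ n.+1).
      by rewrite exprS invfM; field; rewrite expf_neq0.
    move: n5; rewrite EJ j4 leNgt => /negP; apply.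
    apply: le_lt_trans (ler_normD _ _) _.
    have := K false false; have := K true false; have := K false true.
    have := K true true.
    have := ler_normD (J false false) (J true false).
    have := ler_normD (J false false + J true false) (J false true).
    by lra.
  have bnd (i : bool) (u : R) : 0 < u -> 0 <= i%:R * u <= u.
    by move=> u0; case: i; rewrite ?mul1r ?mul0r ?lexx ltW.
  exists k => //; rewrite /bad -/w -/h.
  have /andP[k1 k2] := bnd k.1 _ wp; have /andP[k3 k4] := bnd k.2 _ hp; split.
  - by rewrite (le_trans n1)// lerDl.
  - by apply: le_trans n2; rewrite -addrA lerD2l lerD2r.
  - by rewrite (le_trans n3)// lerDl.
  - by apply: le_trans n4; rewrite -addrA lerD2l lerD2r.
  - exact: jk.
have [n0 [x0 [y0 [_ [L1 L2] [L3 L4] [/andP[L5 L6] /andP[L7 L8]] _]]]] := xyP 1 ltr01.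
have cxy : closed_form_at x y.
  apply: H; first by rewrite bE (le_trans L1 L5) (le_trans L6 L2).
  by rewrite dE (le_trans L3 L7) (le_trans L8 L4).
(* With this [e] the estimate of [rect_int_small] at generation [n] is half of [j / 4 ^+ n]. *)
pose e := j / (2 * (w0 + h0) ^+ 2).
have wh0 : 0 < w0 + h0 by rewrite addr_gt0.
have e0 : 0 < e by rewrite divr_gt0// mulr_gt0// exprn_gt0.
have [d0 d00 K0] := rect_int_small cxy e0.
have [n [x1 [y1 [[M1 M2 M3 M4 M5] _ _ [M6 M7] [M8 M9]]]]] := xyP d0 d00.
have sz (u v : R) : u + v - u = v by rewrite addrAC subrr add0r.
have := K0 x1 (x1 + w0 / 2 ^+ n) y1 (y1 + h0 / 2 ^+ n) M6 M7.
rewrite !sz => /(_ M8 M9 (sub _ _ _ _ M1 M2 M3 M4)) /(le_trans M5).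
have p2 : (2 ^+ n : R) != 0 by rewrite expf_neq0.
have -> : e * (w0 / 2 ^+ n + h0 / 2 ^+ n) ^+ 2 = (j / 4 ^+ n) / 2.
  have -> : (4 ^+ n : R) = 2 ^+ n ^+ 2.
    by rewrite -exprM mulnC exprM; congr (_ ^+ n); rewrite expr2; ring.
  by rewrite /e; field; rewrite p2 gt_eqF.
have : 0 < j / 4 ^+ n by rewrite divr_gt0// exprn_gt0.
by clear; set u := j / _; lra.
Qed.

End goursat.

(** * Circle means and Poisson's formula *)

Section circle_means.
Variable R : realType.
Local Notation C := R[i].
Local Notation mu := (@lebesgue_measure R).
Local Notation Ipi := `[- pi, (pi : R)]%classic.
Implicit Types (f g : C -> C) (z w a : C) (r s t : R).

Lemma Npi_le_pi : - pi <= pi :> R.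
Proof. by rewrite (le_trans _ (pi_ge0 R))// oppr_le0 pi_ge0. Qed.

Lemma ae_imp (P Q : R -> Prop) : (forall t, P t -> Q t) ->
  {ae mu, forall t, P t} -> {ae mu, forall t, Q t}.
Proof. exact: (@filterS _ _ (ae_filter_ringOfSetsType mu)). Qed.

Lemma ae_imp2 (P Q S : R -> Prop) : (forall t, P t -> Q t -> S t) ->
  {ae mu, forall t, P t} -> {ae mu, forall t, Q t} -> {ae mu, forall t, S t}.
Proof. exact: (@filterS2 _ _ (ae_filter_ringOfSetsType mu)). Qed.

Lemma Rint_dominated_ae (D : set R) (u : nat -> R -> R) (v g : R -> R) :
  measurable D -> (forall n, measurable_fun D (u n)) -> measurable_fun D v ->
  {ae mu, forall t, D t -> u n t @[n --> \oo] --> v t} ->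
  mu.-integrable D (EFin \o g) ->
  {ae mu, forall t, D t -> forall n, `|u n t| <= g t} ->
  mu.-integrable D (EFin \o v) /\
  \int[mu]_(t in D) u n t @[n --> \oo] --> \int[mu]_(t in D) v t.
Proof.
move=> mD mfu mv uv ig ug.
have [|||||iv _ H] := @dominated_convergence _ _ R mu D mD
  (fun n => EFin \o u n) (EFin \o v) (EFin \o g).
- by move=> n; apply/measurable_EFinP; exact: mfu.
- exact/measurable_EFinP.
- apply: ae_imp uv => t H Dt; apply/fine_cvgP; split; first exact: nearW.
  exact: H.
- exact: ig.
- by apply: ae_imp ug => t H n Dt /=; rewrite lee_fin; apply: H.
split => //; apply: fine_cvg; rewrite fineK; first exact: H.
exact: integrable_fin_num.
Qed.

Lemma Rint_dominated (D : set R) (u : nat -> R -> R) (v g : R -> R) :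
  measurable D -> (forall n, measurable_fun D (u n)) -> measurable_fun D v ->
  {ae mu, forall t, D t -> u n t @[n --> \oo] --> v t} ->
  mu.-integrable D (EFin \o g) -> (forall n t, D t -> `|u n t| <= g t) ->
  mu.-integrable D (EFin \o v) /\
  \int[mu]_(t in D) u n t @[n --> \oo] --> \int[mu]_(t in D) v t.
Proof.
move=> mD mfu mv uv ig ug; apply: (Rint_dominated_ae mD mfu mv uv ig).
by apply: aeW => t Dt n; exact: ug.
Qed.

Lemma polar z : exists2 t, - pi <= t <= pi & z = (normc z)%:C * expi t.
Proof.
have [->|z0] := eqVneq z 0.
  exists 0; first by rewrite oppr_le0 pi_ge0.
  by rewrite normc_real normr0 mul0r.
have n0 : 0 < normc z by rewrite normc_gt0.
pose x := complex.Re z / normc z.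
have x1 : -1 <= x <= 1.
  by rewrite -ler_norml normrM normfV (ger0_norm (ltW n0)) ler_pdivrMr// mul1r normr_Re_le.
have xz : complex.Re z = normc z * cos (acos x).
  by rewrite acosK ?in_itv//= mulrC divfK// gt_eqF.
have yz : `|complex.Im z| = normc z * sin (acos x).
  rewrite sin_acos//; apply/eqP.
  rewrite -(@eqrXn2 _ 2)// ?mulr_ge0 ?normc_ge0 ?sqrtr_ge0//; apply/eqP.
  rewrite exprMn sqr_sqrtr; last first.
    by rewrite subr_ge0 -(expr1n R 2) -real_normK ?num_real// ler_pXn2r ?nnegrE// ler_norml.
  rewrite real_normK ?num_real// /x expr_div_n mulrBr mulr1.
  rewrite mulrC divfK ?expf_neq0 ?gt_eqF// sqr_normcE; ring.
have [y0|y0] := leP 0 (complex.Im z).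
  exists (acos x).
    by rewrite acos_lepi// andbT (le_trans _ (acos_ge0 x1))// oppr_le0 pi_ge0.
  by apply: complexP; rewrite ?cReM ?cImM /= !mul0r ?subr0 ?addr0// -yz ger0_norm.
exists (- acos x).
  by rewrite lerN2 acos_lepi//= lerNl (le_trans _ (acos_ge0 x1))// oppr_le0 pi_ge0.
apply: complexP; rewrite ?cReM ?cImM /= !mul0r ?subr0 ?addr0 ?cosN//.
by rewrite sinN mulrN -yz ltr0_norm ?opprK.
Qed.

Lemma normc_polar r t : normc (r%:C * expi t) = `|r|.
Proof. by rewrite normcM normc_expi mulr1 normc_real. Qed.

Lemma normc_polar_ge0 r t : 0 <= r -> normc (r%:C * expi t) = r.
Proof. by move=> r0; rewrite normc_polar ger0_norm. Qed.

Lemma cvg_polar (T : Type) (F : set_system T) {FF : Filter F} (u v : T -> R) r t :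
  u x @[x --> F] --> r -> v x @[x --> F] --> t ->
  ((u x)%:C * expi (v x) : C^o) @[x --> F] --> (r%:C * expi t : C^o).
Proof.
move=> ur vt; apply/cvg_ReIm; split.
  under eq_fun do rewrite cReM /= mul0r subr0.
  rewrite cReM /= mul0r subr0; apply: cvgM => //.
  exact: (cvg_comp _ _ vt (@continuous_cos R t)).
under eq_fun do rewrite cImM /= mul0r addr0.
rewrite cImM /= mul0r addr0; apply: cvgM => //.
exact: (cvg_comp _ _ vt (@continuous_sin R t)).
Qed.

Lemma cvg_circle (T : Type) (F : set_system T) {FF : Filter F} f (u v : T -> R) r t :
  {for (r%:C * expi t : C^o), continuous (f : C^o -> C^o)} ->
  u x @[x --> F] --> r -> v x @[x --> F] --> t ->
  (f ((u x)%:C * expi (v x)) : C^o) @[x --> F] --> (f (r%:C * expi t) : C^o).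
Proof.
by move=> fc ur vt; apply: (cvg_comp _ _ (cvg_polar ur vt) fc).
Qed.

Lemma continuous_circle f r t :
  {for (r%:C * expi t : C^o), continuous (f : C^o -> C^o)} ->
  [/\ {for t, continuous (fun t => complex.Re (f (r%:C * expi t)))},
      {for t, continuous (fun t => complex.Im (f (r%:C * expi t)))} &
      {for t, continuous (fun t => normc (f (r%:C * expi t)))}].
Proof.
move=> fc; have H : (f (r%:C * expi x) : C^o) @[x --> t] --> (f (r%:C * expi t) : C^o).
  by apply: (@cvg_circle _ _ _ f (cst r) id) => //; exact: cvg_cst.
by have /cvg_ReIm[? ?] := H; split => //; exact: (cvg_normc H).
Qed.

(** The form is Im (g dz). If the derivative of [g] is p + iq, then d(Im g) = q dx + p dy and d(Re
    g) = p dx - q dy; the shared coefficient p is a Cauchy-Riemann equation. *)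
Lemma cdiff_closed_form g x y : cdiff g (x +i* y) ->
  closed_form_at (fun x y => complex.Im (g (x +i* y)))
    (fun x y => complex.Re (g (x +i* y))) x y.
Proof.
move=> /cdiffP[[p q] H]; exists q, p, (- q) => e e0.
have [d d0 {}H] := H e e0; exists (d / 2); first by rewrite divr_gt0.
move=> h k hd kd.
have hk : normc (h +i* k) <= `|h| + `|k| by apply: normc_le_ReIm.
have E : (x + h) +i* (y + k) - (x +i* y) = h +i* k.
  by apply: complexP => /=; ring.
have := H ((x + h) +i* (y + k)); rewrite E => {}H.
have {}H : normc (g ((x + h) +i* (y + k)) - g (x +i* y) - (p +i* q) * (h +i* k)) <=
    e * (`|h| + `|k|).
  have hkd : normc (h +i* k) < d.
    by apply: le_lt_trans hk _; rewrite [d]splitr ltrD.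
    exact: le_trans (H hkd) (ler_wpM2l (ltW e0) hk).
set G := g ((x + h) +i* (y + k)) in H *; set G0 := g (x +i* y) in H *.
split; apply: le_trans H.
- have -> : complex.Im G - complex.Im G0 - q * h - p * k =
      complex.Im (G - G0 - (p +i* q) * (h +i* k)).
    by rewrite !cImD !cImN cImM /=; ring.
  exact: normr_Im_le.
- have -> : complex.Re G - complex.Re G0 - p * h - - q * k =
      complex.Re (G - G0 - (p +i* q) * (h +i* k)).
    by rewrite !cReD !cReN cReM /=; ring.
  exact: normr_Re_le.
Qed.

Definition cmean f r := \int[mu]_(t in Ipi) complex.Re (f (r%:C * expi t)).

Lemma expiBpi t : expi (- pi) = expi pi :> C.
Proof. by rewrite /expi cosN sinN sinpi oppr0. Qed.

(** The exponential pulls the annulus back to the rectangle with sides [[ln r, ln s]] and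
    [[- pi, pi]]. The horizontal sides cancel by periodicity, and the vertical sides give the two
    circle means. *)
Lemma cmean_open_annulus f (r1 r2 r s : R) : 0 <= r1 ->
  (forall z, r1 < normc z < r2 -> cdiff f z) ->
  r1 < r -> r <= s -> s < r2 -> cmean f r = cmean f s.
Proof.
move=> r10 df r1r rs sr2.
have r0 : 0 < r := le_lt_trans r10 r1r.
have s0 : 0 < s := lt_le_trans r0 rs.
have lnrs : ln r <= ln s by rewrite ler_ln.
have H : closed_form_on (fun x y => complex.Im (f (cexp (x +i* y))))
    (fun x y => complex.Re (f (cexp (x +i* y)))) (ln r) (ln s) (- pi) pi.
  move=> x y /andP[rx xs] _.
  apply: (@cdiff_closed_form (f \o @cexp R)); apply: cdiff_comp; first exact: cdiff_cexp.
  apply: df; rewrite normc_cexp /=; apply/andP; split.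
    by apply: (lt_le_trans r1r); rewrite -[r]lnK// ler_expR.
  by apply: le_lt_trans sr2; rewrite -[s]lnK// ler_expR.
have := goursat lnrs Npi_le_pi H; rewrite /rect_int.
have E x t : 0 < x -> cexp (ln x +i* t) = x%:C * expi t.
  by move=> x0; rewrite /cexp /= lnK.
under eq_Rintegral.
  move=> x _.
  have -> : cexp (x +i* - pi) = cexp (x +i* pi) by rewrite /cexp /= expiBpi.
  rewrite subrr; over.
rewrite Rint_cst// mul0r add0r.
under eq_Rintegral do rewrite !E//.
rewrite RintegralB//=.
- by move/eqP; rewrite subr_eq0 => /eqP; rewrite /cmean => ->.
- apply: ccont_integrable => t _.
  have := df (s%:C * expi t); rewrite normc_polar_ge0 ?ltW// (lt_le_trans r1r rs) sr2.
  by move=> /(_ isT)/cdiff_continuous/continuous_circle[].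
- apply: ccont_integrable => t _.
  have := df (r%:C * expi t); rewrite normc_polar_ge0 ?ltW// r1r (le_lt_trans rs sr2).
  by move=> /(_ isT)/cdiff_continuous/continuous_circle[].
Qed.

End circle_means.

Section poisson_formula.
Variable R : realType.
Local Notation C := R[i].
Local Notation mu := (@lebesgue_measure R).
Local Notation Ipi := `[- pi, (pi : R)]%classic.
Implicit Types (f g : C -> C) (z w a : C) (r s t : R).

Lemma bounded_annulus f r1 r2 : 0 <= r1 ->
  (forall z, r1 <= normc z <= r2 -> {for (z : C^o), continuous (f : C^o -> C^o)}) ->
  exists2 M : R, 0 < M & forall z, r1 <= normc z <= r2 -> normc (f z) <= M.
Proof.
move=> r10 fc.
pose h (p : R * R) := normc (f (p.1%:C * expi p.2)).
have hc : {within `[r1, r2]%classic `*` Ipi, continuous h}.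
  apply: continuous_in_subspaceT => -[r t]; rewrite inE /= => -[].
  rewrite /= !in_itv/= => r12 _.
  have fc' : {for (r%:C * expi t : C^o), continuous (f : C^o -> C^o)}.
    have r0 : 0 <= r by case/andP: r12 => + _; exact: le_trans.
    by apply: fc; rewrite normc_polar_ge0.
  apply: cvg_normc; apply: (@cvg_circle _ _ _ _ f fst snd r t) => //.
    exact: cvg_fst.
  exact: cvg_snd.
have cK : compact (`[r1, r2]%classic `*` Ipi).
  by apply: compact_setX; exact: segment_compact.
have /compact_bounded := continuous_compact hc cK.
move=> [M [Mr MP]]; exists (`|M| + 1); first by rewrite ltr_wpDl.
move=> z zr.
have [t tI zE] := polar z.
have MM : M < `|M| + 1 by rewrite (le_lt_trans (ler_norm _))// ltrDl.
have := MP _ MM (normc (f z)); rewrite /= ger0_norm ?normc_ge0//; apply.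
by exists (normc z, t); rewrite /= ?in_itv//= /h/= -zE.
Qed.

Lemma ccont_circle f r : 0 <= r ->
  (forall z, normc z = r -> {for (z : C^o), continuous (f : C^o -> C^o)}) ->
  ccont (fun t => complex.Re (f (r%:C * expi t))) (- pi) pi.
Proof.
move=> r0 fc t _.
by have [] := @continuous_circle _ f r t (fc _ (normc_polar_ge0 _ r0)).
Qed.

Lemma cvg_cmean f r1 r2 (u : nat -> R) r : 0 <= r1 ->
  (forall z, r1 <= normc z <= r2 -> {for (z : C^o), continuous (f : C^o -> C^o)}) ->
  (forall n, r1 <= u n <= r2) -> r1 <= r <= r2 ->
  u n @[n --> \oo] --> r -> cmean f (u n) @[n --> \oo] --> cmean f r.
Proof.
move=> r10 fc u12 r12 ur; have [M M0 fM] := bounded_annulus r10 fc.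
have pos s : r1 <= s <= r2 -> 0 <= s by case/andP => + _; exact: le_trans.
have mf s : r1 <= s <= r2 -> measurable_fun Ipi (fun t => complex.Re (f (s%:C * expi t))).
  move=> s12; have /integrableP[] : mu.-integrable Ipi (EFin \o (fun t => complex.Re (f (s%:C * expi t)))).
    by apply: ccont_integrable; apply: ccont_circle; [exact: pos|move=> z zs; apply: fc; rewrite zs].
  by move=> /measurable_EFinP.
have [||||||] := @Rint_dominated R Ipi (fun n t => complex.Re (f ((u n)%:C * expi t)))
  (fun t => complex.Re (f (r%:C * expi t))) (cst M) => //.
- by move=> n; apply: mf.
- exact: mf.
- apply: aeW => t _.
  have fr : {for (r%:C * expi t : C^o), continuous (f : C^o -> C^o)}.
    by apply: fc; rewrite normc_polar_ge0// pos.
  have : (f ((u x)%:C * expi t) : C^o) @[x --> \oo] --> (f (r%:C * expi t) : C^o).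
    by apply: (@cvg_circle _ _ _ _ f u (cst t)) => //; exact: cvg_cst.
  by move=> /cvg_ReIm[].
- by apply: ccont_integrable => t _; exact: cvg_cst.
- move=> n t _; apply: le_trans (normr_Re_le _) (fM _ _).
  by rewrite normc_polar_ge0// pos.
Qed.

Lemma cmean_closed_annulus f r1 r2 : 0 <= r1 -> r1 < r2 ->
  (forall z, r1 <= normc z <= r2 -> {for (z : C^o), continuous (f : C^o -> C^o)}) ->
  (forall z, r1 < normc z < r2 -> cdiff f z) -> cmean f r1 = cmean f r2.
Proof.
move=> r10 r12 fc df.
(* Half the width, so that the radii [r1 + d * h n] and [r2 - d * h n] never cross. *)
pose d := (r2 - r1) / 2.
have d0 : 0 < d by rewrite divr_gt0// subr_gt0.
have dE : r1 + d + d = r2 by rewrite /d; lra.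
pose h n : R := n.+1%:R^-1.
have h01 n : 0 < h n <= 1.
  by rewrite invr_gt0 ltr0n/= invf_le1 ?ltr0n// ler1n.
have dh n : 0 < d * h n <= d.
  by have /andP[h0 h1] := h01 n; rewrite mulr_gt0//= ler_piMr// ltW.
have hcvg : d * h n @[n --> \oo] --> (0 : R).
  by rewrite -(mulr0 d); apply: cvgM; [exact: cvg_cst|exact: cvg_harmonic].
have c1 : cmean f (r1 + d * h n) @[n --> \oo] --> cmean f r1.
  apply: (@cvg_cmean f r1 r2) => //.
  - by move=> n; have /andP[? ?] := dh n; apply/andP; split; lra.
  - by rewrite lexx ltW.
  - by rewrite -[X in _ --> X]addr0; apply: cvgD => //; exact: cvg_cst.
have c2 : cmean f (r2 - d * h n) @[n --> \oo] --> cmean f r2.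
  apply: (@cvg_cmean f r1 r2) => //.
  - by move=> n; have /andP[? ?] := dh n; apply/andP; split; lra.
  - by rewrite lexx ltW.
  - by rewrite -[X in _ --> X]subr0; apply: cvgB => //; exact: cvg_cst.
have E : (fun n => cmean f (r1 + d * h n)) = (fun n => cmean f (r2 - d * h n)).
  apply/funext => n; have /andP[? ?] := dh n.
  by apply: (@cmean_open_annulus _ f r1 r2) => //; lra.
rewrite E in c1.
by rewrite -(cvg_lim (@Rhausdorff R) c1) -(cvg_lim (@Rhausdorff R) c2).
Qed.

Lemma cmean0 f : cmean f 0 = complex.Re (f 0) * (2 * pi).
Proof.
rewrite /cmean; under eq_Rintegral do rewrite mul0r.
by rewrite Rint_cst ?Npi_le_pi//; congr (_ * _); ring.
Qed.

(* The mean value property survives one exceptional circle on which the function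
   is only continuous; this replaces the removal of singularities. *)
Lemma cmean_center f p r : 0 <= p -> p < r ->
  (forall z, normc z <= r -> {for (z : C^o), continuous (f : C^o -> C^o)}) ->
  (forall z, normc z < r -> normc z != p -> cdiff f z) ->
  cmean f r = complex.Re (f 0) * (2 * pi).
Proof.
move=> p0 pr fc df; rewrite -cmean0.
have <- : cmean f p = cmean f r.
  apply: cmean_closed_annulus => // [z /andP[_ zr]|z /andP[pz zr]]; first exact: fc.
  by apply: df => //; rewrite gt_eqF.
move: p0; rewrite le_eqVlt => /predU1P[<-//|p0].
apply/esym; apply: cmean_closed_annulus => // [z /andP[_ zr]|z /andP[pz zr]].
  by apply: fc; rewrite (le_trans zr)// ltW.
by apply: df; [exact: lt_trans pr|rewrite lt_eqF].
Qed.

(** The Poisson kernel, with total mass [2 * pi]. *)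
Definition pk z t : R := complex.Re (herglotz_kernel z t).

Lemma conjcM z w : (conjc (z * w)) = (conjc z) * (conjc w).
Proof. exact: rmorphM. Qed.

Lemma conjcD z w : (conjc (z + w)) = (conjc z) + (conjc w).
Proof. exact: rmorphD. Qed.

Lemma conjcB z w : (conjc (z - w)) = (conjc z) - (conjc w).
Proof. exact: rmorphB. Qed.

Lemma conjcV z : (conjc (z^-1)) = (conjc z)^-1.
Proof. exact: fmorphV. Qed.

Lemma ReM_conj z w : complex.Re z * complex.Re w = complex.Re (w * ((z + (conjc z)) / 2)).
Proof.
have -> : (z + (conjc z)) / 2 = (complex.Re z)%:C by rewrite addcJ mulrC mulKf.
by rewrite cReM /= mulr0 subr0 mulrC.
Qed.

Lemma conj_circle r t : (conjc (r%:C * expi t)) * (r%:C * expi t) = (r ^+ 2)%:C.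
Proof.
apply: complexP => /=; last by ring.
by rewrite -[RHS]mulr1 -(cos2Dsin2 t); ring.
Qed.

(** On the circle of radius [r] the integrand is the real part of the function [W], which is
    continuous on the closed disc and holomorphic inside off one circle, with [W 0] the conjugate of
    [f a]. The mean value property of [W] is then the claim. *)
Lemma poisson_formula f r z : 0 < r < 1 -> normc z < 1 ->
  (forall w, normc w < 1 -> cdiff f w) ->
  \int[mu]_(t in Ipi) (pk z t * complex.Re (f (r%:C * expi t))) =
  2 * pi * complex.Re (f (r%:C * z)).
Proof.
move=> /andP[r0 r1] z1 df; set a := r%:C * z.
have ar : normc a < r.
  by rewrite normcM normc_real gtr0_norm// -[ltRHS]mulr1 ltr_pM2l.
have a1 : normc a < 1 by exact: lt_trans r1.
pose r2 : C := (r ^+ 2)%:C.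
have [l lP] := (cdiffP f a).1 (df a a1).
pose g w := if w == a then l else (f w - f a) / (w - a).
pose H w := f w * ((conjc a) * w) / (r2 - (conjc a) * w) + (conjc (f a)) * r2 / (r2 - (conjc a) * w).
have gE w : w != a -> g w = (f w - f a) / (w - a) by rewrite /g => /negbTE ->.
have dg w : normc w < 1 -> w != a -> cdiff g w.
  move=> w1 wa; have nwa : 0 < normc (w - a) by rewrite normc_gt0 subr_eq0.
  apply: (@eq_cdiff _ (fun w => (f w - f a) * (w - a)^-1) _ w (normc (w - a))) => //.
    move=> v vw; rewrite gE//; apply: contraTneq vw => ->.
    by rewrite normcB ltxx.
  apply: cdiffM; first by apply: cdiffB; [exact: df|exact: cdiff_cst].
  apply: cdiffV; first by rewrite subr_eq0.
  by apply: cdiffB; [exact: cdiff_id|exact: cdiff_cst].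
have cg w : normc w < 1 -> {for (w : C^o), continuous (g : C^o -> C^o)}.
  move=> w1; have [->|wa] := eqVneq w a; last exact: cdiff_continuous (dg _ w1 wa).
  apply/continuousCP => e e0.
  have e20 : 0 < e / 2 by rewrite divr_gt0.
  have [d d0 {}lP] := lP _ e20; exists d => // v va.
  rewrite [g a]/g eqxx /g; case: (eqVneq v a) => [_|vna].
    by rewrite subrr normc_real normr0.
  have vnz : v - a != 0 by rewrite subr_eq0.
  have -> : (f v - f a) / (v - a) - l = (f v - f a - l * (v - a)) / (v - a) by field.
  rewrite normcM normcV ltr_pdivrMr ?normc_gt0//.
  apply: le_lt_trans (lP _ va) _.
  by rewrite ltr_pM2r ?normc_gt0//; lra.
have den w : normc w <= r -> r2 - (conjc a) * w != 0.
  move=> wr; rewrite subr_eq0; apply/eqP => E.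
  have : normc r2 <= normc a * r.
    by rewrite E normcM normcJ ler_wpM2l ?normc_ge0.
  rewrite normc_real ger0_norm ?sqr_ge0// expr2 leNgt => /negP; apply.
  by rewrite ltr_pM2r.
have dH w : normc w <= r -> cdiff H w.
  move=> wr; have w1 : normc w < 1 by exact: le_lt_trans r1.
  have dd : cdiff (fun w => (r2 - (conjc a) * w)^-1) w.
    apply: cdiffV; first exact: den.
    apply: cdiffB; first exact: cdiff_cst.
    by apply: cdiffM; [exact: cdiff_cst|exact: cdiff_id].
  apply: cdiffD; apply: cdiffM => //.
  apply: cdiffM; first exact: df.
  by apply: cdiffM; [exact: cdiff_cst|exact: cdiff_id].
pose W w := w * g w + H w.
have E t : pk z t * complex.Re (f (r%:C * expi t)) = complex.Re (W (r%:C * expi t)).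
  have -> : pk z t = complex.Re ((r%:C * expi t + a) / (r%:C * expi t - a)).
    rewrite /pk /herglotz_kernel /a -mulrDr -mulrBr -mulf_div divff ?mul1r//.
    by rewrite -normc_gt0 normc_real normr_gt0 gt_eqF.
  set w := r%:C * expi t.
  have nw : normc w = r by rewrite normc_polar_ge0// ltW.
  have wa : w != a by apply/eqP => wa; move: ar; rewrite -wa nw ltxx.
  have wa0 : w - a != 0 by rewrite subr_eq0.
  have w0 : w != 0 by rewrite -normc_gt0 nw.
  (* This identity on the circle turns every conjugate of [w] into a rational function of [w]. *)
  have wb : (conjc w) * w = r2 by rewrite conj_circle.
  have wb0 : (conjc w) - (conjc a) != 0 by rewrite -conjcB conjc_eq0.
  have den' := den w; rewrite nw lexx in den'.
  have {}den' := den' isT.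
  rewrite ReM_conj conjcM conjcV conjcD conjcB.
  have -> : ((w + a) / (w - a) + ((conjc w) + (conjc a)) / ((conjc w) - (conjc a))) / 2 =
      w / (w - a) + ((conjc a) * w) / (r2 - (conjc a) * w).
    move: den'; rewrite -wb => den'; field; rewrite wb0 wa0 andbT/=.
    by rewrite den'.
  rewrite mulrDr /W gE// /H.
  have -> : f w * (w / (w - a)) = w * ((f w - f a) / (w - a)) + f a * (w / (w - a)).
    by field.
  (* Only the real part matters, so the term with a pole at [a] is replaced by its conjugate, which
     on the circle agrees with a function regular inside. *)
  have -> : (conjc (f a)) * r2 / (r2 - (conjc a) * w) = (conjc (f a * (w / (w - a)))).
    rewrite (conjcM (f a)) (conjcM w) conjcV conjcB -wb; move: den'; rewrite -wb => den'.
    by field; rewrite wb0 den'.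
  have Rec v : complex.Re (conjc v) = complex.Re v by case: v.
  by rewrite !cReD Rec -[f w * _ / _]mulrA; ring.
under eq_Rintegral do rewrite E.
(* The difference quotient [g] is only known to be continuous at [a], which makes the circle of
   radius [normc a] exceptional. *)
rewrite -/(cmean W r) (@cmean_center W (normc a)); first last.
- move=> w wr wa; apply: cdiffD; last by apply: dH; exact: ltW.
  apply: cdiffM; first exact: cdiff_id.
  by apply: dg; [exact: lt_trans r1|apply: contraNneq wa => ->].
- move=> w wr; have w1 : normc w < 1 by exact: le_lt_trans r1.
  apply: (@continuousD _ C^o C^o); last exact: cdiff_continuous (dH _ wr).
  apply: (@continuousM _ C^o) => //; last exact: cg.
- exact: ar.
- exact: normc_ge0.
rewrite /W /H mul0r add0r !mulr0 mul0r add0r subr0 mulfK; first by case: (f a) => x y; rewrite mulrC.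
by rewrite -normc_gt0 normc_real normr_gt0 expf_neq0// gt_eqF.
Qed.

End poisson_formula.

(** * Poisson kernel and Fatou's theorem *)

Section poisson_kernel.
Variable R : realType.
Local Notation C := R[i].
Local Notation mu := (@lebesgue_measure R).
Local Notation Ipi := `[- pi, (pi : R)]%classic.
Implicit Types (z w : C) (r s t x y : R).

Lemma RintegrableZ (D : set R) (c : R) (X : R -> R) : measurable D ->
  mu.-integrable D (EFin \o X) -> mu.-integrable D (EFin \o (fun s => c * X s)).
Proof. by move=> mD iX; exact: (@integrableZl _ _ R mu D mD c _ iX). Qed.

Lemma RintegrableD (D : set R) (X Y : R -> R) : measurable D ->
  mu.-integrable D (EFin \o X) -> mu.-integrable D (EFin \o Y) ->
  mu.-integrable D (EFin \o (fun s => X s + Y s)).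
Proof. by move=> mD iX iY; exact: (@integrableD _ _ R mu D mD _ _ iX iY). Qed.

Lemma RintegrableB (D : set R) (X Y : R -> R) : measurable D ->
  mu.-integrable D (EFin \o X) -> mu.-integrable D (EFin \o Y) ->
  mu.-integrable D (EFin \o (fun s => X s - Y s)).
Proof. by move=> mD iX iY; exact: (@integrableB _ _ R mu D mD _ _ iX iY). Qed.

Lemma integrableM_bounded (D : set R) (h X : R -> R) (M : R) :
  measurable D -> measurable_fun D h -> (forall s, D s -> `|h s| <= M) ->
  mu.-integrable D (EFin \o X) ->
  mu.-integrable D (EFin \o (fun s => h s * X s)).
Proof.
move=> mD mh hM iX.
have mX : measurable_fun D X by apply/measurable_EFinP; exact: (measurable_int mu).
have iMX : mu.-integrable D (EFin \o (fun s => `|M| * `|X s|)).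
  have -> : (EFin \o (fun s => `|M| * `|X s|)) = (fun s => `|M|%:E * `|(EFin \o X) s|)%E.
    by apply/funext => s /=.
  by apply: integrableZl => //; exact: integrable_abse.
apply: le_integrable iMX => //.
  by apply/measurable_EFinP; apply: measurable_funM.
move=> s Ds /=; rewrite lee_fin !normrM !normr_id ler_wpM2r//.
exact: le_trans (hM _ Ds) (ler_norm _).
Qed.

Lemma sqr_normcC z : (normc z ^+ 2)%:C = z * conjc z.
Proof. by rewrite sqr_normcE; case: z => a b; apply: complexP => /=; ring. Qed.

Lemma pkE z t : normc z < 1 ->
  pk z t = (1 - normc z ^+ 2) / normc (expi t - z) ^+ 2.
Proof.
move=> z1; have nz : expi t - z != 0.
  rewrite subr_eq0; apply/eqP => E; move: z1; rewrite -E normc_expi ltxx.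
  by [].
have nn : normc (expi t - z) ^+ 2 != 0 by rewrite expf_neq0// normc_eq0.
rewrite /pk /herglotz_kernel.
have -> : (expi t + z) / (expi t - z) =
    (expi t + z) * conjc (expi t - z) * ((normc (expi t - z) ^+ 2)^-1)%:C.
  have V x : (x^-1)%:C = (x%:C)^-1 :> C by exact: fmorphV.
  rewrite V sqr_normcC.
  have nzc : conjc (expi t - z) != 0 by rewrite conjc_eq0.
  move: (expi t - z) (expi t + z) nz nzc => v u nz nzc {nn}.
  by move: (conjc v) nzc => w nzc; field; rewrite nz nzc.
rewrite cReM /= mulr0 subr0; congr (_ / _).
have := normc_expi t; move: (expi t) => [a b] /(congr1 (fun x => x ^+ 2)).
rewrite !sqr_normcE; case: z {nz nn z1} => c d /=; rewrite expr1n => <-; ring.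
Qed.

Lemma normc_expiB_gt0 z t : normc z < 1 -> 0 < normc (expi t - z) ^+ 2.
Proof.
move=> z1; rewrite exprn_gt0// normc_gt0 subr_eq0; apply/eqP => E.
by move: z1; rewrite -E normc_expi ltxx.
Qed.

Lemma normc_expiB_bounds z t : 1 - normc z <= normc (expi t - z) <= 1 + normc z.
Proof.
rewrite -{1 2}(normc_expi t); apply/andP; split.
  have := ler_normcB_dist (expi t) z; exact: le_trans (ler_norm _).
by rewrite -[normc z in leRHS]normcN le_normcD.
Qed.

(** A weakening of Harnack's bound (1 - |z|) / (1 + |z|), obtained from |e^(it) - z| <= 1 + |z|. *)
Lemma pk_ge z t : normc z < 1 -> (1 - normc z) / 2 <= pk z t.
Proof.
move=> z1; rewrite pkE// ler_pdivlMr ?normc_expiB_gt0//.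
have /andP[_ H] := normc_expiB_bounds z t; have n0 := normc_ge0 z.
have p0 := normc_ge0 (expi t - z).
move: (normc z) (normc (expi t - z)) z1 H n0 p0 => m d m1 dm m0 d0.
have d2 : d ^+ 2 <= (1 + m) ^+ 2 by rewrite ler_pXn2r ?nnegrE ?addr_ge0.
have : (1 - m) / 2 * d ^+ 2 <= (1 - m) / 2 * (1 + m) ^+ 2.
  by rewrite ler_wpM2l// divr_ge0// subr_ge0 ltW.
move=> /le_trans; apply.
have : 0 <= (1 + m) * ((1 - m) * (1 - m)).
  by rewrite mulr_ge0 ?addr_ge0// -expr2 sqr_ge0.
by lra.
Qed.

Lemma pk_gt0 z t : normc z < 1 -> 0 < pk z t.
Proof.
by move=> z1; apply: lt_le_trans (pk_ge t z1); rewrite divr_gt0// subr_gt0.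
Qed.

Lemma pk_le z t : normc z < 1 -> pk z t <= 2 / (1 - normc z).
Proof.
move=> z1; rewrite pkE// ler_pdivrMr ?normc_expiB_gt0//.
have /andP[H _] := normc_expiB_bounds z t; have n0 := normc_ge0 z.
have m10 : 0 < 1 - normc z by rewrite subr_gt0.
move: (normc z) (normc (expi t - z)) z1 H n0 m10 => m d m1 dm m0 m10.
have d2 : (1 - m) ^+ 2 <= d ^+ 2 by rewrite ler_pXn2r ?nnegrE// ltW// (lt_le_trans m10).
have -> : 2 / (1 - m) * d ^+ 2 = 2 * (d ^+ 2 / (1 - m)) by field; rewrite gt_eqF.
have : 1 - m <= d ^+ 2 / (1 - m) by rewrite ler_pdivlMr// -expr2.
nra.
Qed.

Lemma normr_pk_le z t : normc z < 1 -> `|pk z t| <= 2 / (1 - normc z).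
Proof. by move=> z1; rewrite ger0_norm ?pk_le// ltW// pk_gt0. Qed.

Lemma cvg_expi t : (expi x : C^o) @[x --> t] --> (expi t : C^o).
Proof.
apply/cvg_ReIm; split; [exact: continuous_cos|exact: continuous_sin].
Qed.

Lemma continuous_herglotz z t : normc z < 1 ->
  {for t, continuous (fun t => herglotz_kernel z t : C^o)}.
Proof.
move=> z1; apply: (@cvgM C^o); first by apply: (@cvgD _ C^o); [exact: cvg_expi|exact: cvg_cst].
apply: (@cvgV C^o).
  by have := normc_expiB_gt0 t z1; rewrite exprn_even_gt0//= normc_eq0.
by apply: (@cvgB _ C^o); [exact: cvg_expi|exact: cvg_cst].
Qed.

Lemma continuous_pk z : normc z < 1 -> continuous (pk z).
Proof. by move=> z1 t; have /cvg_ReIm[] := @continuous_herglotz z t z1. Qed.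

Lemma measurable_pk z (D : set R) : measurable D -> normc z < 1 -> measurable_fun D (pk z).
Proof.
move=> mD z1; apply: measurable_funS (@continuous_measurable_fun _ _ (continuous_pk z1)) => //.
Qed.

Lemma integrable_pkM z u : normc z < 1 -> mu.-integrable Ipi (EFin \o u) ->
  mu.-integrable Ipi (EFin \o (fun s => pk z s * u s)).
Proof.
move=> z1; apply: (@integrableM_bounded _ _ _ (2 / (1 - normc z))) => //.
  exact: measurable_pk.
by move=> s _; exact: normr_pk_le.
Qed.

(** Poisson's formula for the constant function 1; the radius 1/2 is arbitrary. *)
Lemma integral_pk z : normc z < 1 -> \int[mu]_(t in Ipi) pk z t = 2 * pi.
Proof.
move=> z1; have h12 : 0 < (2^-1 : R) < 1.
  by rewrite invr_gt0 ltr0n invf_lt1// ltr1n.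
have := @poisson_formula _ (fun=> 1) 2^-1 z h12 z1.
rewrite /= !mulr1 => <-; last by move=> w _; exact: cdiff_cst.
by apply: eq_Rintegral => t _; rewrite mulr1.
Qed.

Lemma pk_polarE r s t : 0 <= r < 1 ->
  pk (r%:C * expi s) t = (1 - r ^+ 2) / (1 - 2 * r * cos (t - s) + r ^+ 2).
Proof.
move=> /andP[r0 r1]; rewrite pkE ?normc_polar_ge0//; congr (_ / _).
rewrite sqr_normcE !cReD !cImD !cReN !cImN cReM cImM /= !mul0r subr0 addr0 cosB.
have := cos2Dsin2 s; have := cos2Dsin2 t.
move: (cos s) (sin s) (cos t) (sin t) => a b c d H1 H2.
have -> : (c - r * a) ^+ 2 + (d - r * b) ^+ 2 =
  (c ^+ 2 + d ^+ 2) - 2 * r * (c * a + d * b) + r ^+ 2 * (a ^+ 2 + b ^+ 2) by ring.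
by rewrite H1 H2 mulr1.
Qed.

(** The function sin x - x cos x vanishes at 0 and has derivative x sin x. *)
Lemma sin_ge_mulcos x : 0 <= x <= pi / 2 -> x * cos x <= sin x.
Proof.
move=> /andP[x0 xpi].
pose f (x : R) := sin x - x * cos x.
have df (y : R) : is_derive y 1 f (y * sin y).
  rewrite /f; apply: is_derive_eq; rewrite /GRing.scale /=; ring.
have cf : continuous f.
  by move=> y; apply/differentiable_continuous/derivable1_diffP; case: (df y).
have : f 0 <= f x.
  apply: (@ger0_derive1_le _ f 0 (pi / 2) _ _ true false) => //.
  - by move=> y yI; rewrite derive1E derive_val mulr_ge0//; move: yI; rewrite in_itv/= => /andP[y0 y1]; rewrite ?ltW// sin_gt0_pihalf// y0.
  - by apply: continuous_subspaceT.
  - by rewrite in_itv/= lexx divr_ge0// pi_ge0.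
  - by rewrite in_itv/= x0.
by rewrite /f sin0 mul0r subr0 subr_ge0.
Qed.

(** As 1 - cos x = 2 sin^2 (x/2), it is enough that sin (x/2) >= x/4 for x >= 0. This follows from
    sin (x/2) = 2 sin (x/4) cos (x/4) >= (x/2) cos^2 (x/4) = (x/4) (1 + cos (x/2)). *)
Lemma one_sub_cos_ge x : `|x| <= pi -> x ^+ 2 / 8 <= 1 - cos x.
Proof.
wlog x0 : x / 0 <= x => [H|] xpi.
  have [x0|x0] := leP 0 x; first exact: H.
  by have := H (- x); rewrite cosN sqrrN normrN oppr_ge0 ltW//; exact.
rewrite ger0_norm// in xpi.
have p0 := pi_gt0 R.
have half y : cos y = 1 - 2 * sin (y / 2) ^+ 2 /\ sin y = 2 * (sin (y / 2) * cos (y / 2)) /\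
    cos y = 2 * cos (y / 2) ^+ 2 - 1.
  have cd := cosD (y / 2) (y / 2); have sd := sinD (y / 2) (y / 2).
  rewrite -splitr in cd sd; have := cos2Dsin2 (y / 2).
  rewrite cd sd; move: (cos (y / 2)) (sin (y / 2)) => c s0 H.
  by split; [|split]; lra.
have [E1 _] := half x; have [_ [E2 E3]] := half (x / 2).
have c0 : 0 <= cos (x / 2) by rewrite cos_ge0_pihalf//; apply/andP; split; lra.
have s1 : x / 2 / 2 * cos (x / 2 / 2) <= sin (x / 2 / 2).
  by apply: sin_ge_mulcos; apply/andP; split; lra.
have c1 : 0 <= cos (x / 2 / 2) by rewrite cos_ge0_pihalf//; apply/andP; split; lra.
have s2 : x / 4 <= sin (x / 2).
  rewrite E2; have : x / 2 / 2 * cos (x / 2 / 2) ^+ 2 <= sin (x / 2 / 2) * cos (x / 2 / 2).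
    by rewrite expr2 mulrA ler_wpM2r.
  move: E3 x0 c0 {s1 E1 E2}; move: (cos (x / 2 / 2)) (cos (x / 2)) (sin _ * _) => a b c; nra.
rewrite E1; have : (x / 4) ^+ 2 <= sin (x / 2) ^+ 2.
  rewrite ler_pXn2r ?nnegrE//; first by rewrite divr_ge0.
  by apply: le_trans s2; rewrite divr_ge0.
nra.
Qed.

(** Up to the factor pi, the Poisson kernel of the half-plane at height [d]. *)
Definition cauchy_weight (d x : R) := d / (d ^+ 2 + x ^+ 2).

Lemma cauchy_weight_ge0 d x : 0 <= d -> 0 <= cauchy_weight d x.
Proof. by move=> d0; rewrite divr_ge0// addr_ge0// sqr_ge0. Qed.

(** One of the three differences lies in [[- pi, pi]] and carries the bound; the other two terms are
    nonnegative. The 16 is 2 * 8: the numerator of the kernel is at most 2 (1 - r), and its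
    denominator (1 - r)^2 + 2 r (1 - cos x) is at least ((1 - r)^2 + x^2) / 8 because 2 r >= 1. *)
Lemma pk_le_cauchy r s t : 2^-1 <= r < 1 -> - pi <= s <= pi -> - pi <= t <= pi ->
  pk (r%:C * expi s) t <= 16 * (cauchy_weight (1 - r) (t - s) +
    cauchy_weight (1 - r) (t - (s + 2 * pi)) + cauchy_weight (1 - r) (t - (s - 2 * pi))).
Proof.
move=> /andP[r2 r1] /andP[s1 s2] /andP[t1 t2].
have p0 := pi_gt0 R.
have r0 : 0 < r by apply: lt_le_trans r2; rewrite invr_gt0.
have d0 : 0 < 1 - r by rewrite subr_gt0.
rewrite pk_polarE; last by rewrite ltW.
have key x : `|x| <= pi -> cos x = cos (t - s) ->
    (1 - r ^+ 2) / (1 - 2 * r * cos (t - s) + r ^+ 2) <= 16 * cauchy_weight (1 - r) x.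
  move=> /one_sub_cos_ge xpi <-; rewrite /cauchy_weight.
  have dx : 0 < (1 - r) ^+ 2 + x ^+ 2 by rewrite ltr_pwDl ?exprn_gt0// sqr_ge0.
  have D : ((1 - r) ^+ 2 + x ^+ 2) / 8 <= 1 - 2 * r * cos x + r ^+ 2.
    have -> : 1 - 2 * r * cos x + r ^+ 2 = (1 - r) ^+ 2 + 2 * r * (1 - cos x) by ring.
    have : x ^+ 2 / 8 <= 2 * r * (1 - cos x).
      apply: (le_trans xpi); rewrite ler_peMl ?subr_ge0 ?cos_le1//.
      lra.
    have := sqr_ge0 (1 - r); lra.
  have D0 : 0 < 1 - 2 * r * cos x + r ^+ 2 by apply: lt_le_trans D; rewrite divr_gt0.
  rewrite mulrA ler_pdivrMr// mulrAC ler_pdivlMr//.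
  have n1 : 1 - r ^+ 2 <= 2 * (1 - r) by nra.
  have n2 : 0 <= 1 - r ^+ 2 by nra.
  apply: (@le_trans _ _ (2 * (1 - r) * ((1 - r) ^+ 2 + x ^+ 2))).
    by rewrite ler_wpM2r// ltW.
  move: D D0 dx; move: ((1 - r) ^+ 2 + x ^+ 2) (1 - 2 * r * cos x + r ^+ 2) => A B D _ _.
  have : (1 - r) * A <= (1 - r) * (8 * B) by rewrite ler_wpM2l ?(ltW d0)//; lra.
  lra.
have k0 x := @cauchy_weight_ge0 (1 - r) x (ltW d0).
have [h|h] := leP `|t - s| pi.
  by apply: le_trans (key _ h erefl) _; rewrite ler_wpM2l// -addrA lerDl addr_ge0.
have [ts|ts] := leP s t.
  have h' : `|t - (s + 2 * pi)| <= pi.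
    move: h; rewrite ger0_norm ?subr_ge0// => h.
    by rewrite ler_norml; apply/andP; split; lra.
  have E : cos (t - (s + 2 * pi)) = cos (t - s).
    by rewrite -[LHS]cosD2pi; congr cos; rewrite mulr2n; ring.
  apply: le_trans (key _ h' E) _; rewrite ler_wpM2l//.
  by have := k0 (t - s); have := k0 (t - (s - 2 * pi)); lra.
have h' : `|t - (s - 2 * pi)| <= pi.
  move: h; rewrite ltr0_norm ?subr_lt0// => h.
  by rewrite ler_norml; apply/andP; split; lra.
have E : cos (t - (s - 2 * pi)) = cos (t - s).
  by rewrite -[RHS]cosD2pi; congr cos; rewrite mulr2n; ring.
apply: le_trans (key _ h' E) _; rewrite ler_wpM2l//.
by have := k0 (t - s); have := k0 (t - (s + 2 * pi)); lra.
Qed.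

End poisson_kernel.

(** * Dyadic estimates of Poisson integrals *)

Section poisson_fatou.
Variable R : realType.
Local Notation C := R[i].
Local Notation mu := (@lebesgue_measure R).
Local Notation Ipi := `[- pi, (pi : R)]%classic.
Implicit Types (z w : C) (r s t x y d : R) (u X : R -> R).

(** In the induction the new summand equals the old remainder if |y| is below the new radius;
    otherwise d / y^2 is already below the new remainder. *)
Lemma cauchy_weight_dyadic d y N : 0 < d -> cauchy_weight d y <=
  \sum_(k < N.+1) (if `|y| < 2 ^+ k * d then 4 / (4 ^+ k * d) else 0) + (4 ^+ N * d)^-1.
Proof.
move=> d0; elim: N => [|N IH].
  apply: (@le_trans _ _ (4 ^+ 0 * d)^-1).
    rewrite expr0 mul1r /cauchy_weight ler_pdivrMr; last first.
      by rewrite ltr_pwDl ?exprn_gt0 ?sqr_ge0.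
    by rewrite mulrDr expr2 mulKf ?gt_eqF// lerDl mulr_ge0 ?sqr_ge0// invr_ge0 ltW.
  rewrite lerDr sumr_ge0// => k _; case: ifPn => // _.
  by rewrite divr_ge0// mulr_ge0 ?exprn_ge0// ltW.
have p4 n : 0 < 4 ^+ n * d by rewrite mulr_gt0 ?exprn_gt0.
rewrite big_ord_recr /=; have [yN|Ny] := ltP `|y| (2 ^+ N.+1 * d).
  apply: le_trans IH _; rewrite -addrA lerD2l.
  have -> : 4 / (4 ^+ N.+1 * d) = (4 ^+ N * d)^-1.
    by rewrite exprS -mulrA invfM mulrA divff ?mul1r//.
  by rewrite lerDl invr_ge0 ltW.
rewrite addr0; apply: (@le_trans _ _ (4 ^+ N.+1 * d)^-1); last first.
  rewrite lerDr sumr_ge0// => k _; case: ifPn => // _.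
  by rewrite divr_ge0// ltW.
have -> : (4 ^+ N.+1 * d)^-1 = d / (2 ^+ N.+1 * d) ^+ 2.
  have -> : (4 : R) ^+ N.+1 = 2 ^+ N.+1 ^+ 2.
    by rewrite -exprM mulnC exprM; congr (_ ^+ N.+1); rewrite expr2; ring.
  by field; rewrite gt_eqF//= expf_neq0.
have q0 : 0 < 2 ^+ N.+1 * d by rewrite mulr_gt0// exprn_gt0.
rewrite /cauchy_weight ler_wpM2l ?(ltW d0)// lef_pV2 ?posrE ?exprn_gt0//; last first.
  by rewrite ltr_pwDl ?exprn_gt0 ?sqr_ge0.
rewrite -[y ^+ 2]real_normK ?num_real//.
apply: (@le_trans _ _ (`|y| ^+ 2)); last by rewrite lerDr sqr_ge0.
by rewrite ler_pXn2r ?nnegrE// ltW.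
Qed.

Lemma continuous_cauchy_weight d x : 0 < d -> continuous (fun s => cauchy_weight d (s - x)).
Proof.
move=> d0 s; apply: cvgM; first exact: cvg_cst.
apply: cvgV; first by rewrite gt_eqF// ltr_pwDl ?exprn_gt0 ?sqr_ge0.
apply: cvgD; first exact: cvg_cst.
have c : (fun s => s - x) t @[t --> s] --> s - x.
  by apply: cvgB; [exact: cvg_id|exact: cvg_cst].
exact: (cvgM c c).
Qed.

Lemma integrable_cauchy_weight d x X : 0 < d -> mu.-integrable setT (EFin \o X) ->
  mu.-integrable setT (EFin \o (fun s => cauchy_weight d (s - x) * X s)).
Proof.
move=> d0; apply: (@integrableM_bounded _ _ _ _ d^-1) => //.
  exact: continuous_measurable_fun (@continuous_cauchy_weight d x d0).
move=> s _; rewrite (ger0_norm (cauchy_weight_ge0 _ (ltW d0))).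
rewrite /cauchy_weight ler_pdivrMr; last by rewrite ltr_pwDl ?exprn_gt0 ?sqr_ge0.
by rewrite mulrDr expr2 mulKf ?gt_eqF// lerDl mulr_ge0 ?sqr_ge0// invr_ge0 ltW.
Qed.

(** The [k]-th ball contributes at most [4 * B / 2 ^+ k], which sums to less than [8 * B]. The sum
    stops at [N] because in Fatou's theorem only small balls are under control; the rest is paid by
    the total mass of [X]. *)
Lemma Rint_cauchy_weight_le X x d (B : R) N : 0 < d ->
  mu.-integrable setT (EFin \o X) -> (forall s, 0 <= X s) ->
  (forall k, (k <= N)%N ->
     \int[mu]_(s in ball x (2 ^+ k * d)) X s <= B * (2 ^+ k * d)) ->
  \int[mu]_s (cauchy_weight d (s - x) * X s) <=
    8 * B + (4 ^+ N * d)^-1 * \int[mu]_s X s.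
Proof.
move=> d0 iX X0 HB.
have B0 : 0 <= B.
  have := HB 0%N (leq0n N); rewrite expr0 mul1r => H.
  by rewrite -(pmulr_lge0 _ d0); apply: le_trans H; exact: Rintegral_ge0.
pose c k : R := 4 / (4 ^+ k * d).
pose T k s := (if `|s - x| < 2 ^+ k * d then c k else 0) * X s.
have TE k : T k = (fun s => c k * X s) \_ (ball x (2 ^+ k * d)).
  apply/funext => s; rewrite /T patchE.
  have -> : (s \in (ball x (2 ^+ k * d) : set R)) = (`|s - x| < 2 ^+ k * d).
    by rewrite distrC; apply/idP/idP => [|H]; [rewrite inE|rewrite inE].
  by case: ifPn => //; rewrite mul0r.
have iT k : mu.-integrable setT (EFin \o T k).
  rewrite TE -restrict_EFin; apply/integrable_restrict => //.
    exact: measurable_ball.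
  rewrite setTI; apply: (@integrableS _ _ _ mu setT) => //; first exact: measurable_ball.
  exact: RintegrableZ.
have iTk k : (k <= N)%N -> \int[mu]_s T k s <= 4 * B / 2 ^+ k.
  move=> kN; rewrite TE -Rintegral_mkcond RintegralZl//=; last 2 first.
  - exact: measurable_ball.
  - by apply: (@integrableS _ _ _ mu setT) => //; exact: measurable_ball.
  have := HB k kN; have c0 : 0 < c k by rewrite divr_gt0// mulr_gt0// exprn_gt0.
  move=> /(ler_wpM2l (ltW c0)) => H; apply: (le_trans H).
  rewrite /c le_eqVlt; apply/orP; left; apply/eqP.
  have -> : (4 : R) ^+ k = 2 ^+ k ^+ 2.
    by rewrite -exprM mulnC exprM; congr (_ ^+ k); rewrite expr2; ring.
  by field; rewrite expf_neq0 ?(gt_eqF d0)//.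
have iS n : mu.-integrable setT (EFin \o (fun s => \sum_(k < n) T k s)).
  elim: n => [|n IH].
    rewrite (_ : (fun s => \sum_(k < 0) T k s) = cst 0); first exact: integrable0.
    by apply/funext => s; rewrite big_ord0.
  rewrite (_ : (fun s => \sum_(k < n.+1) T k s) = (fun s => \sum_(k < n) T k s + T n s)).
    exact: RintegrableD.
  by apply/funext => s; rewrite big_ord_recr.
have S n : (n <= N)%N -> \int[mu]_s (\sum_(k < n.+1) T k s) <= 8 * B - 4 * B / 2 ^+ n.
  elim: n => [|n IH] nN.
    under eq_Rintegral do rewrite big_ord1.
    by apply: le_trans (iTk 0%N nN) _; rewrite expr0; lra.
  under eq_Rintegral do rewrite big_ord_recr.
  rewrite RintegralD//; apply: le_trans (lerD (IH (ltnW nN)) (iTk _ nN)) _.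
  rewrite le_eqVlt; apply/orP; left; apply/eqP.
  by rewrite exprS; field; rewrite expf_neq0.
have iC : mu.-integrable setT (EFin \o (fun s => (4 ^+ N * d)^-1 * X s)).
  exact: RintegrableZ.
apply: (@le_trans _ _ (\int[mu]_s (\sum_(k < N.+1) T k s + (4 ^+ N * d)^-1 * X s))).
  apply: le_Rintegral => //.
  - exact: integrable_cauchy_weight.
  - exact: RintegrableD.
  - move=> s _; rewrite -mulr_suml -mulrDl ler_wpM2r//.
    exact: cauchy_weight_dyadic.
rewrite RintegralD// RintegralZl// lerD2r (le_trans (S N _))// gerBl.
by rewrite divr_ge0 ?mulr_ge0 ?exprn_ge0.
Qed.

(** Three translates with the constant 16 of [pk_le_cauchy] make 48. As [X] vanishes off the
    interval, integrals over it may be taken over the line. *)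
Lemma Rint_pk_le X r s (B : R) N : 2^-1 <= r < 1 -> - pi <= s <= pi ->
  mu.-integrable setT (EFin \o X) -> (forall t, 0 <= X t) ->
  (forall t, ~ Ipi t -> X t = 0) ->
  (forall c k, c \in [:: s; s + 2 * pi; s - 2 * pi] -> (k <= N)%N ->
     \int[mu]_(t in ball c (2 ^+ k * (1 - r))) X t <= B * (2 ^+ k * (1 - r))) ->
  \int[mu]_(t in Ipi) (pk (r%:C * expi s) t * X t) <=
    48 * (8 * B + (4 ^+ N * (1 - r))^-1 * \int[mu]_t X t).
Proof.
move=> r12 sI iX X0 XI HB.
have d0 : 0 < 1 - r by case/andP: r12 => _; rewrite subr_gt0.
have rn : normc (r%:C * expi s) < 1.
  by rewrite normc_polar; case/andP: r12 => r2 r1; rewrite ger0_norm// (le_trans _ r2)// invr_ge0.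
pose W c t := cauchy_weight (1 - r) (t - c) * X t.
have iW c : mu.-integrable setT (EFin \o W c) by exact: integrable_cauchy_weight.
have bW c : c \in [:: s; s + 2 * pi; s - 2 * pi] ->
    \int[mu]_t W c t <= 8 * B + (4 ^+ N * (1 - r))^-1 * \int[mu]_t X t.
  by move=> cs; apply: Rint_cauchy_weight_le => // k kN; exact: HB.
pose V t := W s t + W (s + 2 * pi) t + W (s - 2 * pi) t.
have iW2 : mu.-integrable setT (EFin \o (fun t => W s t + W (s + 2 * pi) t)).
  exact: RintegrableD.
have iV : mu.-integrable setT (EFin \o V).
  exact: RintegrableD.
have iV16 : mu.-integrable setT (EFin \o (fun t => 16 * V t)).
  exact: RintegrableZ.
have i1 : mu.-integrable Ipi (EFin \o (fun t => pk (r%:C * expi s) t * X t)).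
  by apply: integrable_pkM => //; apply: (@integrableS _ _ _ mu setT).
apply: (@le_trans _ _ (\int[mu]_t (16 * V t))).
  apply: (@le_trans _ _ (\int[mu]_(t in Ipi) (16 * V t))).
    apply: le_Rintegral => //; first by apply: (@integrableS _ _ _ mu setT).
    move=> t; rewrite /= in_itv/= => tI; rewrite /V /W -!mulrDl mulrA ler_wpM2r//.
    exact: pk_le_cauchy.
  rewrite [leLHS]Rintegral_mkcond le_eqVlt; apply/orP; left; apply/eqP.
  apply: eq_Rintegral => t _; rewrite patchE; case: ifPn => // /negP tI.
  rewrite /V /W XI ?mulr0 ?addr0 ?mulr0// => tI'.
  by apply: tI; rewrite inE.
rewrite RintegralZl//= RintegralD//= RintegralD//=.
have := bW s; have := bW (s + 2 * pi); have := bW (s - 2 * pi).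
rewrite !inE !eqxx !orbT/= => /(_ isT) H1 /(_ isT) H2 /(_ isT) H3.
have := lerD (lerD H3 H2) H1; move: (8 * B + _) => K.
by move: (\int[mu]_t W s t) (\int[mu]_t W (s + 2 * pi) t) (\int[mu]_t W (s - 2 * pi) t) => a b c; lra.
Qed.

End poisson_fatou.

Section poisson_integral.
Variable R : realType.
Local Notation C := R[i].
Local Notation mu := (@lebesgue_measure R).
Local Notation Ipi := `[- pi, (pi : R)]%classic.
Implicit Types (z w : C) (r s t x y d : R) (u X : R -> R).

(** The Poisson integral of [u], normalized so as to reproduce constants. *)
Definition PI u z : R := (2 * pi)^-1 * \int[mu]_(t in Ipi) (pk z t * u t).

Lemma Rintegral0_eq (D : set R) (f : R -> R) : (forall s, D s -> f s = 0) ->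
  \int[mu]_(s in D) f s = 0.
Proof. by move=> f0; rewrite /Rintegral integral0_eq// => s /f0 ->. Qed.

Lemma ae_neq (c : R) : {ae mu, forall t, t <> c}.
Proof.
exists [set c]; split; first exact: measurable_set1.
  exact: lebesgue_measure_set1.
by move=> t /= /contrapT.
Qed.

Lemma lebesgue_pt_avg (f : R -> R) t e : lebesgue_pt f t -> 0 < e ->
  exists2 eta : R, 0 < eta & forall h, 0 < h < eta ->
    (\int[mu]_(s in ball t h) `|f s - f t|%:E <= (e * (2 * h))%:E)%E.
Proof.
move=> /fine_cvgP[/= fin lim] e0.
have /cvgrPdist_lt/(_ _ e0) := lim.
move=> lim'; have H0 : \forall h \near (0 : R), 0 < h ->
    davg f t h \is a fin_num /\ `|0 - fine (davg f t h)| < e := filterI fin lim'.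
have [eta eta0 H] := near_normr (H0 (within_filter _ (nbhs_filter _))).
exists eta => // h /andP[h0 he].
have [] := H h; first by rewrite subr0 gtr0_norm.
- exact: h0.
rewrite /= sub0r normrN => f1 f2.
have : (davg f t h <= e%:E)%E.
  by rewrite -(fineK f1) lee_fin ltW// (le_lt_trans (ler_norm _)).
rewrite /davg /iavg lebesgue_measure_ball ?(ltW h0)//.
rewrite inver mulrn_eq0 (gt_eqF h0)/= lee_pdivrMl ?mulrn_wgt0//.
move=> H1; apply: le_trans H1 _.
by rewrite -EFinM lee_fin; lra.
Qed.

Lemma integrable_restrictT u : mu.-integrable Ipi (EFin \o u) ->
  mu.-integrable setT (EFin \o (u \_ Ipi)).
Proof.
move=> iu; rewrite -restrict_EFin; apply/integrable_restrict => //.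
by rewrite setTI.
Qed.

(** [N.+1] is the least exponent whose ball has radius at least [eta]. All balls up to [N] are then
    small, while the tail coefficient is still of order [d]. *)
Lemma dyadic_scale d eta : 0 < d < eta ->
  exists2 N : nat, 2 ^+ N * d < eta & (4 ^+ N * d)^-1 <= 4 * d / eta ^+ 2.
Proof.
move=> /andP[d0 de]; have eta0 := lt_trans d0 de.
have ex : exists n : nat, eta <= 2 ^+ n * d.
  have [n] : exists n : nat, eta / d < n%:R by exists (Num.bound (eta / d)); apply: archi_boundP; rewrite divr_ge0 ?(ltW d0) ?(ltW eta0).
  rewrite ltr_pdivrMr// => H; exists n; apply: ltW; apply: lt_le_trans H _.
  rewrite ler_pM2r// -natrX ler_nat; exact: ltnW (ltn_expl _ _).
have [n nP nmin] := ex_minnP ex.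
case: n nP nmin => [|N] nP nmin.
  by move: nP; rewrite expr0 mul1r leNgt de.
exists N; first by rewrite ltNge; apply/negP => /nmin; rewrite ltnn.
have -> : (4 ^+ N * d)^-1 = 4 * d / (2 ^+ N.+1 * d) ^+ 2.
  have -> : (4 : R) ^+ N = 2 ^+ N ^+ 2.
    by rewrite -exprM mulnC exprM; congr (_ ^+ N); rewrite expr2; ring.
  by rewrite (exprS 2 N); field; rewrite expf_neq0// gt_eqF.
rewrite ler_wpM2l ?mulr_ge0 ?(ltW d0)// lef_pV2 ?posrE ?exprn_gt0//; last first.
  by rewrite mulr_gt0// exprn_gt0.
have q : 0 < 2 ^+ N.+1 * d by rewrite mulr_gt0// exprn_gt0.
by rewrite ler_pXn2r ?nnegrE//; exact: ltW.
Qed.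

(** At an interior Lebesgue point, |P[u] - u(t)| <= P[|u - u(t)|]. The balls up to the scale [eta]
    are controlled by the Lebesgue point, and the tail vanishes as the radius tends to 1. *)
Theorem PI_fatou u : mu.-integrable Ipi (EFin \o u) ->
  {ae mu, forall t, Ipi t -> PI u (r%:C * expi t) @[r --> (1 : R)^'-] --> u t}.
Proof.
move=> iu.
have p0 := pi_gt0 R.
have loc : locally_integrable setT (u \_ Ipi).
  apply: integrable_locally_restrict => //.
have H := lebesgue_differentiation loc.
apply: ae_imp2 (ae_imp2 (fun _ h1 h2 => conj h1 h2) (ae_neq pi) (ae_neq (- pi))) H.
move=> t [tp tNp] Ht tI; have tI' : - pi <= t <= pi by move: tI; rewrite /= in_itv.
have tlt : `|t| < pi.
  case/andP: tI' => t1 t2; rewrite ltr_norml !lt_neqAle t1 t2 !andbT.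
  by apply/andP; split; apply/eqP => // E; apply: tNp.
pose X := (fun s => `|u s - u t|) \_ Ipi.
have iut : mu.-integrable Ipi (EFin \o (fun s => u s - u t)).
  apply: RintegrableB => //; apply: ccont_integrable => s _; exact: cvg_cst.
have iX : mu.-integrable setT (EFin \o X).
  by apply: integrable_restrictT; exact: (integrable_norm iut).
have X0 s : 0 <= X s by rewrite /X patchE; case: ifPn.
have XI s : ~ Ipi s -> X s = 0.
  by move=> sI; rewrite /X patchE; case: ifPn => //; rewrite inE.
set I := \int[mu]_s X s; have I0 : 0 <= I by exact: Rintegral_ge0.
apply/cvgrPdist_le => e e0.
(* The final bound is 48 * (16 + 1) = 816 times [e1]. *)
pose e1 := e / (32 * 32); have e10 : 0 < e1 by rewrite divr_gt0// mulr_gt0.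
have [eta0 eta00 Heta] := lebesgue_pt_avg Ht e10.
(* The bound [pi - |t|] keeps balls about [t + 2 * pi] and [t - 2 * pi] off the interval, so that
   only those about [t] contribute. *)
have [eta etap [eta1 eta2]] : exists2 eta : R, 0 < eta & eta <= eta0 /\ eta <= pi - `|t|.
  exists (Num.min eta0 (pi - `|t|)); first by rewrite lt_min eta00 subr_gt0.
  by split; rewrite ge_min lexx ?orbT.
(* In turn: radii at least 1/2 for [Rint_pk_le], room for [dyadic_scale], and a tail of at most
   [e1]. *)
pose dl := Num.min (2^-1) (Num.min eta (e1 * eta ^+ 2 / (4 * (I + 1)))).
have dlp : 0 < dl.
  rewrite !lt_min invr_gt0 ltr0n etap/= divr_gt0 ?mulr_gt0 ?exprn_gt0//.
  by rewrite ltr_wpDl.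
rewrite near_withinE; apply/nbhs_ballP; exists dl => // r; rewrite /ball /= => r1 r2.
have d0 : 0 < 1 - r by rewrite subr_gt0.
move: r1; rewrite gtr0_norm// !lt_min => /and3P[d1 d2 d3].
have r12 : 2^-1 <= r < 1 by rewrite r2 andbT; lra.
have r0 : 0 <= r by lra.
have zn : normc (r%:C * expi t) < 1 by rewrite normc_polar_ge0.
have [N N1 N2] := @dyadic_scale (1 - r) eta (introT andP (conj d0 d2)).
have ballX c k : c \in [:: t; t + 2 * pi; t - 2 * pi] -> (k <= N)%N ->
     \int[mu]_(s in ball c (2 ^+ k * (1 - r))) X s <= (2 * e1) * (2 ^+ k * (1 - r)).
  move=> ct kN; set h := 2 ^+ k * (1 - r).
  have h0 : 0 < h by rewrite mulr_gt0// exprn_gt0.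
  have heta : h < eta.
    apply: le_lt_trans N1; rewrite ler_pM2r//; apply: ler_weXn2l => //; lra.
  have h1 := lt_le_trans heta eta1; have h2 := lt_le_trans heta eta2.
  move: ct; rewrite !inE => /or3P[] /eqP -> {c}; last 2 first.
  - rewrite (_ : \int[mu]_(s in ball (t + 2 * pi) h) X s = 0) ?mulr_ge0 ?ltW//.
    apply: Rintegral0_eq => s; rewrite /ball /= ltr_norml => /andP[s1 s2].
    apply: XI; rewrite /= in_itv/= => /andP[s3 s4].
    have := ler_norm (- t); rewrite normrN; lra.
  - rewrite (_ : \int[mu]_(s in ball (t - 2 * pi) h) X s = 0) ?mulr_ge0 ?ltW//.
    apply: Rintegral0_eq => s; rewrite /ball /= ltr_norml => /andP[s1 s2].
    apply: XI; rewrite /= in_itv/= => /andP[s3 s4].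
    have := ler_norm t; lra.
  have := Heta h; rewrite h0 h1 => /(_ isT) Hh.
  rewrite -lee_fin fineK; last first.
    apply: integrable_fin_num => //; first exact: measurable_ball.
    by apply: (@integrableS _ _ _ mu setT) => //; exact: measurable_ball.
  rewrite [_ * h](_ : _ = e1 * (2 * h)); last by ring.
  apply: le_trans Hh; apply: ge0_le_integral => //.
  - exact: measurable_ball.
  - by move=> s _; rewrite lee_fin.
  - have /(measurable_int mu) mX := iX.
    by apply: measurable_funS mX.
  - apply/measurable_EFinP; apply: measurableT_comp => //.
    apply: measurable_funB => //; case: loc => mf _ _.
    by apply: measurable_funS mf.
  - move=> s _; rewrite lee_fin /X !patchE; case: ifPn => sI; last exact: normr_ge0.
    by rewrite (mem_set tI).
have := Rint_pk_le r12 tI' iX X0 XI ballX.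
have -> : \int[mu]_(s in Ipi) (pk (r%:C * expi t) s * X s) =
    \int[mu]_(s in Ipi) (pk (r%:C * expi t) s * `|u s - u t|).
  by apply: eq_Rintegral => s sI; rewrite /X patchE sI.
set z := r%:C * expi t in zn * => bound.
have E : PI u z - u t = (2 * pi)^-1 * \int[mu]_(s in Ipi) (pk z s * (u s - u t)).
  rewrite /PI.
  have -> : \int[mu]_(s in Ipi) (pk z s * (u s - u t)) =
      \int[mu]_(s in Ipi) (pk z s * u s) - 2 * pi * u t.
    rewrite -(integral_pk zn) -RintegralZr//=.
    - rewrite -RintegralB//=; last 2 first.
      + exact: integrable_pkM.
      + by apply: integrable_pkM => //; apply: ccont_integrable => s _; exact: cvg_cst.
      by apply: eq_Rintegral => s _; rewrite mulrBr.
    - by apply: ccont_integrable => s _; exact: continuous_pk.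
  by rewrite mulrBr mulKf// gt_eqF// mulr_gt0.
rewrite distrC E normrM (ger0_norm (_ : 0 <= (2 * pi)^-1)); last first.
  by rewrite invr_ge0 mulr_ge0// ltW.
have n1 : `|\int[mu]_(s in Ipi) (pk z s * (u s - u t))| <=
    \int[mu]_(s in Ipi) (pk z s * `|u s - u t|).
  have i1 := integrable_pkM zn iut.
  apply: le_trans (le_normr_Rintegral _ i1) _ => //.
  rewrite le_eqVlt; apply/orP; left; apply/eqP; apply: eq_Rintegral => s _.
  by rewrite normrM (ger0_norm (ltW (pk_gt0 s zn))).
apply: le_trans (ler_wpM2l _ (le_trans n1 bound)) _.
  by rewrite invr_ge0 mulr_ge0// ltW.
have N3 : (4 ^+ N * (1 - r))^-1 * I <= e1.
  apply: (@le_trans _ _ (4 * (1 - r) / eta ^+ 2 * (I + 1))).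
    apply: ler_pM => //; first by rewrite invr_ge0 mulr_ge0 ?exprn_ge0// ltW.
    by rewrite lerDl.
  move: d3; rewrite ltr_pdivlMr ?mulr_gt0 ?ltr_wpDl// => d3.
  rewrite mulrAC ler_pdivrMr ?exprn_gt0//; apply: le_trans (ltW d3).
  by rewrite le_eqVlt; apply/orP; left; apply/eqP; ring.
have q1 : (2 * pi)^-1 <= (1 : R).
  by rewrite invf_le1 ?mulr_gt0//; have := pi_ge2 R; lra.
have q2 : 0 <= (2 * pi)^-1 :> R by rewrite invr_ge0 mulr_ge0// ltW.
have q3 : 48 * (8 * (2 * e1) + (4 ^+ N * (1 - r))^-1 * I) <= e.
  by move: N3; set A := _^-1 * I; rewrite /e1; lra.
have q4 : 0 <= 48 * (8 * (2 * e1) + (4 ^+ N * (1 - r))^-1 * I).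
  have : 0 <= (4 ^+ N * (1 - r))^-1 * I.
    by rewrite mulr_ge0// invr_ge0 mulr_ge0 ?exprn_ge0// ltW.
  by set A := _^-1 * I; lra.
by apply: le_trans q3; rewrite ler_piMl.
Qed.

End poisson_integral.

(** * Outer functions *)

Section outer_functions.
Variable R : realType.
Local Notation C := R[i].
Local Notation mu := (@lebesgue_measure R).
Local Notation Ipi := `[- pi, (pi : R)]%classic.
Implicit Types (z w : C) (r s t x y d : R) (u v X : R -> R) (k : R -> C).

(** General enough for the Herglotz kernel, its derivative in [z] and the remainder of its
    expansion, so that linearity of [kint] in the kernel can be used. *)
Definition bounded_kernel k := [/\ measurable_fun Ipi (fun t => complex.Re (k t)),
  measurable_fun Ipi (fun t => complex.Im (k t)) &
  exists M : R, forall t, normc (k t) <= M].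

Definition kint k u : C := cintegral Ipi (fun t => k t * (u t)%:C).

Lemma kintE k u : kint k u =
  (\int[mu]_(t in Ipi) (complex.Re (k t) * u t)) +i*
  (\int[mu]_(t in Ipi) (complex.Im (k t) * u t)).
Proof.
rewrite /kint /cintegral; congr (_ +i* _); apply: eq_Rintegral => t _.
  by rewrite cReM /= mulr0 subr0.
by rewrite cImM /= mulr0 add0r.
Qed.

Lemma bounded_kernel_integrable k u : bounded_kernel k ->
  mu.-integrable Ipi (EFin \o u) ->
  mu.-integrable Ipi (EFin \o (fun t => complex.Re (k t) * u t)) /\
  mu.-integrable Ipi (EFin \o (fun t => complex.Im (k t) * u t)).
Proof.
move=> [mR mI [M kM]] iu; split; apply: (@integrableM_bounded _ _ _ _ M) => // t _.
  exact: le_trans (normr_Re_le _) (kM t).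
exact: le_trans (normr_Im_le _) (kM t).
Qed.

Lemma bounded_kernelB k1 k2 : bounded_kernel k1 -> bounded_kernel k2 ->
  bounded_kernel (fun t => k1 t - k2 t).
Proof.
move=> [mR mI [M1 H1]] [mR2 mI2 [M2 H2]]; split.
- rewrite (_ : (fun t => _) = (fun t => complex.Re (k1 t) - complex.Re (k2 t))).
    exact: measurable_funB.
  by apply/funext => t; rewrite cReD cReN.
- rewrite (_ : (fun t => _) = (fun t => complex.Im (k1 t) - complex.Im (k2 t))).
    exact: measurable_funB.
  by apply/funext => t; rewrite cImD cImN.
- by exists (M1 + M2) => t; rewrite (le_trans (le_normcD _ _))// normcN lerD.
Qed.

Lemma bounded_kernelZ (c : C) k : bounded_kernel k ->
  bounded_kernel (fun t => c * k t).
Proof.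
move=> [mR mI [M H]]; split.
- rewrite (_ : (fun t => _) = (fun t => complex.Re c * complex.Re (k t) -
      complex.Im c * complex.Im (k t))).
    by apply: measurable_funB; exact: measurable_funM.
  by apply/funext => t; rewrite cReM.
- rewrite (_ : (fun t => _) = (fun t => complex.Re c * complex.Im (k t) +
      complex.Im c * complex.Re (k t))).
    by apply: measurable_funD; exact: measurable_funM.
  by apply/funext => t; rewrite cImM.
- by exists (normc c * M) => t; rewrite normcM ler_wpM2l ?normc_ge0.
Qed.

Lemma kintB k1 k2 u : bounded_kernel k1 -> bounded_kernel k2 ->
  mu.-integrable Ipi (EFin \o u) ->
  kint (fun t => k1 t - k2 t) u = kint k1 u - kint k2 u.
Proof.
move=> b1 b2 iu; have [R1 I1] := bounded_kernel_integrable b1 iu.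
have [R2 I2] := bounded_kernel_integrable b2 iu.
rewrite !kintE; apply: complexP => /=; rewrite -RintegralB//=;
  by apply: eq_Rintegral => t _; rewrite ?cReD ?cReN ?cImD ?cImN mulrBl.
Qed.

Lemma kintZ (c : C) k u : bounded_kernel k ->
  mu.-integrable Ipi (EFin \o u) -> kint (fun t => c * k t) u = c * kint k u.
Proof.
move=> bk iu; have [R1 I1] := bounded_kernel_integrable bk iu.
case: c => a b; rewrite !kintE; apply: complexP => /=; rewrite -!RintegralZl//=.
  rewrite -RintegralB//=; last 2 first.
  - exact: RintegrableZ.
  - exact: RintegrableZ.
  by apply: eq_Rintegral => t _; rewrite cReM /=; ring.
rewrite -RintegralD//=; last 2 first.
- exact: RintegrableZ.
- exact: RintegrableZ.
by apply: eq_Rintegral => t _; rewrite cImM /=; ring.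
Qed.

Lemma kintD k u v : bounded_kernel k -> mu.-integrable Ipi (EFin \o u) ->
  mu.-integrable Ipi (EFin \o v) ->
  kint k (fun t => u t + v t) = kint k u + kint k v.
Proof.
move=> bk iu iv; have [R1 I1] := bounded_kernel_integrable bk iu.
have [R2 I2] := bounded_kernel_integrable bk iv.
rewrite !kintE; apply: complexP => /=; rewrite -RintegralD//=;
  by apply: eq_Rintegral => t _; rewrite mulrDr.
Qed.

Lemma normc_kint_le k u (M : R) : bounded_kernel k ->
  mu.-integrable Ipi (EFin \o u) -> (forall t, Ipi t -> normc (k t) <= M) ->
  normc (kint k u) <= 2 * M * \int[mu]_(t in Ipi) `|u t|.
Proof.
move=> bk iu kM; have [R1 I1] := bounded_kernel_integrable bk iu.
have iau : mu.-integrable Ipi (EFin \o (fun t => `|u t|)) := integrable_norm iu.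
apply: le_trans (normc_le_ReIm _) _; rewrite kintE /=.
have -> : 2 * M * \int[mu]_(t in Ipi) `|u t| =
    \int[mu]_(t in Ipi) (M * `|u t|) + \int[mu]_(t in Ipi) (M * `|u t|).
  by rewrite RintegralZl//; ring.
apply: lerD.
  apply: le_trans (le_normr_Rintegral _ R1) _ => //; apply: le_Rintegral => //.
  - exact: (integrable_norm R1).
  - exact: RintegrableZ.
  - move=> t tI; rewrite normrM ler_wpM2r//.
    exact: le_trans (normr_Re_le _) (kM t tI).
apply: le_trans (le_normr_Rintegral _ I1) _ => //; apply: le_Rintegral => //.
- exact: (integrable_norm I1).
- exact: RintegrableZ.
- move=> t tI; rewrite normrM ler_wpM2r//.
  exact: le_trans (normr_Im_le _) (kM t tI).
Qed.

Lemma continuous_bounded_kernel k : (forall t, (k x : C^o) @[x --> t] --> (k t : C^o)) ->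
  (exists M : R, forall t, normc (k t) <= M) -> bounded_kernel k.
Proof.
move=> kc bM; have mk (f : R -> R) : continuous f -> measurable_fun Ipi f.
  by move=> fc; apply: measurable_funS (@continuous_measurable_fun _ _ fc).
by split => //; apply: mk => t; have /cvg_ReIm[] := kc t.
Qed.

Lemma normc_herglotz_le z t : normc z < 1 ->
  normc (herglotz_kernel z t) <= 2 / (1 - normc z).
Proof.
move=> z1; have /andP[H _] := normc_expiB_bounds z t.
have m10 : 0 < 1 - normc z by rewrite subr_gt0.
rewrite normcM normcV; apply: ler_pM; rewrite ?normc_ge0 ?invr_ge0 ?normc_ge0//.
  by rewrite (le_trans (le_normcD _ _))// normc_expi; lra.
by rewrite lef_pV2 ?posrE// (lt_le_trans m10).
Qed.

Lemma bounded_herglotz z : normc z < 1 -> bounded_kernel (herglotz_kernel z).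
Proof.
move=> z1; apply: continuous_bounded_kernel => [t|]; first exact: continuous_herglotz.
by exists (2 / (1 - normc z)) => t; exact: normc_herglotz_le.
Qed.

Lemma normc_2 : normc (2 : C) = 2.
Proof. by rewrite -(rmorph_nat (real_complex R) 2) normc_real ger0_norm. Qed.

(** Differentiation under the integral sign: [D] is the derivative of the Herglotz kernel in [z],
    and the remainder [E] is explicit with a factor (w - z)^2. *)
Lemma cdiff_kint u z : normc z < 1 -> mu.-integrable Ipi (EFin \o u) ->
  cdiff (fun z => kint (herglotz_kernel z) u) z.
Proof.
move=> z1 iu; pose dz := 1 - normc z; have dz0 : 0 < dz by rewrite subr_gt0.
pose D t : C := 2 * expi t / (expi t - z) ^+ 2.
have nz t : expi t - z != 0.
  by rewrite -normc_gt0; have /andP[H _] := normc_expiB_bounds z t; exact: lt_le_trans H.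
have bD : bounded_kernel D.
  apply: continuous_bounded_kernel => [t|].
    apply: (@cvgM C^o); first by apply: (@cvgM C^o); [exact: cvg_cst|exact: cvg_expi].
    apply: (@cvgV C^o); first by rewrite expf_neq0.
    have h : (expi x - z : C^o) @[x --> t] --> (expi t - z : C^o).
      by apply: (@cvgB _ C^o); [exact: cvg_expi|exact: cvg_cst].
    exact: (cvgM h h).
  exists (2 / dz ^+ 2) => t; have /andP[H _] := normc_expiB_bounds z t.
  rewrite normcM normcV normcM normc_expi mulr1 expr2 normcM.
  rewrite normc_2 ler_wpM2l// -expr2 lef_pV2 ?posrE ?exprn_gt0//.
    by rewrite ler_pXn2r ?nnegrE ?normc_ge0// ltW.
  exact: lt_le_trans H.
apply/cdiffP; exists (kint D u) => e e0.
pose I := \int[mu]_(t in Ipi) `|u t|; have I0 : 0 <= I by exact: Rintegral_ge0.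
(* The first bound gives [dz / 2 <= normc (expi t - w)]; in the second, 8 is the 2 of
   [normc_kint_le] times the 4 of [EM]. *)
pose d := Num.min (dz / 2) (e * dz ^+ 3 / (8 * (I + 1))).
have d0 : 0 < d.
  by rewrite lt_min !divr_gt0 ?mulr_gt0 ?exprn_gt0// ltr_wpDl.
exists d => // w; rewrite lt_min => /andP[wd1 wd2].
have w1 : normc w < 1.
  have := le_normcD (w - z) z; rewrite subrK => /le_lt_trans; apply.
  by move: wd1; rewrite /dz; have := normc_ge0 z; lra.
have bw := bounded_herglotz w1; have bz := bounded_herglotz z1.
pose E t := (w - z) ^+ 2 * (2 * expi t / ((expi t - w) * (expi t - z) ^+ 2)).
have nw t : dz / 2 <= normc (expi t - w).
  have := le_normcD (expi t - w) (w - z); rewrite addrA subrK.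
  by have /andP[H _] := normc_expiB_bounds z t; move: wd1 H; rewrite -/dz; lra.
have nw0 t : expi t - w != 0.
  by rewrite -normc_gt0; apply: lt_le_trans (nw t); rewrite divr_gt0.
have EE : E = (fun t => (herglotz_kernel w t - herglotz_kernel z t) - (w - z) * D t).
  apply/funext => t; rewrite /E /herglotz_kernel /D.
  by move: (nw0 t) (nz t); move: (expi t) => a h1 h2; field; rewrite h1 h2.
have bwz := bounded_kernelB bw bz.
have bDw := bounded_kernelZ (w - z) bD.
have bE : bounded_kernel E by rewrite EE; exact: bounded_kernelB.
have -> : kint (herglotz_kernel w) u - kint (herglotz_kernel z) u - kint D u * (w - z) =
    kint E u.
  by rewrite EE kintB// kintB// kintZ// [kint D u * _]mulrC.
have n2 := normc_2.
have EM t : Ipi t -> normc (E t) <= normc (w - z) ^+ 2 * (4 / dz ^+ 3).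
  move=> _; rewrite /E normcM expr2 normcM -expr2 ler_wpM2l ?sqr_ge0//.
  rewrite normcM normcV normcM n2 normc_expi mulr1 normcM expr2 normcM -expr2.
  have /andP[H _] := normc_expiB_bounds z t; rewrite -/dz in H.
  have -> : 4 / dz ^+ 3 = 2 / (dz / 2 * dz ^+ 2) by field; rewrite gt_eqF.
  rewrite ler_wpM2l// lef_pV2 ?posrE; last 2 first.
  - by rewrite mulr_gt0 ?exprn_gt0 ?normc_gt0.
  - by rewrite mulr_gt0 ?exprn_gt0// divr_gt0.
  apply: ler_pM => //; first by rewrite divr_ge0// ltW.
    by rewrite sqr_ge0.
  by rewrite ler_pXn2r ?nnegrE ?normc_ge0// ltW.
apply: le_trans (normc_kint_le bE iu EM) _; rewrite -/I.
move: wd2; rewrite ltr_pdivlMr ?mulr_gt0 ?ltr_wpDl// => wd2.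
have n0 := normc_ge0 (w - z).
have -> : 2 * (normc (w - z) ^+ 2 * (4 / dz ^+ 3)) * I =
    (normc (w - z) * (8 * I) / dz ^+ 3) * normc (w - z) by ring.
rewrite ler_wpM2r// ler_pdivrMr ?exprn_gt0//; apply: le_trans (ltW wd2).
by rewrite ler_wpM2l// ler_wpM2l// lerDl.
Qed.

(** The outer function with boundary modulus [expR u]. Parametrized by the logarithm, products
    become sums. *)
Definition oexp u z : C := cexp (((2 * pi)^-1)%:C * kint (herglotz_kernel z) u).

Lemma normc_oexp u z : normc (oexp u z) = expR (PI u z).
Proof. by rewrite /oexp normc_cexp kintE cReM /= mul0r subr0. Qed.

Lemma oexp_neq0 u z : oexp u z != 0.
Proof. by rewrite -normc_gt0 normc_oexp expR_gt0. Qed.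

Lemma cdiff_oexp u z : normc z < 1 -> mu.-integrable Ipi (EFin \o u) ->
  cdiff (oexp u) z.
Proof.
move=> z1 iu; apply: (@cdiff_comp _ (fun z => ((2 * pi)^-1)%:C * kint (herglotz_kernel z) u)).
  by apply: cdiffM; [exact: cdiff_cst|exact: cdiff_kint].
exact: cdiff_cexp.
Qed.

Lemma oexpD u v z : normc z < 1 -> mu.-integrable Ipi (EFin \o u) ->
  mu.-integrable Ipi (EFin \o v) ->
  oexp (fun t => u t + v t) z = oexp u z * oexp v z.
Proof.
by move=> z1 iu iv; rewrite /oexp kintD ?mulrDr ?cexpD//; exact: bounded_herglotz.
Qed.

Lemma ae_eq_Rintegral u v : measurable_fun Ipi u -> measurable_fun Ipi v ->
  {ae mu, forall t, Ipi t -> u t = v t} ->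
  \int[mu]_(t in Ipi) u t = \int[mu]_(t in Ipi) v t.
Proof.
move=> mu_ mv uv; rewrite /Rintegral; congr fine.
apply: ae_eq_integral => //; [exact/measurable_EFinP|exact/measurable_EFinP|].
by apply: ae_imp uv => t H It; rewrite /= H.
Qed.

Lemma ae_eq_oexp u v z : normc z < 1 -> mu.-integrable Ipi (EFin \o u) ->
  mu.-integrable Ipi (EFin \o v) -> {ae mu, forall t, Ipi t -> u t = v t} ->
  oexp u z = oexp v z.
Proof.
move=> z1 iu iv uv; rewrite /oexp !kintE; congr (cexp (_ * _)).
have [R1 I1] := bounded_kernel_integrable (bounded_herglotz z1) iu.
have [R2 I2] := bounded_kernel_integrable (bounded_herglotz z1) iv.
congr (_ +i* _); apply: ae_eq_Rintegral.
- by apply/measurable_EFinP; exact: (measurable_int mu).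
- by apply/measurable_EFinP; exact: (measurable_int mu).
- by apply: ae_imp uv => t H It; rewrite H.
- by apply/measurable_EFinP; exact: (measurable_int mu).
- by apply/measurable_EFinP; exact: (measurable_int mu).
- by apply: ae_imp uv => t H It; rewrite H.
Qed.

Lemma oexp_fatou u : mu.-integrable Ipi (EFin \o u) ->
  {ae mu, forall t, Ipi t ->
    normc (oexp u (r%:C * expi t)) @[r --> (1 : R)^'-] --> expR (u t)}.
Proof.
move=> iu; apply: ae_imp (PI_fatou iu) => t H It.
under eq_fun do rewrite normc_oexp.
exact: (cvg_comp _ _ (H It) (@continuous_expR R _)).
Qed.

Lemma PI_ge u z (K : R) : normc z < 1 -> mu.-integrable Ipi (EFin \o u) ->
  (forall t, Ipi t -> K <= u t) -> K <= PI u z.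
Proof.
move=> z1 iu Ku; rewrite /PI mulrC ler_pdivlMr; last by rewrite mulr_gt0// pi_gt0.
rewrite -(integral_pk z1) -RintegralZl//=; last first.
  by apply: ccont_integrable => t _; exact: continuous_pk.
apply: le_Rintegral => //.
- by apply: RintegrableZ => //; apply: ccont_integrable => t _; exact: continuous_pk.
- exact: integrable_pkM.
- by move=> t It; rewrite mulrC ler_wpM2l ?Ku// ltW// pk_gt0.
Qed.

(** The shift by two makes every radius, and hence every quotient of a smaller by a larger one, at
    least 1/2, as the estimates of the Poisson kernel require. *)
Definition rad n : R := 1 - n.+2%:R^-1.

Lemma rad_itv n : 2^-1 <= rad n < 1.
Proof.
rewrite /rad; have n0 : 0 < (n.+2%:R : R)^-1 by rewrite invr_gt0 ltr0n.
have n1 : (n.+2%:R : R)^-1 <= 2^-1 by rewrite lef_pV2 ?posrE ?ltr0n// ler_nat.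
by move: n0 n1; move: (_^-1) => x n0 n1; apply/andP; split; lra.
Qed.

Lemma rad_itv01 n : 0 < rad n < 1.
Proof. by have /andP[h ->] := rad_itv n; rewrite andbT (lt_le_trans _ h)// invr_gt0. Qed.

Lemma cvg_rad : rad n @[n --> \oo] --> (1 : R).
Proof.
rewrite -[X in _ --> X]subr0; apply: cvgB; first exact: cvg_cst.
by have := @cvg_harmonic R; rewrite -cvg_shiftS.
Qed.

Lemma cvg_rad_left : rad n @[n --> \oo] --> (1 : R)^'-.
Proof.
move=> P /= HP; have {}HP : \forall w \near (1 : R), w < 1 -> P w := HP.
have [d d0 H] := near_normr HP.
have /cvgrPdist_lt/(_ _ d0) := cvg_rad; apply: filterS => n; rewrite distrC => nd.
by apply: H => //; have /andP[] := rad_itv n.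
Qed.

(* The quotient of [f] by the outer function is bounded with boundary modulus at
   most 1, so Poisson's formula bounds it by 1. *)
Lemma outer_majorant (f : C -> C) v (b : R -> R) (M K : R) :
  (forall z, normc z < 1 -> cdiff f z) -> (forall z, normc z < 1 -> normc (f z) <= M) ->
  mu.-integrable Ipi (EFin \o v) -> (forall t, Ipi t -> K <= v t) ->
  measurable_fun Ipi b ->
  {ae mu, forall t, Ipi t -> normc (f ((rad n)%:C * expi t)) @[n --> \oo] --> b t} ->
  {ae mu, forall t, Ipi t -> b t <= expR (v t)} ->
  forall z, normc z < 1 -> normc (f z) <= expR (PI v z).
Proof.
move=> df fM iv Kv mb fb bv z z1.
pose q w := f w * (oexp v w)^-1.
have M0 : 0 <= M by apply: le_trans (fM 0 _); rewrite ?normc_ge0// normc_real normr0.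
have nq w : normc (q w) = normc (f w) * expR (- PI v w).
  by rewrite normcM normcV normc_oexp expRN.
have dq w : normc w < 1 -> cdiff q w.
  move=> w1; apply: cdiffM; first exact: df.
  by apply: cdiffV; [exact: oexp_neq0|exact: cdiff_oexp].
have qM w : normc w < 1 -> normc (q w) <= M * expR (- K).
  move=> w1; rewrite nq; apply: ler_pM; rewrite ?normc_ge0 ?expR_ge0 ?fM//.
  by rewrite ler_expR lerN2; exact: PI_ge.
suff q1 : normc (q z) <= 1.
  by move: q1; rewrite nq expRN ler_pdivrMr ?expR_gt0// mul1r.
have [->|qz] := eqVneq (q z) 0; first by rewrite normc_real normr0.
(* This unimodular factor makes [c * q z] the real number [normc (q z)], so that a formula for real
   parts yields the modulus. *)
pose c : C := (q z)^-1 * (normc (q z))%:C.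
have c1 : normc c = 1.
  by rewrite normcM normcV normc_real ger0_norm ?normc_ge0// mulVf// normc_eq0.
have cq : c * q z = (normc (q z))%:C by rewrite /c mulrAC mulVf// mul1r.
pose F w := c * q w.
have dF w : normc w < 1 -> cdiff F w.
  by move=> w1; apply: cdiffM; [exact: cdiff_cst|exact: dq].
have rw n w : normc w < 1 -> normc ((rad n)%:C * w) < 1.
  move=> w1; have /andP[r0 r1] := rad_itv01 n.
  by rewrite normcM normc_real gtr0_norm// mulr_ilt1// ?normc_ge0// ltW.
have rexp n t : normc ((rad n)%:C * expi t) < 1.
  by have /andP[r0 r1] := rad_itv01 n; rewrite normc_polar_ge0// ltW.
have pois n : 2 * pi * complex.Re (F ((rad n)%:C * z)) <=
    \int[mu]_(t in Ipi) (pk z t * normc (q ((rad n)%:C * expi t))).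
  rewrite -poisson_formula//; last exact: rad_itv01.
  have cont (g : C -> C) : (forall w, normc w < 1 -> cdiff g w) -> forall t,
      {for t, continuous (fun t => complex.Re (g ((rad n)%:C * expi t)))} /\
      {for t, continuous (fun t => normc (g ((rad n)%:C * expi t)))}.
    by move=> dg t; have [] := continuous_circle (cdiff_continuous (dg _ (rexp n t))).
  apply: le_Rintegral => //.
  - by apply: integrable_pkM => //; apply: ccont_integrable => t _; have [] := cont _ dF t.
  - by apply: integrable_pkM => //; apply: ccont_integrable => t _; have [] := cont _ dq t.
  - move=> t _; rewrite ler_wpM2l ?(ltW (pk_gt0 t z1))//.
    by apply: le_trans (Re_le_normc _) _; rewrite normcM c1 mul1r.
have lhs : 2 * pi * complex.Re (F ((rad n)%:C * z)) @[n --> \oo] --> 2 * pi * normc (q z).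
  apply: cvgM; first exact: cvg_cst.
  have -> : normc (q z) = complex.Re (F z) by rewrite /F cq.
  have : (F ((rad n)%:C * z) : C^o) @[n --> \oo] --> (F z : C^o).
    apply: (cvg_comp (fun n => ((rad n)%:C * z : C^o)) (F : C^o -> C^o)) (cdiff_continuous (dF z z1)).
    have [t _ zE] := polar z; rewrite zE.
    have -> : (fun n => (rad n)%:C * ((normc z)%:C * expi t) : C^o) =
        (fun n => (rad n * normc z)%:C * expi t : C^o).
      by apply/funext => n; rewrite rmorphM/= mulrA.
    apply: cvg_polar; last exact: cvg_cst.
    by rewrite -[X in _ --> X]mul1r; apply: cvgM; [exact: cvg_rad|exact: cvg_cst].
  by move=> /cvg_ReIm[].
have mv : measurable_fun Ipi v by apply/measurable_EFinP; exact: (measurable_int mu iv).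
(* The minimum with 1 changes the limit only on a null set and makes the bound by 1 hold at every
   [t]. *)
have [||||||ir rhs] := @Rint_dominated R Ipi
  (fun n t => pk z t * normc (q ((rad n)%:C * expi t)))
  (fun t => pk z t * Num.min (b t * expR (- v t)) 1) (cst (2 / (1 - normc z) * (M * expR (- K)))) => //.
- move=> n; apply: measurable_funM; first exact: measurable_pk.
  apply: measurable_funS (@continuous_measurable_fun _ (fun t => normc (q ((rad n)%:C * expi t))) _) => //.
  by move=> t; have [] := continuous_circle (cdiff_continuous (dq _ (rexp n t))).
- apply: measurable_funM; first exact: measurable_pk.
  apply: measurable_minr => //; apply: measurable_funM => //.
  by do 2 apply: measurableT_comp => //.
- apply: ae_imp2 (ae_imp2 (fun _ h1 h2 => conj h1 h2) fb bv) (PI_fatou iv).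
  move=> t [h1 hb] h2 It; apply: cvgM; first exact: cvg_cst.
  have -> : Num.min (b t * expR (- v t)) 1 = b t * expR (- v t).
    by apply/min_idPl; rewrite expRN ler_pdivrMr ?expR_gt0// mul1r hb.
  under eq_fun do rewrite nq; apply: cvgM; first exact: h1.
  have h3 := cvg_comp _ _ cvg_rad_left (h2 It).
  exact: (cvg_comp _ _ (cvgN h3) (@continuous_expR R _)).
- by apply: ccont_integrable => t _; exact: cvg_cst.
- move=> n t _; rewrite normrM (ger0_norm (normc_ge0 _)).
  by apply: ler_pM => //; rewrite ?normc_ge0 ?normr_pk_le ?qM.
have L : 2 * pi * normc (q z) <= \int[mu]_(t in Ipi) (pk z t * Num.min (b t * expR (- v t)) 1).
  by apply: (ler_cvg_to lhs rhs); apply: nearW => n; exact: pois.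
have p0 : 0 < 2 * pi :> R by rewrite mulr_gt0// pi_gt0.
rewrite -(ler_pM2l p0) mulr1; apply: le_trans L _; rewrite -(integral_pk z1).
apply: le_Rintegral => //.
  by apply: ccont_integrable => t _; exact: continuous_pk.
move=> t _; rewrite -[leRHS]mulr1 ler_wpM2l ?(ltW (pk_gt0 t z1))//.
by rewrite ge_min lexx orbT.
Qed.

End outer_functions.

(** * Radial limits and factorization of bounded functions *)

Section bounded_fatou.
Variable R : realType.
Local Notation C := R[i].
Local Notation mu := (@lebesgue_measure R).
Local Notation Ipi := `[- pi, (pi : R)]%classic.
Implicit Types (z w : C) (r s t x y d : R).

(** The sum of the absolute increments has integral at most [2 * K], hence is finite almost
    everywhere, and there the telescoping series converges absolutely. *)
Lemma ae_cvg_summable (u : nat -> R -> R) (K : R) :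
  (forall k, mu.-integrable Ipi (EFin \o u k)) ->
  (forall k, \int[mu]_(t in Ipi) `|u k.+1 t - u k t| <= K / 2 ^+ k) ->
  {ae mu, forall t, Ipi t -> cvgn (u ^~ t)}.
Proof.
move=> iu uK.
pose g k t : \bar R := `|u k.+1 t - u k t|%:E.
have id k : mu.-integrable Ipi (EFin \o (fun t => u k.+1 t - u k t)).
  exact: RintegrableB.
have ig k : mu.-integrable Ipi (g k) := integrable_norm (id k).
have mg k : measurable_fun Ipi (g k) := measurable_int mu (ig k).
have K0 : 0 <= K.
  by have := uK 0%N; rewrite expr0 divr1; apply: le_trans; exact: Rintegral_ge0.
pose S t := (\sum_(k <oo) g k t)%E.
have mS : measurable_fun Ipi S.
  by apply: ge0_emeasurable_sum => // k t _ _; rewrite lee_fin.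
have S0 t : (0 <= S t)%E by apply: nneseries_ge0 => k _ _; rewrite lee_fin.
have iS : (\int[mu]_(t in Ipi) S t <= (2 * K)%:E)%E.
  rewrite integral_nneseries//; last by move=> k t _; rewrite lee_fin.
  apply: lime_le.
    by apply: is_cvg_nneseries => k _ _; apply: integral_ge0 => t _; rewrite lee_fin.
  apply: nearW => n.
  have ek k : (\int[mu]_(t in Ipi) g k t <= (K / 2 ^+ k)%:E)%E.
    have := uK k; rewrite -lee_fin fineK//.
    exact: (integrable_fin_num _ (ig k)).
  apply: (@le_trans _ _ (\sum_(0 <= k < n) (K / 2 ^+ k)%:E)%E).
    by apply: lee_sum => k _; exact: ek.
  rewrite sumEFin lee_fin.
  suff : \sum_(0 <= k < n) K / 2 ^+ k <= 2 * K - 2 * K / 2 ^+ n.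
    by move=> /le_trans; apply; rewrite gerBl divr_ge0 ?mulr_ge0 ?exprn_ge0.
  elim: n => [|n IH]; first by rewrite big_geq// expr0 divr1 subrr.
  rewrite big_nat_recr//=; apply: le_trans (lerD IH (lexx _)) _.
  rewrite le_eqVlt; apply/orP; left; apply/eqP.
  by rewrite exprS; field; rewrite expf_neq0.
have iS' : mu.-integrable Ipi S.
  apply/integrableP; split => //.
  under eq_integral do rewrite gee0_abs//.
  by apply: le_lt_trans iS _; rewrite ltry.
have := @integrable_ae _ _ R mu Ipi (measurable_itv _) S iS'; apply: ae_imp => t /[apply] St.
have : cvgn (series (telescope (u ^~ t))).
  apply: normed_cvg; apply: nondecreasing_is_cvgn.
    by apply/nondecreasing_seqP => n; rewrite /normed_series_of !seriesEnat/= big_nat_recr//= lerDl.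
  exists (fine (S t)) => _ [n _ <-]; rewrite -lee_fin fineK//.
  rewrite /normed_series_of seriesEnat/= -sumEFin.
  by apply: nneseries_lim_ge => k _ _; rewrite lee_fin.
move=> /cvg_ex[l sl]; apply/cvg_ex; exists (u 0%N t + l).
under eq_fun do rewrite (eq_sum_telescope (u ^~ t)).
by apply: cvgD => //; exact: cvg_cst.
Qed.

(** * Square means over circles *)

Section square_means.
Variables (f : C -> C) (M : R).
Hypothesis df : forall z, normc z < 1 -> cdiff f z.
Hypothesis fM : forall z, normc z < 1 -> normc (f z) <= M.

Definition sqmean r := \int[mu]_(t in Ipi) normc (f (r%:C * expi t)) ^+ 2.

Lemma cont_circ r t : 0 < r < 1 ->
  [/\ {for t, continuous (fun t => complex.Re (f (r%:C * expi t)))},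
      {for t, continuous (fun t => complex.Im (f (r%:C * expi t)))} &
      {for t, continuous (fun t => normc (f (r%:C * expi t)))}].
Proof.
move=> /andP[r0 r1]; apply: continuous_circle; apply/cdiff_continuous/df.
by rewrite normc_polar_ge0// ltW.
Qed.

(** The function h(w) = f(w) conj(f(rs / conj w)) is holomorphic for rs < |w| < 1, so its mean is
    the same on the circles of radius r and sqrt(rs). In Taylor coefficients both sides are 2 pi
    times the sum of |a_n|^2 (rs)^n, but no power series is used. *)
Lemma sqmean_cross r s : 0 < r < 1 -> 0 < s < 1 ->
  \int[mu]_(t in Ipi) complex.Re (f (r%:C * expi t) * conjc (f (s%:C * expi t))) =
  sqmean (Num.sqrt (r * s)).
Proof.
move=> /andP[r0 r1] /andP[s0 s1]; set g := Num.sqrt (r * s).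
have rs0 : 0 < r * s by rewrite mulr_gt0.
have g0 : 0 < g by rewrite sqrtr_gt0.
have gg : g * g = r * s by rewrite -expr2 sqr_sqrtr// ltW.
have g1 : g < 1 by rewrite -(@ltr_pXn2r _ 2) ?nnegrE ?(ltW g0)// expr2 gg expr1n mulr_ilt1// ltW.
have rsr : r * s < r by rewrite -[ltRHS]mulr1 ltr_pM2l.
have rsg : r * s < g by rewrite -gg -[ltRHS]mulr1 ltr_pM2l.
pose h w := f w * conjc (f (conjc ((r * s)%:C * w^-1))).
have dh z : r * s < normc z < 1 -> cdiff h z.
  move=> /andP[z1 z2]; apply: cdiffM; first exact: df.
  have nz : z != 0 by rewrite -normc_gt0 (lt_trans rs0).
  apply: (@cdiff_comp _ (fun w => (r * s)%:C * w^-1) (fun w => conjc (f (conjc w)))).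
    by apply: cdiffM; [exact: cdiff_cst|apply: cdiffV => //; exact: cdiff_id].
  apply: cdiff_conj; apply: df.
  rewrite normcJ normcM normcV normc_real gtr0_norm// ltr_pdivrMr ?mul1r//.
  by rewrite (lt_trans rs0).
have hE a b t : 0 < a -> a * b = r * s ->
    complex.Re (h (a%:C * expi t)) = complex.Re (f (a%:C * expi t) * conjc (f (b%:C * expi t))).
  move=> a0 ab; rewrite /h; congr (complex.Re (_ * conjc (f _))).
  have aC : a%:C != 0 :> C by rewrite -normc_gt0 normc_real normr_gt0 gt_eqF.
  have -> : (r * s)%:C * (a%:C * expi t)^-1 = b%:C * expi (- t).
    have cM : (a * b)%:C = a%:C * b%:C :> C by exact: rmorphM.
    have eV : expi (- t) = (expi t)^-1.
      by apply: (mulIf (expi_neq0 t)); rewrite mulVf ?expi_neq0// -expiD addNr expi0.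
    rewrite -ab cM eV; move: (expi t) (a%:C) (b%:C) aC (expi_neq0 t) => e a' b' a'0 e0.
    by field; rewrite a'0 e0.
  by rewrite expiN conjcM conjcK; congr (_ * _); apply: complexP; rewrite /= ?oppr0.
have -> : \int[mu]_(t in Ipi) complex.Re (f (r%:C * expi t) * conjc (f (s%:C * expi t))) =
    cmean h r.
  by apply: eq_Rintegral => t _; rewrite (hE r s).
have -> : sqmean g = cmean h g.
  apply: eq_Rintegral => t _; rewrite (hE g g)// sqr_normcE cReM.
  by case: (f _) => a b /=; ring.
have [rg|gr] := leP r g.
  by apply: (@cmean_open_annulus _ h (r * s) 1) => //; exact: ltW.
by apply/esym; apply: (@cmean_open_annulus _ h (r * s) 1) => //; exact: ltW.
Qed.

Lemma ccont_sq r : 0 < r < 1 -> ccont (fun t => normc (f (r%:C * expi t)) ^+ 2) (- pi) pi.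
Proof.
move=> r01 t _; have [_ _ h] := cont_circ t r01; exact: (cvgM h h).
Qed.

Lemma sqmean_dist r s : 0 < r < 1 -> 0 < s < 1 ->
  \int[mu]_(t in Ipi) normc (f (r%:C * expi t) - f (s%:C * expi t)) ^+ 2 =
  sqmean r + sqmean s - 2 * sqmean (Num.sqrt (r * s)).
Proof.
move=> r01 s01; rewrite -sqmean_cross// /sqmean.
have i1 := ccont_integrable (ccont_sq r01).
have i2 := ccont_integrable (ccont_sq s01).
have i3 : mu.-integrable Ipi (EFin \o (fun t =>
    complex.Re (f (r%:C * expi t) * conjc (f (s%:C * expi t))))).
  apply: ccont_integrable => t _.
  have [a b _] := cont_circ t r01; have [a' b' _] := cont_circ t s01.
  have -> : (fun t => complex.Re (f (r%:C * expi t) * conjc (f (s%:C * expi t)))) =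
     (fun t => complex.Re (f (r%:C * expi t)) * complex.Re (f (s%:C * expi t)) +
               complex.Im (f (r%:C * expi t)) * complex.Im (f (s%:C * expi t))).
    by apply/funext => x; rewrite cReM; case: (f (r%:C * expi x)) => ? ?; case: (f (s%:C * expi x)) => ? ? /=; ring.
  by apply: cvgD; apply: cvgM.
rewrite -RintegralZl// -RintegralD// -RintegralB//; last 2 first.
- exact: RintegrableD.
- exact: RintegrableZ.
apply: eq_Rintegral => t _; rewrite !sqr_normcE cReM cReD cImD cReN cImN.
by case: (f (r%:C * expi t)) => ? ?; case: (f (s%:C * expi t)) => ? ? /=; ring.
Qed.

Lemma sqmean_mid r s : 0 < r < 1 -> 0 < s < 1 ->
  2 * sqmean (Num.sqrt (r * s)) <= sqmean r + sqmean s.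
Proof.
move=> r01 s01; rewrite -subr_ge0 -sqmean_dist//.
by apply: Rintegral_ge0 => t _; rewrite sqr_ge0.
Qed.

Lemma sqmean_le r : 0 < r < 1 -> sqmean r <= M ^+ 2 * (2 * pi).
Proof.
move=> r01; have -> : M ^+ 2 * (2 * pi) = \int[mu]_(t in Ipi) (M ^+ 2).
  by rewrite Rint_cst ?Npi_le_pi//; congr (_ * _); ring.
apply: le_Rintegral => //.
- exact: ccont_integrable (ccont_sq r01).
- by apply: ccont_integrable => t _; exact: cvg_cst.
- move=> t _; have ft : normc (f (r%:C * expi t)) <= M.
    by case/andP: r01 => r0 r1; apply: fM; rewrite normc_polar_ge0// ltW.
  by rewrite ler_pXn2r ?nnegrE ?normc_ge0// (le_trans _ ft)// normc_ge0.
Qed.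

(* [sqmean] is midpoint convex in [ln r] and bounded as [r -> 0]. *)
Lemma sqmean_nondecreasing r s : 0 < r -> r <= s -> s < 1 -> sqmean r <= sqmean s.
Proof.
move=> r0 rs s1; rewrite leNgt; apply/negP => H.
have s0 := lt_le_trans r0 rs.
pose q := r / s; have q0 : 0 < q by rewrite divr_gt0.
have q1 : q <= 1 by rewrite ler_pdivrMr// mul1r.
(* Each [x n.+1] is the geometric mean of its neighbours. By convexity the assumed drop [e] recurs
   at every step inward, so that [sqmean (x n)] would grow without bound. *)
pose x n := s * q ^+ n.
have x01 n : 0 < x n < 1.
  rewrite mulr_gt0 ?exprn_gt0//=; apply: le_lt_trans s1.
  by rewrite ler_piMr ?(ltW s0)// exprn_ile1// ltW.
have xm n : Num.sqrt (x n * x n.+2) = x n.+1.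
  rewrite (_ : x n * x n.+2 = x n.+1 ^+ 2); last by rewrite /x !exprS; ring.
  by rewrite sqrtr_sqr ger0_norm// ltW//; case/andP: (x01 n.+1).
pose e := sqmean r - sqmean s; have e0 : 0 < e by rewrite subr_gt0.
have x0 : x 0%N = s by rewrite /x expr0 mulr1.
have x1 : x 1%N = r by rewrite /x expr1 /q mulrC divfK// gt_eqF.
have D n : e <= sqmean (x n.+1) - sqmean (x n).
  elim: n => [|n IH]; first by rewrite x0 x1.
  have := sqmean_mid (x01 n) (x01 n.+2); rewrite xm; lra.
have S n : sqmean s + n%:R * e <= sqmean (x n).
  elim: n => [|n IH]; first by rewrite x0 mul0r addr0.
  have := D n; rewrite -natr1; lra.
have m0 : 0 <= sqmean s by apply: Rintegral_ge0 => t _; rewrite sqr_ge0.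
have K0 : 0 <= M ^+ 2 * (2 * pi) / e.
  by rewrite divr_ge0 ?(ltW e0)// mulr_ge0 ?sqr_ge0// mulr_ge0// pi_ge0.
have := archi_boundP K0; set n := Num.Def.archi_bound _ => nK.
have := le_trans (S n) (sqmean_le (x01 n)).
by move: nK; rewrite ltr_pdivrMr//; lra.
Qed.

(** For r <= s one has r <= sqrt(rs), so by monotonicity the subtracted term of [sqmean_dist] is at
    least twice [sqmean r]. *)
Lemma sqmean_dist_le r s : 0 < r < 1 -> 0 < s < 1 ->
  \int[mu]_(t in Ipi) normc (f (r%:C * expi t) - f (s%:C * expi t)) ^+ 2 <=
  `|sqmean s - sqmean r|.
Proof.
move=> r01 s01; rewrite sqmean_dist//.
wlog rs : r s r01 s01 / r <= s => [H|].
  have [rs|sr] := leP r s; first exact: H.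
  by have := H s r s01 r01 (ltW sr); rewrite distrC [s * r]mulrC [sqmean s + _]addrC.
case/andP: (r01) => r0 r1; case/andP: (s01) => s0 s1.
rewrite ger0_norm ?subr_ge0 ?sqmean_nondecreasing//.
have rg : r <= Num.sqrt (r * s).
  by rewrite -{1}[r]gtr0_norm// -sqrtr_sqr ler_wsqrtr// expr2 ler_pM2l.
have g1 : Num.sqrt (r * s) < 1.
  by rewrite -sqrtr1 ltr_sqrt// mulr_ilt1// ltW.
have := sqmean_nondecreasing r0 rg g1; lra.
Qed.

(** The square means increase and are bounded, so radii with square means within [(8 ^+ k)^-1] of
    the supremum have square distances controlled by [sqmean_dist_le]. *)
Lemma radii_exist : exists rho : nat -> R, (forall k, 0 < rho k < 1) /\
  rho n @[n --> \oo] --> (1 : R) /\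
  forall k, \int[mu]_(t in Ipi)
     normc (f ((rho k.+1)%:C * expi t) - f ((rho k)%:C * expi t)) ^+ 2 <= (8 ^+ k)^-1.
Proof.
pose A := [set sqmean r | r in [set r : R | 0 < r < 1]].
have hA : has_sup A.
  split; first by exists (sqmean (rad R 0)), (rad R 0) => //=; exact: rad_itv01.
  by exists (M ^+ 2 * (2 * pi)) => _ [r r01 <-]; exact: sqmean_le.
have p8 k : 0 < (8 ^+ k : R)^-1 by rewrite invr_gt0 exprn_gt0.
have /choice[rho rhoP] k : exists r : R, [/\ 0 < r < 1, rad R k <= r &
    sup A - (8 ^+ k)^-1 <= sqmean r].
  have [_ [r /= r01 <-] rP] := sup_adherent (p8 k) hA.
  case/andP: (r01) => r0 r1; case/andP: (rad_itv01 R k) => k0 k1.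
  (* The maximum with [rad R k] forces the chosen radii to tend to 1. *)
  exists (Num.max r (rad R k)); split.
  - by rewrite lt_max r0 gt_max r1 k1.
  - by rewrite le_max lexx orbT.
  - apply: le_trans (ltW rP) _; apply: sqmean_nondecreasing => //.
      by rewrite le_max lexx.
    by rewrite gt_max r1 k1.
have r01 k : 0 < rho k < 1 by have [] := rhoP k.
have up k : sqmean (rho k) <= sup A by apply: ub_le_sup; [case: hA|exists (rho k) => //; exact: r01].
exists rho; split => //; split.
  apply: (@squeeze_cvgr _ _ _ _ (rad R) (cst 1)).
  - by apply: nearW => k; have [/andP[_ h] -> _] := rhoP k; rewrite ltW.
  - exact: cvg_rad.
  - exact: cvg_cst.
move=> k; apply: le_trans (sqmean_dist_le (r01 _) (r01 _)) _.
have [_ _ h1] := rhoP k; have [_ _ h2] := rhoP k.+1.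
have h3 := up k; have h4 := up k.+1.
have h5 : (8 ^+ k.+1 : R)^-1 <= (8 ^+ k)^-1.
  by rewrite lef_pV2 ?posrE ?exprn_gt0// ler_eXn2l//; lra.
move: h1 h2 h3 h4 h5; move: (sup A) (sqmean (rho k)) (sqmean (rho k.+1)) => a b c.
move: (8 ^+ k)^-1 (8 ^+ k.+1)^-1 => p q h1 h2 h3 h4 h5.
by rewrite ler_norml; apply/andP; split; lra.
Qed.

(* The radial limits of [Re f] along a fast sequence of radii give its Poisson
   representation, hence all radial limits. *)
Lemma Re_radial_limit : exists b : R -> R,
  {ae mu, forall t, Ipi t ->
    complex.Re (f (r%:C * expi t)) @[r --> (1 : R)^'-] --> b t}.
Proof.
have [rho [rho01 [rho1 rhoD]]] := radii_exist.
pose u k t := complex.Re (f ((rho k)%:C * expi t)).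
have cu k : ccont (u k) (- pi) pi by move=> t _; have [] := cont_circ t (rho01 k).
have iu k : mu.-integrable Ipi (EFin \o u k) := ccont_integrable (cu k).
have mu_ k : measurable_fun Ipi (u k) by apply/measurable_EFinP; exact: (measurable_int mu (iu k)).
have rn k t : normc ((rho k)%:C * expi t) < 1.
  by case/andP: (rho01 k) => ? ?; rewrite normc_polar_ge0// ltW.
have uM k t : `|u k t| <= M by exact: le_trans (normr_Re_le _) (fM (rn k t)).
have uD k : \int[mu]_(t in Ipi) `|u k.+1 t - u k t| <= (pi + 1) / 2 ^+ k.
  pose g t := normc (f ((rho k.+1)%:C * expi t) - f ((rho k)%:C * expi t)) ^+ 2.
  have ig : mu.-integrable Ipi (EFin \o g).
    apply: ccont_integrable => t _.
    have [a b _] := cont_circ t (rho01 k); have [a' b' _] := cont_circ t (rho01 k.+1).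
    have -> : g = (fun t => (u k.+1 t - u k t) * (u k.+1 t - u k t) +
       (complex.Im (f ((rho k.+1)%:C * expi t)) - complex.Im (f ((rho k)%:C * expi t))) *
       (complex.Im (f ((rho k.+1)%:C * expi t)) - complex.Im (f ((rho k)%:C * expi t)))).
      by apply/funext => x; rewrite /g sqr_normcE cReD cReN cImD cImN.
    by apply: cvgD; apply: cvgM; apply: cvgB.
  have p2 : 0 < (2 ^+ k : R) by rewrite exprn_gt0.
  (* From a <= (2^(-k) + 2^k a^2) / 2: this trades the decay 8^(-k) of the square means for a decay
     2^(-k) of the means. *)
  apply: (@le_trans _ _ (\int[mu]_(t in Ipi) (2^-1 / 2 ^+ k + 2^-1 * 2 ^+ k * g t))).
    apply: le_Rintegral => //.
    - exact: (integrable_norm (RintegrableB _ (iu k.+1) (iu k))).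
    - apply: RintegrableD => //; last exact: RintegrableZ.
      by apply: ccont_integrable => t _; exact: cvg_cst.
    - move=> t _; have : `|u k.+1 t - u k t| ^+ 2 <= g t.
        rewrite /g sqr_normcE cReD cReN real_normK ?num_real// lerDl sqr_ge0//.
      set a := `|_|; move=> ag; have : 0 <= (a * 2 ^+ k - 1) ^+ 2 by rewrite sqr_ge0.
      move=> h.
      have -> : a = (2 * (a * 2 ^+ k)) * (2^-1 / 2 ^+ k) by field; rewrite gt_eqF.
      have -> : 2^-1 * 2 ^+ k * g t = (2 ^+ k) ^+ 2 * g t * (2^-1 / 2 ^+ k).
        by field; rewrite gt_eqF.
      rewrite -[X in _ <= X + _]mul1r -mulrDl ler_wpM2r ?divr_ge0 ?invr_ge0 ?(ltW p2)//.
      have : (2 ^+ k) ^+ 2 * a ^+ 2 <= (2 ^+ k) ^+ 2 * g t by rewrite ler_wpM2l// sqr_ge0.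
      by move: h; lra.
  rewrite RintegralD//; last 2 first.
  - by apply: ccont_integrable => t _; exact: cvg_cst.
  - exact: RintegrableZ.
  rewrite Rint_cst ?Npi_le_pi// RintegralZl//.
  have := rhoD k; rewrite -/g => gk.
  have : 2^-1 * 2 ^+ k * \int[mu]_(t in Ipi) g t <= 2^-1 * 2 ^+ k * (8 ^+ k)^-1.
    by rewrite ler_wpM2l// mulr_ge0// ?invr_ge0// ltW.
  have e8 : 2 ^+ k * (8 ^+ k)^-1 <= (2 ^+ k)^-1 :> R.
    rewrite ler_pdivrMr ?exprn_gt0// mulrC ler_pdivlMr//.
    by rewrite -exprMn; apply: lerXn2r; rewrite ?nnegrE//; lra.
  have -> : 2^-1 / 2 ^+ k * (pi - - pi) = pi / 2 ^+ k :> R by field; rewrite gt_eqF.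
  have i2 : 0 < (2 ^+ k : R)^-1 by rewrite invr_gt0.
  move=> h; rewrite [leRHS]mulrDl mul1r lerD2l; apply: le_trans h _.
  rewrite -mulrA; move: (2 ^+ k * (8 ^+ k)^-1) (2 ^+ k)^-1 e8 i2 => a b; lra.
have := ae_cvg_summable iu uD => uc.
(* The upper limit is measurable without reference to convergence. *)
pose b t := fine (limn_esup (fun n => (u n t)%:E)).
have mb : measurable_fun Ipi b.
  apply: measurableT_comp => //; apply: measurable_fun_limn_esup => n.
  exact/measurable_EFinP.
have ub : {ae mu, forall t, Ipi t -> u n t @[n --> \oo] --> b t}.
  apply: ae_imp uc => t h It; have {}h := h It; move/cvg_ex: (h) => [l ul].
  suff -> : b t = l by [].
  have ul' : (u n t)%:E @[n --> \oo] --> l%:E by apply: cvg_EFin => //; exact: nearW.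
  rewrite /b is_cvg_limn_esupE; last by apply/cvg_ex; exists l%:E.
  by rewrite (cvg_lim _ ul').
have [||||||ib _] := @Rint_dominated R Ipi u b (cst M) => //.
  by apply: ccont_integrable => t _; exact: cvg_cst.
have rep z : normc z < 1 -> complex.Re (f z) = PI b z.
  move=> z1.
  have [||||||_ lim2] := @Rint_dominated R Ipi (fun k t => pk z t * u k t)
    (fun t => pk z t * b t) (cst (2 / (1 - normc z) * M)) => //.
  - by move=> n; apply: measurable_funM => //; exact: measurable_pk.
  - by apply: measurable_funM => //; exact: measurable_pk.
  - by apply: ae_imp ub => t h It; apply: cvgM; [exact: cvg_cst|exact: h].
  - by apply: ccont_integrable => t _; exact: cvg_cst.
  - by move=> n t _; rewrite normrM ler_pM// normr_pk_le.
  have lim1 : 2 * pi * complex.Re (f ((rho n)%:C * z)) @[n --> \oo] --> 2 * pi * complex.Re (f z).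
    apply: cvgM; first exact: cvg_cst.
    suff : (f ((rho n)%:C * z) : C^o) @[n --> \oo] --> (f z : C^o) by move=> /cvg_ReIm[].
    apply: (cvg_comp (fun n => ((rho n)%:C * z : C^o)) (f : C^o -> C^o)) (cdiff_continuous (df z1)).
    have [t _ zE] := polar z; rewrite zE.
    have -> : (fun n => (rho n)%:C * ((normc z)%:C * expi t) : C^o) =
        (fun n => (rho n * normc z)%:C * expi t : C^o).
      by apply/funext => n; rewrite rmorphM/= mulrA.
    apply: cvg_polar; last exact: cvg_cst.
    by rewrite -[X in _ --> X]mul1r; apply: cvgM => //; exact: cvg_cst.
  have E : (fun n => \int[mu]_(t in Ipi) (pk z t * u n t)) =
      (fun n => 2 * pi * complex.Re (f ((rho n)%:C * z))).
    by apply/funext => n; rewrite -poisson_formula.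
  rewrite E in lim2.
  have p0 : 2 * pi != 0 :> R by rewrite gt_eqF// mulr_gt0// pi_gt0.
  apply: (mulfI p0); rewrite /PI mulrA divff// mul1r.
  by rewrite -(cvg_lim (@Rhausdorff R) lim1) -(cvg_lim (@Rhausdorff R) lim2).
exists b; apply: ae_imp (PI_fatou ib) => t h It.
apply: cvg_trans (h It); apply: near_eq_cvg.
have : \forall r \near (1 : R)^'-, 0 < r < 1.
  near=> r; apply/andP; split; near: r; last exact: nbhs_left_lt.
  exact: nbhs_left_gt.
apply: filterS => r /andP[r0 r1]; rewrite rep// normc_polar_ge0// ltW.
Unshelve. all: by end_near. Qed.

End square_means.

Theorem bounded_fatou (f : C -> C) (M : R) :
  (forall z, normc z < 1 -> cdiff f z) -> (forall z, normc z < 1 -> normc (f z) <= M) ->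
  {ae mu, forall t, Ipi t ->
    exists l : C^o, (f (r%:C * expi t) : C^o) @[r --> (1 : R)^'-] --> l}.
Proof.
move=> df fM; have [b1 H1] := Re_radial_limit df fM.
(* Multiplication by -i turns the imaginary part of [f] into a real part. *)
pose g z := (0 -i* 1) * f z.
have dg z : normc z < 1 -> cdiff g z.
  by move=> z1; apply: cdiffM; [exact: cdiff_cst|exact: df].
have gM z : normc z < 1 -> normc (g z) <= M.
  move=> z1; rewrite normcM (_ : normc (0 -i* 1) = 1) ?mul1r ?fM//.
  by rewrite normcE /= expr0n/= sqrrN expr1n add0r sqrtr1.
have [b2 H2] := Re_radial_limit dg gM.
apply: ae_imp2 H1 H2 => t h1 h2 It; exists (b1 t +i* b2 t).
apply/cvg_ReIm; split; first exact: h1.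
have -> : (fun r => complex.Im (f (r%:C * expi t))) =
    (fun r => complex.Re (g (r%:C * expi t))).
  by apply/funext => r; rewrite /g cReM /= mul0r sub0r mulN1r opprK.
exact: h2.
Qed.

End bounded_fatou.

Section bounded_inner_outer.
Variable R : realType.
Local Notation C := R[i].
Local Notation mu := (@lebesgue_measure R).
Local Notation Ipi := `[- pi, (pi : R)]%classic.
Implicit Types (z w : C) (r s t x y d : R) (f : C -> C).

(* For [f] bounded by 1 on the disc, [bmod f] is the modulus of its radial limit
   at almost every point of the circle; [blog f] is the logarithm of [bmod f], with
   junk value 0 on the null set where [bmod f] vanishes. *)
Definition bmod f z : R :=
  Num.min 1 (fine (limn_esup (fun n => (normc (f ((rad R n)%:C * z)))%:E))).

Definition blog f z : R := ln (if 0 < bmod f z then bmod f z else 1).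

Lemma normc_rad_expi n t : normc ((rad R n)%:C * expi t) < 1.
Proof. by have /andP[r0 r1] := rad_itv01 R n; rewrite normc_polar_ge0// ltW. Qed.

Lemma measurable_bmod f : (forall z, normc z < 1 -> cdiff f z) ->
  measurable_fun [set: R] (fun t => bmod f (expi t)).
Proof.
move=> df; apply: measurable_minr => //.
apply: measurableT_comp => //; apply: measurable_fun_limn_esup => n.
apply/measurable_EFinP; apply: continuous_measurable_fun => t.
by have [] := continuous_circle (cdiff_continuous (df _ (normc_rad_expi n t))).
Qed.

Lemma measurable_blog f : (forall z, normc z < 1 -> cdiff f z) ->
  measurable_fun [set: R] (fun t => blog f (expi t)).
Proof.
move=> df; have mb := measurable_bmod df.
apply: measurableT_comp => //; apply: measurable_fun_ifT => //.
exact: measurable_fun_ltr.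
Qed.

Lemma bmod_lim f t (l : R) : l <= 1 ->
  normc (f (r%:C * expi t)) @[r --> (1 : R)^'-] --> l -> bmod f (expi t) = l.
Proof.
move=> l1 H; have Hn := cvg_comp _ _ (@cvg_rad_left R) H.
have He : (normc (f ((rad R n)%:C * expi t)))%:E @[n --> \oo] --> l%:E.
  by apply: cvg_EFin; [exact: nearW|exact: Hn].
rewrite /bmod is_cvg_limn_esupE; last by apply/cvg_ex; exists l%:E.
by rewrite (cvg_lim _ He)//=; apply/min_idPr.
Qed.

Lemma ae_bmod f : (forall z, normc z < 1 -> cdiff f z) ->
  (forall z, normc z < 1 -> normc (f z) <= 1) ->
  {ae mu, forall t, Ipi t -> 0 <= bmod f (expi t) /\
    normc (f (r%:C * expi t)) @[r --> (1 : R)^'-] --> bmod f (expi t)}.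
Proof.
move=> df f1; apply: ae_imp (bounded_fatou df f1) => t h It.
have [l /cvg_normc fl] := h It.
have l1 : normc l <= 1.
  apply: (ler_cvg_to (cvg_comp _ _ (@cvg_rad_left R) fl) (cvg_cst (1 : R))).
  by apply: nearW => n; apply: f1; exact: normc_rad_expi.
by rewrite (bmod_lim l1 fl); split => //; exact: normc_ge0.
Qed.

(** * Integrability of the logarithm of the boundary modulus *)

Section majorant.
Variables (f : C -> C) (a : C).
Hypothesis df : forall z, normc z < 1 -> cdiff f z.
Hypothesis f1 : forall z, normc z < 1 -> normc (f z) <= 1.
Hypothesis a1 : normc a < 1.
Hypothesis fa : f a != 0.

Let b t := bmod f (expi t).
(** Truncation from below keeps the logarithm bounded, as [outer_majorant] requires. *)
Let v n t := ln (Num.max (b t) (expR (- n%:R))).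

Let b1 t : b t <= 1. Proof. by rewrite /b /bmod ge_min lexx. Qed.

Let max0 n t : 0 < Num.max (b t) (expR (- n%:R)).
Proof. by rewrite lt_max expR_gt0 orbT. Qed.

Let v_itv n t : - n%:R <= v n t <= 0.
Proof.
apply/andP; split.
  by rewrite -[X in X <= _]expRK ler_ln ?posrE ?expR_gt0// le_max lexx orbT.
apply: ln_le0; rewrite ge_max b1/= -[leRHS]expR0 ler_expR oppr_le0.
exact: ler0n.
Qed.

Let mb : measurable_fun [set: R] b. Proof. exact: measurable_bmod. Qed.

Let mv n : measurable_fun Ipi (v n).
Proof.
apply: (@measurable_funS _ _ _ _ setT) => //.
by apply: measurableT_comp => //; apply: measurable_maxr.
Qed.

Let iv n : mu.-integrable Ipi (EFin \o v n).
Proof.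
have ic : mu.-integrable Ipi (EFin \o cst (n%:R : R)).
  by apply: ccont_integrable => t _; exact: cvg_cst.
apply: le_integrable ic => //; first by apply/measurable_EFinP; exact: mv.
move=> t _ /=; rewrite lee_fin [leRHS]ger0_norm ?ler0n// ler_norml.
by have /andP[-> h] := v_itv n t; rewrite (le_trans h).
Qed.

Let majn n z : normc z < 1 -> normc (f z) <= expR (PI (v n) z).
Proof.
apply: (@outer_majorant _ f (v n) b 1 (- n%:R)) => //.
- by move=> t _; have /andP[] := v_itv n t.
- exact: (@measurable_funS _ _ _ _ setT).
- apply: ae_imp (ae_bmod df f1) => t h It; have [_ {}h] := h It.
  exact: (cvg_comp _ _ (@cvg_rad_left R) h).
- by apply: aeW => t _; rewrite lnK ?posrE// le_max lexx.
Qed.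

Let K : R := 2 / (1 - normc a) * (2 * pi * - ln (normc (f a))).

(** At [a], [majn] bounds [ln (normc (f a))] by the Poisson integral of [v n]. As [v n] is
    nonpositive and the kernel is at least [(1 - normc a) / 2], one nonzero value of [f] controls
    all the truncations at once. *)
Let boundK n : (\int[mu]_(t in Ipi) (- v n t)%:E <= K%:E)%E.
Proof.
have nfa : 0 < normc (f a) by rewrite normc_gt0.
have inv : mu.-integrable Ipi (EFin \o (fun t => - v n t)).
  rewrite (_ : (fun t => - v n t) = (fun t => -1 * v n t)); first exact: RintegrableZ.
  by apply/funext => t; rewrite mulN1r.
rewrite -[leLHS]fineK; last exact: (@integrable_fin_num _ _ _ mu _ _ _ inv).
rewrite lee_fin -/(Rintegral mu Ipi _) /K.
have p0 : 0 < 2 * pi :> R by rewrite mulr_gt0// pi_gt0.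
have c0 : 0 < 1 - normc a by rewrite subr_gt0.
have h1 : 2 * pi * ln (normc (f a)) <= \int[mu]_(t in Ipi) (pk a t * v n t).
  by have := majn n a1; rewrite -{1}[normc (f a)]lnK ?posrE// ler_expR ler_pdivlMl.
have h2 : (1 - normc a) / 2 * \int[mu]_(t in Ipi) (- v n t) <=
    - (\int[mu]_(t in Ipi) (pk a t * v n t)).
  have -> : (1 - normc a) / 2 * \int[mu]_(t in Ipi) (- v n t) =
      \int[mu]_(t in Ipi) ((1 - normc a) / 2 * - v n t) by rewrite RintegralZl.
  have -> : - (\int[mu]_(t in Ipi) (pk a t * v n t)) =
      \int[mu]_(t in Ipi) (-1 * (pk a t * v n t)).
    by rewrite RintegralZl ?mulN1r//; exact: integrable_pkM.
  apply: le_Rintegral => //.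
  - exact: RintegrableZ.
  - by apply: RintegrableZ => //; exact: integrable_pkM.
  - move=> t _; rewrite mulN1r -mulrN ler_wpM2r ?pk_ge//.
    by rewrite oppr_ge0; have /andP[] := v_itv n t.
rewrite -ler_pdivrMl ?divr_gt0// invf_div.
by move: h1 h2; move: (Rintegral _ _ _) => A h1 h2; lra.
Qed.

(** This limit is [+oo] where [b] vanishes, so that its integrability gives both the integrability
    of the logarithm and the positivity of [b] almost everywhere. *)
Let S t : \bar R := limn_einf (fun n => (- v n t)%:E).

Let Spos t : 0 < b t -> S t = (- ln (b t))%:E.
Proof.
move=> b0; suff H : (- v n t)%:E @[n --> \oo] --> (- ln (b t))%:E.
  by rewrite /S is_cvg_limn_einfE; [exact: cvg_lim|apply/cvg_ex; exists (- ln (b t))%:E].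
apply: cvg_EFin; first exact: nearW.
apply: cvg_near_cst.
have [N] : exists N : nat, - ln (b t) < N%:R.
  exists (Num.Def.archi_bound (- ln (b t))); apply: archi_boundP.
  by rewrite oppr_ge0 ln_le0.
move=> HN; exists N => // n /= Nn; rewrite /v; congr (- ln _).
apply/max_idPl; rewrite -[leRHS]lnK ?posrE// ler_expR lerNl.
by rewrite (le_trans (ltW HN))// ler_nat.
Qed.

Let Sneg t : ~~ (0 < b t) -> S t = +oo%E.
Proof.
rewrite -leNgt => b0.
have -> : S t = limn_einf (fun n => (n%:R)%:E : \bar R).
  congr limn_einf; apply/funext => n; rewrite /v.
  have /max_idPr -> : b t <= expR (- n%:R) by rewrite (le_trans b0)// expR_ge0.
  by rewrite expRK opprK.
have H : (n%:R)%:E @[n --> \oo] --> (+oo%E : \bar R) by apply/cvgenyP.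
rewrite is_cvg_limn_einfE; first exact: cvg_lim.
by apply/cvg_ex; exists +oo%E.
Qed.

Let mS : measurable_fun Ipi S.
Proof.
rewrite (_ : S = fun t => (- limn_esup (fun n => (v n t)%:E))%E).
  apply: measurableT_comp => //; apply: measurable_fun_limn_esup => n.
  by apply/measurable_EFinP; exact: mv.
by apply/funext => t; rewrite -limn_einfN.
Qed.

Let iS : mu.-integrable Ipi S.
Proof.
have S0 t : (0 <= S t)%E.
  have [b0|b0] := boolP (0 < b t); last by rewrite Sneg.
  by rewrite Spos// lee_fin oppr_ge0 ln_le0.
apply/integrableP; split => //.
under eq_integral do rewrite gee0_abs//.
apply: (@le_lt_trans _ _ K%:E); last by rewrite ltry.
apply: le_trans (fatou _ _ _ _) _ => //.
- move=> n; apply/measurable_EFinP; apply: measurableT_comp => //; exact: mv.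
- by move=> n t _; rewrite lee_fin oppr_ge0; have /andP[] := v_itv n t.
rewrite limn_einf_lim; apply: lime_le; first exact: is_cvg_einfs.
apply: nearW => n; apply: le_trans (boundK n).
by apply: ereal_inf_lbound; exists n => /=.
Qed.

Lemma blogE t : 0 < bmod f (expi t) -> blog f (expi t) = ln (bmod f (expi t)).
Proof. by rewrite /blog => ->. Qed.

Lemma ae_bmod_gt0 : {ae mu, forall t, Ipi t -> 0 < bmod f (expi t)}.
Proof.
have := @integrable_ae _ _ R mu Ipi (measurable_itv _) S iS; apply: ae_imp => t /[apply].
by have [//|b0] := boolP (0 < b t); rewrite Sneg.
Qed.

Lemma integrable_blog : mu.-integrable Ipi (EFin \o (fun t => blog f (expi t))).
Proof.
apply: le_integrable iS => //.
  apply/measurable_EFinP; apply: (@measurable_funS _ _ _ _ setT) => //.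
  exact: measurable_blog.
move=> t _ /=; have [b0|b0] := boolP (0 < b t).
  by rewrite Spos//= lee_fin blogE// normrN.
by rewrite Sneg// leey.
Qed.

(** The truncation in [majn] is removed by dominated convergence: almost everywhere [v n] lies
    between [blog f] and 0. *)
Lemma bounded_majorant z : normc z < 1 ->
  normc (f z) <= expR (PI (fun t => blog f (expi t)) z).
Proof.
move=> z1.
have [||||||_ H] := @Rint_dominated_ae R Ipi (fun n t => pk z t * v n t)
  (fun t => pk z t * blog f (expi t))
  (fun t => 2 / (1 - normc z) * `|blog f (expi t)|) => //.
- by move=> n; apply: measurable_funM => //; exact: measurable_pk.
- apply: measurable_funM; first exact: measurable_pk.
  apply: (@measurable_funS _ _ _ _ setT) => //; exact: measurable_blog.
- apply: ae_imp ae_bmod_gt0 => t h It; apply: cvgM; first exact: cvg_cst.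
  rewrite blogE ?h//.
  apply: cvg_near_cst.
  have [N] : exists N : nat, - ln (b t) < N%:R.
    exists (Num.Def.archi_bound (- ln (b t))); apply: archi_boundP.
    by rewrite oppr_ge0 ln_le0.
  move=> HN; exists N => // n /= Nn; rewrite /v; congr ln.
  apply/max_idPl; rewrite -[leRHS]lnK ?posrE ?h// ler_expR lerNl.
  by rewrite (le_trans (ltW HN))// ler_nat.
- by apply: RintegrableZ => //; exact: (integrable_norm integrable_blog).
- apply: ae_imp ae_bmod_gt0 => t h It n; have b0 := h It.
  rewrite normrM ler_pM ?normr_pk_le// blogE//.
  have /andP[_ v0] := v_itv n t.
  rewrite (ler0_norm v0) (ler0_norm (ln_le0 (b1 t))).
  by rewrite lerN2 ler_ln ?posrE// le_max lexx.
have p0 : 0 < 2 * pi :> R by rewrite mulr_gt0// pi_gt0.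
have [->|fz] := eqVneq (f z) 0; first by rewrite normc_real normr0 expR_ge0.
have nfz : 0 < normc (f z) by rewrite normc_gt0.
rewrite -[normc (f z)]lnK ?posrE// ler_expR ler_pdivlMl//.
apply: (ler_cvg_to (cvg_cst _) H); apply: nearW => n.
by have := majn n z1; rewrite -{1}[normc (f z)]lnK ?posrE// ler_expR ler_pdivlMl.
Qed.

(** The quotient is bounded by 1, so radial limits exist by [bounded_fatou]; their modulus is the
    boundary modulus of [f] divided by itself. *)
Lemma bounded_inner :
  {ae mu, forall t, Ipi t -> exists2 l : C^o,
    (f (r%:C * expi t) / oexp (fun t => blog f (expi t)) (r%:C * expi t) : C^o)
      @[r --> (1 : R)^'-] --> l & normc l = 1}.
Proof.
pose q z := f z * (oexp (fun t => blog f (expi t)) z)^-1.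
have iu := integrable_blog.
have dq z : normc z < 1 -> cdiff q z.
  move=> z1; apply: cdiffM; first exact: df.
  by apply: cdiffV; [exact: oexp_neq0|exact: cdiff_oexp].
have q1 z : normc z < 1 -> normc (q z) <= 1.
  move=> z1; rewrite normcM normcV normc_oexp ler_pdivrMr ?expR_gt0// mul1r.
  exact: bounded_majorant.
apply: ae_imp2 (ae_imp2 (fun _ h1 h2 => conj h1 h2) (bounded_fatou dq q1) (ae_bmod df f1))
  (ae_imp2 (fun _ h1 h2 => conj h1 h2) ae_bmod_gt0 (oexp_fatou iu)).
move=> t [h1 h2] [h3 h4] It.
have [l ql] := h1 It; exists l; first exact: ql.
have [_ fb] := h2 It; have b0 := h3 It.
have c2 : normc (q (r%:C * expi t)) @[r --> (1 : R)^'-] --> normc l.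
  exact: (cvg_normc ql).
have : normc (q (r%:C * expi t)) @[r --> (1 : R)^'-] --> bmod f (expi t) * (expR (blog f (expi t)))^-1.
  under eq_fun do rewrite normcM normcV.
  apply: cvgM; first exact: fb.
  by apply: cvgV; [rewrite gt_eqF// expR_gt0|exact: h4].
rewrite blogE// lnK ?posrE// divff ?gt_eqF// => c1.
by rewrite -(cvg_lim (@Rhausdorff R) c1) -(cvg_lim (@Rhausdorff R) c2).
Qed.

End majorant.

End bounded_inner_outer.

(** * Periodic functions *)

Section translation.
Variable R : realType.
Local Notation mu := (@lebesgue_measure R).
Local Notation Ipi := `[- pi, (pi : R)]%classic.
Implicit Types (c t : R).

Definition shiftR c : measurableTypeR R -> measurableTypeR R := fun x => x + c.

Lemma measurable_shiftR c : measurable_fun setT (shiftR c).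
Proof.
apply: (@continuous_measurable_fun R (fun x => x + c)) => x.
by apply: cvgD; [exact: cvg_id|exact: cvg_cst].
Qed.

(** Lebesgue measure is determined by the lengths of intervals, which a translation preserves. *)
Lemma lebesgue_measureD c (A : set (measurableTypeR R)) : measurable A ->
  mu (shiftR c @^-1` A) = mu A.
Proof.
move=> mA; pose phi := mfun_Sub (mem_set (measurable_shiftR c)).
rewrite -[LHS]/(pushforward mu phi A).
apply/esym/lebesgue_measure_unique => //= _ [[a b]] _ <-.
rewrite /pushforward (_ : phi @^-1` _ = `](a - c), (b - c)]%classic); last first.
  by apply/seteqP; split => x; rewrite /= !in_itv/= /shiftR ltrBlDr lerBrDr.
rewrite !lebesgue_measure_itv/= !lte_fin ltrD2r; case: ifPn => // _.
by rewrite -!EFinB; congr EFin; ring.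
Qed.

Lemma ge0_integral_shift c (D : set (measurableTypeR R)) (f : R -> \bar R) :
  measurable D -> measurable_fun D f -> (forall x, (0 <= f x)%E) ->
  (\int[mu]_(x in D) f x = \int[mu]_(x in shiftR c @^-1` D) f (shiftR c x))%E.
Proof.
move=> mD mf f0.
have := @ge0_integral_pushforward _ _ _ _ R (shiftR c) (measurable_shiftR c) mu D f
  mD mf (fun x _ => f0 x).
move=> <-; apply: eq_measure_integral; first exact: measurable_shiftR.
by move=> h A mA AS; rewrite -[LHS](lebesgue_measureD c mA).
Qed.

Lemma ae_shift c (P : R -> Prop) : {ae mu, forall t, P t} ->
  {ae mu, forall t, P (t + c)}.
Proof.
move=> [A [mA A0 AP]]; exists (shiftR c @^-1` A); split.
- by rewrite -[X in measurable X]setTI; exact: measurable_shiftR.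
- by rewrite lebesgue_measureD.
- by move=> t /= H; exact: AP.
Qed.

(** [inner_function] speaks of almost all real [t], the Poisson estimates of one period. A multiple
    of [2 * pi] moves each [t] into the period, and countably many translates of a null set form a
    null set. *)
Lemma ae_periodic (P : R -> Prop) : (forall t, P (t + 2 * pi) <-> P t) ->
  {ae mu, forall t, Ipi t -> P t} -> {ae mu, forall t, P t}.
Proof.
move=> per H.
have p0 : 0 < 2 * pi :> R by rewrite mulr_gt0// pi_gt0.
have perp n t : P (t + n%:R * (2 * pi)) <-> P t.
  elim: n t => [|n IH] t; first by rewrite mul0r addr0.
  by rewrite -natr1 mulrDl mul1r addrA per.
have pern n t : P (t - n%:R * (2 * pi)) <-> P t.
  by rewrite -(perp n (t - _)) subrK.
have H1 := ae_foralln (fun n : nat => ae_shift (n%:R * (2 * pi)) H).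
have H2 := ae_foralln (fun n : nat => ae_shift (- (n%:R * (2 * pi))) H).
apply: ae_imp2 H1 H2 => t h1 h2.
pose x := (t + pi) / (2 * pi).
have xE : t = x * (2 * pi) - pi by rewrite /x divfK ?gt_eqF// addrK.
have key y : Num.floor x = y -> - pi <= t - y%:~R * (2 * pi) <= pi.
  move=> <-; have fl := floor_le_tmp x; have fg := floorD1_gt x.
  rewrite intrD in fg; rewrite xE; apply/andP; split.
    by rewrite lerBrDr addrC lerD2r ler_pM2r.
  have : x * (2 * pi) <= ((Num.floor x)%:~R + 1%:~R) * (2 * pi) by rewrite ler_pM2r// ltW.
  by rewrite mulrDl mul1r; lra.
case E : (Num.floor x) => [n|n]; have := key _ E.
  by move=> /= tI; rewrite -(pern n); apply: h2; rewrite /= in_itv.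
rewrite NegzE mulrNz mulNr opprK => /= tI.
by rewrite -(perp n.+1); apply: h1; rewrite /= in_itv.
Qed.

(** [lux_norm] integrates over [[0, 2 * pi]], Poisson integrals over [[- pi, pi]]; the upper half of
    the first interval is translated to the lower half of the second. *)
Lemma integral_2pi_periodic (h : R -> \bar R) : measurable_fun [set: R] h ->
  (forall t, (0 <= h t)%E) -> (forall t, h (t + 2 * pi) = h t) ->
  (\int[mu]_(t in `[0%R, (2 * pi)%R]) h t = \int[mu]_(t in Ipi) h t)%E.
Proof.
move=> mh h0 per; have p0 := pi_gt0 R.
have mS (D : set R) : measurable D -> measurable_fun D h.
  by move=> mD; apply: (@measurable_funS _ _ _ _ setT).
rewrite (@itv_bndbnd_setU _ _ (BLeft 0) (BLeft (pi : R)) (BRight (2 * pi))); last 2 first.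
  by rewrite bnd_simp ltW.
  by rewrite bnd_simp; lra.
rewrite ge0_integral_setU//=; last 2 first.
- exact: mS (measurableU _ _ _ _).
- apply/disj_setPS => x [] /=; rewrite !in_itv/= => /andP[_ x1] /andP[x2 _].
  by move: (lt_le_trans x1 x2); rewrite ltxx.
rewrite (@ge0_integral_shift (2 * pi) `[(pi : R), (2 * pi)%R]%classic)//; last exact: mS.
have -> : shiftR (2 * pi) @^-1` `[(pi : R), (2 * pi)%R]%classic = `[(- pi : R), 0%R]%classic.
  by apply/seteqP; split => x; rewrite /= !in_itv/= /shiftR => /andP[? ?]; apply/andP; split; lra.
under [X in (_ + X)%E]eq_integral do rewrite /shiftR per.
rewrite -(@integral_itv_bndo_bndc _ (BLeft (- pi : R)) 0); last exact: mS.
rewrite addeC -ge0_integral_setU//=; last 2 first.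
- exact: mS (measurableU _ _ _ _).
- apply/disj_setPS => x [] /=; rewrite !in_itv/= => /andP[_ x1] /andP[x2 _].
  by move: (lt_le_trans x1 x2); rewrite ltxx.
rewrite -itv_bndbnd_setU; [|by rewrite bnd_simp oppr_le0 ltW|by rewrite bnd_simp ltW].
by rewrite integral_itv_bndo_bndc//; exact: mS.
Qed.

End translation.

(** * Jensen and maximal inequalities for growth functions *)

Section growth.
Variable R : realType.
Local Notation C := R[i].
Local Notation mu := (@lebesgue_measure R).
Local Notation Ipi := `[- pi, (pi : R)]%classic.
Implicit Types (z w : C) (r s t x y d : R) (u : R -> R).

Variables (Phi : R -> R) (p K : R).
Hypothesis Phi_mono : forall s t : R, 0 <= s -> s <= t -> Phi s <= Phi t.
Hypothesis Phi0 : Phi 0 = 0.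
Hypothesis Phi_gt0 : forall t : R, 0 < t -> 0 < Phi t.
Hypothesis p0 : 0 < p.
Hypothesis K1 : 1 < K.
Hypothesis Phi_low : forall s t : R, 0 <= s -> 0 <= t -> t <= 1 ->
  Phi (s * t) <= K * t `^ p * Phi s.

Let K0 : 0 < K. Proof. exact: lt_trans K1. Qed.

Lemma Phi_ge0 x : 0 <= x -> 0 <= Phi x.
Proof. by move=> x0; rewrite -Phi0; exact: Phi_mono. Qed.

Lemma measurable_Phi (D : set R) u : measurable D -> measurable_fun D u ->
  (forall t, 0 <= u t) -> measurable_fun D (fun t => Phi (u t)).
Proof.
move=> mD mu_ u0.
rewrite (_ : (fun t => Phi (u t)) = (fun x => Phi (Num.max x 0)) \o u).
  apply: measurableT_comp => //; apply: nondecreasing_measurable => // x y xy.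
  apply: Phi_mono; first by rewrite le_max lexx orbT.
  by rewrite ge_max !le_max xy lexx orbT.
by apply/funext => t /=; rewrite (max_idPl (u0 t)).
Qed.

(** The lower type compares [expR s] with 1 through the ratio [expR (- s)]. It yields the
    exponential growth behind the decay of the level sets. *)
Lemma Phi_expR_lower s : 0 <= s -> Phi 1 / K * expR (s * p) <= Phi (expR s).
Proof.
move=> s0; have := @Phi_low (expR s) (expR (- s)).
rewrite expR_ge0 -expRD subrr expR0 -expRM => /(_ isT (expR_ge0 _)).
rewrite expR_le1 oppr_le0 => /(_ s0) H.
rewrite mulrAC ler_pdivrMr// -ler_pdivlMr ?expR_gt0// -expRN.
by rewrite -mulNr; apply: le_trans H _; rewrite mulrAC [Phi _ * _]mulrC.
Qed.

(** With [k] the (1/p)-th power of [A' * K], the factor that the lower type gives at the ratio 1/k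
    is exactly the inverse of [A']. The maximum with 1 in [A'] ensures [1 <= k]. *)
Lemma Phi_absorb (A : R) : exists2 k : R, 1 <= k &
  forall x, 0 <= x -> A * Phi (x / k) <= Phi x.
Proof.
pose A' := Num.max A 1; have A1 : 1 <= A' by rewrite le_max lexx orbT.
have A0 : 0 < A' by exact: lt_le_trans A1.
pose q := ln (A' * K) / p.
have AK : 1 <= A' * K by rewrite -[1]mulr1 ler_pM// ltW.
have q0 : 0 <= q by rewrite divr_ge0 ?ln_ge0// ltW.
exists (expR q); first by rewrite -[X in X <= _]expR0 ler_expR.
move=> x x0; rewrite -expRN.
have kx : 0 <= x * expR (- q) by rewrite mulr_ge0// expR_ge0.
apply: (@le_trans _ _ (A' * Phi (x * expR (- q)))).
  by rewrite ler_wpM2r ?Phi_ge0// le_max lexx.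
have := @Phi_low x (expR (- q)) x0 (expR_ge0 _).
rewrite expR_le1 oppr_le0 => /(_ q0) /(ler_wpM2l (ltW A0)) H.
apply: le_trans H _.
rewrite -expRM mulNr /q divfK ?gt_eqF// expRN lnK ?posrE ?mulr_gt0//.
rewrite !mulrA divff ?mul1r// gt_eqF// mulr_gt0//.
Qed.

(* Although [Phi o exp] need not be convex, the lower type gives it supporting
   lines up to the factor [K / p]; this replaces convexity in Jensen's inequality. *)
Lemma Phi_tangent x y : Phi (expR y) * (x - y) <= K / p * Phi (expR x).
Proof.
have [xy|yx] := leP x y.
  apply: (@le_trans _ _ 0).
    by rewrite mulr_ge0_le0 ?Phi_ge0 ?expR_ge0// subr_le0.
  by rewrite mulr_ge0 ?Phi_ge0 ?expR_ge0// divr_ge0// ltW.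
set s := x - y; have s0 : 0 < s by rewrite subr_gt0.
have := @Phi_low (expR x) (expR (- s)) (expR_ge0 _) (expR_ge0 _).
rewrite expR_le1 oppr_le0 ltW// => /(_ isT).
have -> : expR x * expR (- s) = expR y by rewrite -expRD; congr expR; rewrite /s; ring.
rewrite -expRM => H.
have := ler_wpM2r (ltW s0) H; move/le_trans; apply.
rewrite mulrAC ler_wpM2r ?Phi_ge0 ?expR_ge0// -mulrA ler_wpM2l ?(ltW K0)//.
(* The factor [1 / p] is a bound for [s * expR (- (s * p))], as [expR (s * p)] is at least
   [s * p]. *)
rewrite -[leRHS]mul1r ler_pdivlMr// mulNr expRN.
rewrite (_ : _ * p = s * p / expR (s * p)); last by ring.
rewrite ler_pdivrMr ?expR_gt0// mul1r.
by apply: le_trans (expR_ge1Dx (s * p)); rewrite lerDr.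
Qed.

(** [Phi_tangent] is integrated at a point [y] one below the mean of [u], so that [u - y] has mean
    exactly 1. At the mean itself the left-hand side would vanish, which is why the shift by 1
    cannot simply be dropped. *)
Lemma PhiE_jensen u z : normc z < 1 -> mu.-integrable Ipi (EFin \o u) ->
  mu.-integrable Ipi (EFin \o (fun t => Phi (expR (u t)))) ->
  Phi (expR (PI u z - 1)) <= K / p * PI (fun t => Phi (expR (u t))) z.
Proof.
move=> z1 iu iP; set y := PI u z - 1.
have pp : 0 < 2 * pi :> R by rewrite mulr_gt0// pi_gt0.
have ic (c : R) : mu.-integrable Ipi (EFin \o cst c).
  by apply: ccont_integrable => t _; exact: cvg_cst.
have iuy : mu.-integrable Ipi (EFin \o (fun t => u t - y)).
  by apply: RintegrableB => //; exact: ic.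
have L : \int[mu]_(t in Ipi) (pk z t * (Phi (expR y) * (u t - y))) <=
   \int[mu]_(t in Ipi) (pk z t * (K / p * Phi (expR (u t)))).
  apply: le_Rintegral => //.
  - by apply: integrable_pkM => //; exact: RintegrableZ.
  - by apply: integrable_pkM => //; exact: RintegrableZ.
  - move=> t _; rewrite ler_wpM2l ?(ltW (pk_gt0 t z1))//.
    exact: Phi_tangent.
have E1 : \int[mu]_(t in Ipi) (pk z t * (Phi (expR y) * (u t - y))) =
    Phi (expR y) * (2 * pi).
  have -> : \int[mu]_(t in Ipi) (pk z t * (Phi (expR y) * (u t - y))) =
      \int[mu]_(t in Ipi) (Phi (expR y) * (pk z t * u t - pk z t * y)).
    by apply: eq_Rintegral => t _; ring.
  have ipu := integrable_pkM z1 iu; have ipy := integrable_pkM z1 (ic y).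
  rewrite RintegralZl//; last exact: RintegrableB.
  congr (_ * _); rewrite RintegralB// RintegralZr//; last first.
    by apply: ccont_integrable => t _; exact: continuous_pk.
  rewrite integral_pk// /y /PI mulrBr mulr1 mulrA divff ?gt_eqF// mul1r; ring.
have E2 : \int[mu]_(t in Ipi) (pk z t * (K / p * Phi (expR (u t)))) =
    K / p * \int[mu]_(t in Ipi) (pk z t * Phi (expR (u t))).
  rewrite -RintegralZl//; last exact: integrable_pkM.
  by apply: eq_Rintegral => t _; rewrite mulrCA.
move: L; rewrite E1 E2 => L; rewrite /PI [leRHS]mulrCA ler_pdivlMl// mulrC; exact: L.
Qed.

Lemma HL_maximal_ball X x h (b : R) : 0 < h -> 0 <= b ->
  mu.-integrable setT (EFin \o X) -> (forall s, 0 <= X s) ->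
  (HL_maximal X x <= b%:E)%E -> \int[mu]_(s in ball x h) X s <= 2 * b * h.
Proof.
move=> h0 b0 iX X0 H.
have : (iavg X (ball x h) <= b%:E)%E.
  apply: le_trans H; apply: ereal_sup_ubound; exists h => //.
  by rewrite /= in_itv/= h0.
rewrite /iavg lebesgue_measure_ball ?(ltW h0)//.
rewrite inver mulrn_eq0 (gt_eqF h0)/= lee_pdivrMl ?mulrn_wgt0//.
rewrite -lee_fin => H1; rewrite fineK; last first.
  apply: integrable_fin_num => //; first exact: measurable_ball.
  by apply: (@integrableS _ _ _ mu setT) => //; exact: measurable_ball.
apply: (@le_trans _ _ (\int[mu]_(y in ball x h) `|(X y)%:E|)%E).
  rewrite le_eqVlt; apply/orP; left; apply/eqP; apply: eq_integral => s _.
  by rewrite gee0_abs// lee_fin.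
apply: le_trans H1 _; rewrite -EFinM lee_fin; lra.
Qed.

(** The exceptional set consists of a level set of the Hardy-Littlewood maximal function and its
    translates by [2 * pi] and [- (2 * pi)], three sets of measure at most 3/b times the integral.
    Off it the balls of all sizes are controlled with constant [2 * b], so [N] may tend to infinity
    in [Rint_pk_le], leaving 48 * 8 * (2 * b). *)
Lemma poisson_weak_type X (b : R) : mu.-integrable Ipi (EFin \o X) ->
  (forall t, 0 <= X t) -> 0 < b ->
  exists E : set R, [/\ measurable E,
    (mu E <= (9 / b)%:E * (\int[mu]_(t in Ipi) X t)%:E)%E &
    forall t r, Ipi t -> ~ E t -> 2^-1 <= r < 1 ->
      PI X (r%:C * expi t) <= 48 * 16 * b].
Proof.
move=> iX X0 b0; pose Y := X \_ Ipi.
have pi0 := pi_gt0 R.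
have iY : mu.-integrable setT (EFin \o Y) by exact: integrable_restrictT.
have Y0 t : 0 <= Y t by rewrite /Y patchE; case: ifPn.
have YI t : ~ Ipi t -> Y t = 0.
  by move=> tI; rewrite /Y patchE; case: ifPn => //; rewrite inE.
have loc : locally_integrable setT Y by exact: integrable_locally_restrict.
pose H : set R := [set x | (b%:E < HL_maximal Y x)%E].
have mH : measurable H.
  rewrite -[X in measurable X]setTI; apply: emeasurable_fun_o_infty => //.
  exact: measurable_HL_maximal.
have nH : (mu H <= (3 / b)%:E * (\int[mu]_(t in Ipi) X t)%:E)%E.
  apply: le_trans (maximal_inequality loc b0) _.
  rewrite lee_wpmul2l ?lee_fin ?divr_ge0 ?(ltW b0)//.
  rewrite fineK; last exact: (@integrable_fin_num _ _ _ mu).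
  rewrite [leRHS]integral_mkcond le_eqVlt; apply/orP; left; apply/eqP.
  apply: eq_integral => s _; rewrite gee0_abs ?lee_fin// /Y !patchE.
  by case: ifPn.
pose Hc c := shiftR c @^-1` H.
have mHc c : measurable (Hc c).
  by rewrite -[X in measurable X]setTI; exact: measurable_shiftR.
have nHc c : (mu (Hc c) <= (3 / b)%:E * (\int[mu]_(t in Ipi) X t)%:E)%E.
  by rewrite lebesgue_measureD.
have mE1 := measurableU _ _ (mHc 0) (mHc (2 * pi)).
have mE := measurableU _ _ mE1 (mHc (- (2 * pi))).
exists (Hc 0 `|` Hc (2 * pi) `|` Hc (- (2 * pi))); split.
- exact: mE.
- apply: le_trans (measureU2 _ mE1 (mHc _)) _.
  have -> : ((9 / b)%:E * (\int[mu]_(t in Ipi) X t)%:E =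
    (3 / b)%:E * (\int[mu]_(t in Ipi) X t)%:E + (3 / b)%:E * (\int[mu]_(t in Ipi) X t)%:E +
    (3 / b)%:E * (\int[mu]_(t in Ipi) X t)%:E)%E.
    by rewrite -!EFinM -!EFinD; congr EFin; ring.
  apply: leeD; last exact: nHc.
  by apply: le_trans (measureU2 _ (mHc _) (mHc _)) _; apply: leeD; exact: nHc.
move=> t r tI nE r12.
have tI' : - pi <= t <= pi by move: tI; rewrite /= in_itv.
have HLc c : c \in [:: t; t + 2 * pi; t - 2 * pi] -> (HL_maximal Y c <= b%:E)%E.
  move=> ct; rewrite leNgt; apply/negP => Hlt; apply: nE.
  move: ct; rewrite !inE => /or3P[] /eqP ct; rewrite ct in Hlt.
  - by left; left; rewrite /Hc /= /shiftR addr0.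
  - by left; right.
  - by right.
have d0 : 0 < 1 - r by case/andP: r12 => _ ?; rewrite subr_gt0.
have B N := @Rint_pk_le R Y r t (2 * b) N r12 tI' iY Y0 YI.
set I := \int[mu]_t Y t in B.
have I0 : 0 <= I by exact: Rintegral_ge0.
have L N : \int[mu]_(s in Ipi) (pk (r%:C * expi t) s * Y s) <=
    48 * (8 * (2 * b) + (4 ^+ N * (1 - r))^-1 * I).
  apply: B => c k ck kN; apply: HL_maximal_ball => //; first by rewrite mulr_gt0// exprn_gt0.
    exact: ltW.
  exact: HLc.
have lim : 48 * (8 * (2 * b) + (4 ^+ N * (1 - r))^-1 * I) @[N --> \oo] --> 48 * (8 * (2 * b) + 0 * I).
  apply: cvgM; first exact: cvg_cst.
  apply: cvgD; first exact: cvg_cst.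
  apply: cvgM; last exact: cvg_cst.
  rewrite -(mul0r (1 - r)^-1).
  under eq_fun do rewrite invfM -exprVn.
  apply: cvgM; last exact: cvg_cst.
  by apply: cvg_expr; rewrite ger0_norm ?invr_ge0// invf_lt1//; lra.
have L2 : \int[mu]_(s in Ipi) (pk (r%:C * expi t) s * Y s) <=
    48 * (8 * (2 * b) + 0 * I).
  by apply: (ler_cvg_to (cvg_cst _) lim); apply: nearW.
rewrite mul0r addr0 in L2; rewrite /PI.
have -> : \int[mu]_(s in Ipi) (pk (r%:C * expi t) s * X s) =
    \int[mu]_(s in Ipi) (pk (r%:C * expi t) s * Y s).
  by apply: eq_Rintegral => s sI; rewrite /Y patchE sI.
rewrite ler_pdivrMl ?mulr_gt0//; apply: le_trans L2 _.
rewrite (_ : 48 * (8 * (2 * b)) = 1 * (48 * 16 * b)); last by ring.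
by rewrite ler_wpM2r ?mulr_ge0 ?(ltW b0)//; have := pi_ge2 R; lra.
Qed.

End growth.

(** * Integrability of the logarithmic radial maximal function *)

Section smirnov.
Variable R : realType.
Local Notation C := R[i].
Local Notation mu := (@lebesgue_measure R).
Local Notation Ipi := `[- pi, (pi : R)]%classic.
Implicit Types (z w : C) (r s t x y d : R) (u : R -> R).

Lemma ae_le_Rintegral u v : mu.-integrable Ipi (EFin \o u) ->
  mu.-integrable Ipi (EFin \o v) -> {ae mu, forall t, Ipi t -> u t <= v t} ->
  \int[mu]_(t in Ipi) u t <= \int[mu]_(t in Ipi) v t.
Proof.
move=> iu iv uv.
have mu_ : measurable_fun Ipi u by apply/measurable_EFinP; exact: (measurable_int mu iu).
have mv : measurable_fun Ipi v by apply/measurable_EFinP; exact: (measurable_int mu iv).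
have mm : measurable_fun Ipi (fun t => Num.min (u t) (v t)) by exact: measurable_minr.
have im : mu.-integrable Ipi (EFin \o (fun t => Num.min (u t) (v t))).
  have ia : mu.-integrable Ipi (EFin \o (fun t => `|u t| + `|v t|)).
    by apply: RintegrableD => //; [exact: (integrable_norm iu)|exact: (integrable_norm iv)].
  apply: le_integrable ia => //; first exact/measurable_EFinP.
  move=> t _ /=; rewrite lee_fin [leRHS]ger0_norm ?addr_ge0//.
  by rewrite /Num.min; case: ifP => _; rewrite ?lerDl ?lerDr.
rewrite (@ae_eq_Rintegral _ u (fun t => Num.min (u t) (v t)))//.
  by apply: le_Rintegral => // t _; rewrite ge_min lexx orbT.
by apply: ae_imp uv => t H It; apply/esym/min_idPl; exact: H.
Qed.

Variables (Phi : R -> R) (p K : R).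
Hypothesis Phi_mono : forall s t : R, 0 <= s -> s <= t -> Phi s <= Phi t.
Hypothesis Phi0 : Phi 0 = 0.
Hypothesis Phi_gt0 : forall t : R, 0 < t -> 0 < Phi t.
Hypothesis p0 : 0 < p.
Hypothesis K1 : 1 < K.
Hypothesis Phi_low : forall s t : R, 0 <= s -> 0 <= t -> t <= 1 ->
  Phi (s * t) <= K * t `^ p * Phi s.

Variable F : C -> C.
Hypothesis dF : forall z, normc z < 1 -> cdiff F z.
Hypothesis bF : forall r, 0 < r < 1 ->
  (\int[mu]_(t in Ipi) (Phi (normc (F (r%:C * expi t))))%:E <= (2 * pi)%:E)%E.

Definition logp (G : C -> C) n z : R := ln (Num.max (normc (G ((rad R n)%:C * z))) 1).

Let g n t := logp F n (expi t).

Let rn z n : normc z <= 1 -> normc ((rad R n)%:C * z) <= rad R n.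
Proof.
move=> z1; have /andP[r0 _] := rad_itv01 R n.
by rewrite normcM normc_real gtr0_norm// ler_piMr// ltW.
Qed.

Let rn1 z n : normc z <= 1 -> normc ((rad R n)%:C * z) < 1.
Proof. by move=> /(rn n)/le_lt_trans; apply; have /andP[] := rad_itv01 R n. Qed.

Let expg n t : expR (g n t) = Num.max (normc (F ((rad R n)%:C * expi t))) 1.
Proof. by rewrite lnK// posrE lt_max ltr01 orbT. Qed.

Let g0 n t : 0 <= g n t.
Proof. by rewrite ln_ge0// le_max lexx orbT. Qed.

Let bounded n : exists2 M : R, 1 <= M & forall z, normc z <= 1 ->
  normc (F ((rad R n)%:C * z)) <= M.
Proof.
have /andP[r0 r1] := rad_itv01 R n.
have [||M M0 H] := @bounded_annulus _ F 0 (rad R n) => //.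
  by move=> z /andP[_ zr]; apply: cdiff_continuous (dF _); exact: le_lt_trans r1.
exists (Num.max M 1); first by rewrite le_max lexx orbT.
by move=> z z1; rewrite le_max H// normc_ge0 rn.
Qed.

Let cont n t : {for t, continuous (fun t => normc (F ((rad R n)%:C * expi t)))}.
Proof.
have h : normc (expi t) <= 1 by rewrite normc_expi.
by have [] := continuous_circle (cdiff_continuous (dF (rn1 n h))).
Qed.

Let mn n : measurable_fun [set: R] (fun t => normc (F ((rad R n)%:C * expi t))).
Proof. by apply: continuous_measurable_fun => t; exact: cont. Qed.

Let mg n : measurable_fun [set: R] (g n).
Proof. by apply: measurableT_comp => //; apply: measurable_maxr. Qed.

Let ig n : mu.-integrable Ipi (EFin \o g n).
Proof.
have [M M1 H] := bounded n.
have ic : mu.-integrable Ipi (EFin \o cst (ln M)).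
  by apply: ccont_integrable => t _; exact: cvg_cst.
apply: le_integrable ic => //.
  by apply/measurable_EFinP; apply: (@measurable_funS _ _ _ _ setT) => //; exact: (mg n).
move=> t _ /=; rewrite lee_fin (ger0_norm (g0 n t)) ger0_norm ?ln_ge0//.
rewrite ler_ln ?posrE ?lt_max ?ltr01 ?orbT ?(lt_le_trans ltr01 M1)//.
by rewrite ge_max M1 andbT H// normc_expi.
Qed.

Let X n t := Phi (expR (g n t)).

Let X0 n t : 0 <= X n t. Proof. by apply: (@Phi_ge0 _ Phi) => //; exact: expR_ge0. Qed.

Let mX n : measurable_fun [set: R] (X n).
Proof.
apply: (@measurable_Phi _ Phi) => //.
exact: measurableT_comp.
Qed.

Let iX n : mu.-integrable Ipi (EFin \o X n).
Proof.
have [M M1 H] := bounded n.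
have ic : mu.-integrable Ipi (EFin \o cst (Phi M)).
  by apply: ccont_integrable => t _; exact: cvg_cst.
apply: le_integrable ic => //.
  by apply/measurable_EFinP; apply: (@measurable_funS _ _ _ _ setT) => //; exact: (mX n).
move=> t _ /=; rewrite lee_fin !ger0_norm//; last first.
  by apply: (@Phi_ge0 _ Phi) => //; apply: le_trans M1.
apply: Phi_mono; first exact: expR_ge0.
by rewrite expg ge_max M1 andbT H// normc_expi.
Qed.

(** The first term is the bound [bF]; the second pays for replacing |F| by its maximum with 1. *)
Let A := 2 * pi + 2 * pi * Phi 1.

Let A0 : 0 <= A.
Proof. by rewrite addr_ge0 ?mulr_ge0 ?pi_ge0// Phi_ge0. Qed.

Let bX n : \int[mu]_(t in Ipi) X n t <= A.
Proof.
rewrite /Rintegral -lee_fin fineK; last by apply: integrable_fin_num => //; exact: (iX n).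
have mPF : measurable_fun Ipi (fun t => (Phi (normc (F ((rad R n)%:C * expi t))))%:E).
  apply/measurable_EFinP; apply: (@measurable_Phi _ Phi) => //; last by move=> t; exact: normc_ge0.
  by apply: (@measurable_funS _ _ _ _ setT) => //; exact: (mn n).
apply: (@le_trans _ _ (\int[mu]_(t in Ipi) ((Phi (normc (F ((rad R n)%:C * expi t))))%:E + (Phi 1)%:E))%E).
  apply: ge0_le_integral => //.
  - by move=> t _; rewrite lee_fin.
  - by apply/measurable_EFinP; apply: (@measurable_funS _ _ _ _ setT) => //; exact: (mX n).
  - by apply: emeasurable_funD.
  - move=> t _; rewrite -EFinD lee_fin /X expg.
    have n0 : 0 <= Phi (normc (F ((rad R n)%:C * expi t))).
      by apply: (@Phi_ge0 _ Phi) => //; exact: normc_ge0.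
    have n1 : 0 <= Phi 1 by exact: Phi_ge0.
    by rewrite /Num.max; case: ifP => _; rewrite ?lerDl ?lerDr.
rewrite ge0_integralD//=; last 2 first.
- by move=> t _; rewrite lee_fin; apply: (@Phi_ge0 _ Phi) => //; exact: normc_ge0.
- by move=> t _; rewrite lee_fin; exact: Phi_ge0.
rewrite EFinD; apply: leeD; first by apply: bF; exact: rad_itv01.
rewrite integral_cst//= lebesgue_measure_itv/= lte_fin.
case: ifPn => _; last by rewrite mule0 lee_fin !mulr_ge0 ?pi_ge0// Phi_ge0.
by rewrite -EFinB -EFinM lee_fin mulrC le_eqVlt; apply/orP; left; apply/eqP; ring.
Qed.

(** The dilation of [F] by [rad R n] is bounded and continuous up to the circle, so [outer_majorant]
    applies with its own boundary modulus. *)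
Let major n z : normc z < 1 -> normc (F ((rad R n)%:C * z)) <= expR (PI (g n) z).
Proof.
move=> z1; have [M M1 H] := bounded n.
apply: (@outer_majorant _ (fun z => F ((rad R n)%:C * z)) (g n)
  (fun t => normc (F ((rad R n)%:C * expi t))) M 0) => //.
- move=> w w1; apply: (@cdiff_comp _ (fun w => (rad R n)%:C * w)).
    by apply: cdiffM; [exact: cdiff_cst|exact: cdiff_id].
  by apply: dF; apply: rn1; exact: ltW.
- by move=> w /ltW; exact: H.
- by apply: (@measurable_funS _ _ _ _ setT) => //; exact: (mn n).
- apply: aeW => t _.
  have E : (fun m => normc (F ((rad R n)%:C * ((rad R m)%:C * expi t)))) =
      (fun m => normc (F ((rad R n * rad R m)%:C * expi t))).
    by apply/funext => m; rewrite rmorphM/= mulrA.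
  rewrite E; apply: cvg_normc.
  apply: (@cvg_circle _ _ _ _ F (fun m => rad R n * rad R m) (cst t)).
  + by apply: cdiff_continuous; apply: dF; apply: rn1; rewrite normc_expi.
  + by rewrite -[X in _ --> X]mulr1; apply: cvgM; [exact: cvg_cst|exact: cvg_rad].
  + exact: cvg_cst.
- by apply: aeW => t _; rewrite expg le_max lexx.
Qed.

Let rad_lt m n : (m < n)%N -> 2^-1 <= rad R m / rad R n < 1.
Proof.
move=> mltn; have /andP[m0 m1] := rad_itv R m; have /andP[n0 n1] := rad_itv01 R n.
rewrite ler_pdivlMr// ltr_pdivrMr// mul1r; apply/andP; split.
  by apply: le_trans m0; rewrite ler_piMr ?invr_ge0// ltW.
by rewrite /rad ltrD2l ltrN2 ltf_pV2 ?posrE ?ltr0n// ltr_nat !ltnS.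
Qed.

(** For [m < n] the smaller circle is the dilation of the larger one by the quotient of the radii.
    Hence [g m] is at most the Poisson integral of [g n], and the Jensen inequality applies. *)
Let step m n t : (m < n)%N -> Phi (expR (g m t - 1)) <=
  K / p * PI (X n) ((rad R m / rad R n)%:C * expi t).
Proof.
move=> mltn; set rho := rad R m / rad R n.
have /andP[rho0 rho1] := rad_lt mltn; rewrite -/rho in rho0 rho1.
have r0 : 0 <= rho by apply: le_trans rho0; rewrite invr_ge0.
have z1 : normc (rho%:C * expi t) < 1 by rewrite normc_polar_ge0.
apply: le_trans (PhiE_jensen Phi_mono Phi0 p0 K1 Phi_low z1 (ig n) (iX n)).
apply: Phi_mono; first exact: expR_ge0.
rewrite ler_expR lerD2r -ler_expR expg ge_max; apply/andP; split; last first.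
  rewrite -[X in X <= _]expR0 ler_expR; apply: PI_ge => //.
have := major n z1; congr (normc (F _) <= _).
rewrite mulrA -rmorphM/= (_ : rad R n * rho = rad R m)// /rho mulrC divfK// gt_eqF//.
by have /andP[] := rad_itv01 R n.
Qed.

(** Chosen so that the bound of the weak-type inequality, times [K / p], is half of the lower bound
    of [Phi_expR_lower]; the half provides a strict inequality. *)
Let b0 : R := Phi 1 / K / (2 * (K / p * (48 * 16))).

Let b0_gt0 : 0 < b0.
Proof.
have K0 : 0 < K by exact: lt_trans K1.
have Kp : 0 < K / p by exact: divr_gt0.
apply: divr_gt0; first by apply: divr_gt0 => //; exact: Phi_gt0.
have h48 : (0 : R) < 48 by rewrite ltr0n.
have h16 : (0 : R) < 16 by rewrite ltr0n.
by rewrite mulr_gt0// mulr_gt0// mulr_gt0.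
Qed.

(** The restriction to [m < n] lets the single function [X n] dominate all the circles involved. The
    1 added to [k] compensates the shift in the Jensen inequality. *)
Let D n k : set R := \bigcup_(m in `I_n) (Ipi `&` [set t | k%:R + 1 < g m t]).

Let mD n k : measurable (D n k).
Proof.
apply: fin_bigcup_measurable => // m _; apply: measurableI => //.
rewrite -[X in measurable X]setTI; rewrite (_ : [set t | _] = g m @^-1` `]k%:R + 1, +oo[%classic).
  by apply: mg => //; exact: measurable_itv.
by apply/seteqP; split => t /=; rewrite in_itv/= andbT.
Qed.

Let A1 := 9 / b0 * A.
Let q := expR (- p).

(* By [step], each [D n k] is contained in the exceptional set of the weak-type
   inequality for [X n] at height [b], and [b] grows like [expR (k * p)] by the
   lower type. *)
Let muD n k : (mu (D n k) <= (A1 * q ^+ k)%:E)%E.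
Proof.
have K0 : 0 < K by exact: lt_trans K1.
pose b := b0 * expR (k%:R * p).
have bp : 0 < b by rewrite mulr_gt0// expR_gt0.
have [E [mE nE HE]] := poisson_weak_type (iX n) (X0 n) bp.
apply: (@le_trans _ _ (mu E)).
  apply: le_measure; rewrite ?inE//; first exact: mD.
  move=> t [m /= mltn [tI gm]]; apply: contrapT => nEt.
  have := HE t _ tI nEt (rad_lt mltn); apply/negP; rewrite -ltNge.
  have Kp : 0 < K / p by rewrite divr_gt0.
  rewrite -(ltr_pM2l Kp); apply: lt_le_trans (step t mltn).
  have h1 : Phi (expR k%:R) <= Phi (expR (g m t - 1)).
    apply: Phi_mono; first exact: expR_ge0.
    by rewrite ler_expR lerBrDr ltW.
  apply: lt_le_trans h1.
  have := Phi_expR_lower K1 Phi_low (ler0n R k); apply: lt_le_trans.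
  have P1 : 0 < Phi 1 / K * expR (k%:R * p).
    by rewrite mulr_gt0 ?expR_gt0// divr_gt0// Phi_gt0.
  have -> : K / p * (48 * 16 * b) = Phi 1 / K * expR (k%:R * p) / 2.
    rewrite /b /b0; have Kn := gt_eqF K0; have pn := gt_eqF p0.
    by field; rewrite Kn pn.
  by rewrite ltr_pdivrMr// ltr_pMr//; lra.
apply: le_trans nE _.
apply: (@le_trans _ _ ((9 / b)%:E * A%:E)%E).
  by rewrite lee_wpmul2l ?lee_fin ?divr_ge0 ?(ltW bp).
rewrite -EFinM lee_fin /A1 /q /b -expRM_natl mulrN expRN invfM.
by rewrite le_eqVlt; apply/orP; left; apply/eqP; ring.
Qed.

Let Dk k : set R := \bigcup_n D n k.

Let mDk k : measurable (Dk k).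
Proof. by apply: bigcup_measurable => n _; exact: mD. Qed.

Let muDk k : (mu (Dk k) <= (A1 * q ^+ k)%:E)%E.
Proof.
have H := @nondecreasing_cvg_mu _ _ R mu (D ^~ k) (fun n => mD n k) (mDk k).
have nd : nondecreasing_seq (D ^~ k).
  move=> m n mltn; apply/subsetPset => t [j /= jm H1]; exists j => //=.
  exact: leq_trans mltn.
have {}H := H nd; rewrite /Dk -(cvg_lim _ H)//.
by apply: lime_le; [apply/cvg_ex; eexists; exact: H|apply: nearW => n; exact: muD].
Qed.

Definition esup_logp (G : C -> C) z : \bar R := esups (fun n => (logp G n z)%:E) 0.

(** The value is 0 where the supremum is infinite, which for [F] is a null set of the period. *)
Definition sup_logp (G : C -> C) z : R := fine (esup_logp G z).

Let es t := esup_logp F (expi t).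

Let g_es n t : ((g n t)%:E <= es t)%E.
Proof. by apply: ereal_sup_ubound; exists n. Qed.

Let mes : measurable_fun [set: R] es.
Proof.
by apply: measurable_fun_esups => n; apply/measurable_EFinP; exact: mg.
Qed.

(** Layer by layer: capped at [N + 1], [g m t] exceeds 1 by at most the number of [k < N] with
    [g m t > k + 1]. *)
Let es_le t : Ipi t -> (es t <= 1 + \sum_(k <oo) (\1_(Dk k) t)%:E)%E.
Proof.
move=> tI; apply: ge_ereal_sup => _ [m _ <-].
have key N : Num.min (g m t) (N%:R + 1) <= 1 + \sum_(0 <= k < N) \1_(Dk k) t.
  elim: N => [|N IH]; first by rewrite big_geq// ge_min add0r addr0 lexx orbT.
  rewrite big_nat_recr//= addrA -natr1.
  have [gN|Ng] := leP (g m t) (N%:R + 1).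
    apply: le_trans (_ : g m t <= _); first by rewrite ge_min lexx.
    move: IH; rewrite (min_idPl gN) => /le_trans; apply.
    by rewrite lerDl indicE; case: (_ \in _).
  have -> : \1_(Dk N) t = 1 :> R.
    by rewrite indicE mem_set//; exists m.+1 => //; exists m => //=.
  apply: (@le_trans _ _ (Num.min (g m t) (N%:R + 1) + 1)); last by rewrite lerD2r.
  by rewrite (min_idPr (ltW Ng)) ge_min lexx orbT.
pose N := Num.Def.archi_bound (g m t).
have gN : g m t < N%:R by exact: archi_boundP.
have := key N; rewrite (_ : Num.min _ _ = g m t); last first.
  by apply/min_idPl; rewrite (le_trans (ltW gN))// lerDl.
rewrite -lee_fin EFinD -sumEFin => /le_trans; apply.
by rewrite leeD2l//; apply: nneseries_lim_ge => k _ _; rewrite lee_fin.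
Qed.

(** The measures of the sets [Dk k] are bounded by a geometric sequence of ratio
    [q = expR (- p) < 1]. *)
Let ies : mu.-integrable Ipi es.
Proof.
have q1 : q < 1 by rewrite expR_lt1 oppr_lt0.
have q0 : 0 <= q by exact: expR_ge0.
have A10 : 0 <= A1 by rewrite mulr_ge0// divr_ge0// ltW.
have es0 t : (0 <= es t)%E by apply: le_trans (g_es 0%N t); rewrite lee_fin.
apply/integrableP; split; first by apply: (@measurable_funS _ _ _ _ setT) => //; exact: mes.
under eq_integral do rewrite gee0_abs//.
pose S (t : R) : \bar R := (\sum_(k <oo) (\1_(Dk k) t : R)%:E)%E.
have mI k : measurable_fun Ipi (fun t => (\1_(Dk k) t)%:E : \bar R).
  by apply/measurable_EFinP; apply: (@measurable_funS _ _ _ _ setT) => //; exact: measurable_indic.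
have mS : measurable_fun Ipi S.
  by apply: ge0_emeasurable_sum => // k t _ _; rewrite lee_fin.
have S0 t : (0 <= S t)%E by apply: nneseries_ge0 => k _ _; rewrite lee_fin.
have iS : (\int[mu]_(t in Ipi) S t <= (A1 / (1 - q))%:E)%E.
  rewrite integral_nneseries//.
  apply: lime_le.
    by apply: is_cvg_nneseries => k _ _; apply: integral_ge0 => t _; rewrite lee_fin.
  apply: nearW => n.
  apply: (@le_trans _ _ (\sum_(0 <= k < n) (A1 * q ^+ k)%:E)%E).
    apply: lee_sum => k _; rewrite integral_indic//; last exact: mDk.
    apply: le_trans (muDk k); apply: le_measure; rewrite ?inE//; last exact: mDk.
    by apply: measurableI => //; exact: mDk.
  rewrite sumEFin lee_fin.
  have -> : \sum_(0 <= k < n) A1 * q ^+ k = A1 * (1 - q ^+ n) / (1 - q).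
    have q1n : q != 1 by rewrite lt_eqF.
    have := @geometric_seriesE R A1 q q1n; move=> /(congr1 (fun f => f n)).
    by rewrite seriesEnat.
  rewrite ler_wpM2r ?invr_ge0 ?subr_ge0 ?(ltW q1)//.
  by rewrite ler_piMr// gerBl exprn_ge0.
apply: (@le_lt_trans _ _ (\int[mu]_(t in Ipi) (1 + S t))%E).
  apply: ge0_le_integral => //.
  - by apply: (@measurable_funS _ _ _ _ setT) => //; exact: mes.
  - by apply: emeasurable_funD.
rewrite ge0_integralD//=; apply: lte_add_pinfty.
  rewrite integral_cst//= mul1e lebesgue_measure_itv/= lte_fin.
  by case: ifPn => _; rewrite ?ltry.
by apply: le_lt_trans iS _; rewrite ltry.
Qed.

Lemma measurable_sup_logp : measurable_fun [set: R] (fun t => sup_logp F (expi t)).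
Proof. exact: measurableT_comp. Qed.

Lemma integrable_sup_logp : mu.-integrable Ipi (EFin \o (fun t => sup_logp F (expi t))).
Proof.
apply: le_integrable ies => //.
  apply/measurable_EFinP; apply: (@measurable_funS _ _ _ _ setT) => //.
  exact: measurable_sup_logp.
move=> t _ /=; rewrite /sup_logp -/(es t).
have : (0 <= es t)%E by apply: le_trans (g_es 0%N t); rewrite lee_fin.
by case: (es t) => [x|_|]//=; rewrite ?leey.
Qed.

(** The boundary function no longer depends on [n], so only the left-hand side of [major] passes to
    the limit. *)
Theorem smirnov_majorant z : normc z < 1 ->
  normc (F z) <= expR (PI (fun t => sup_logp F (expi t)) z).
Proof.
move=> z1.
have pi2 : 0 < 2 * pi :> R by rewrite mulr_gt0// pi_gt0.
have L n : normc (F ((rad R n)%:C * z)) <= expR (PI (fun t => sup_logp F (expi t)) z).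
  apply: le_trans (major n z1) _; rewrite ler_expR /PI ler_wpM2l ?invr_ge0 ?(ltW pi2)//.
  apply: ae_le_Rintegral.
  - exact: integrable_pkM.
  - by apply: integrable_pkM => //; exact: integrable_sup_logp.
  have := @integrable_ae _ _ R mu Ipi (measurable_itv _) es ies; apply: ae_imp => t /[apply] fes.
  rewrite ler_wpM2l ?(ltW (pk_gt0 t z1))//.
  by rewrite -lee_fin fineK//; exact: g_es.
have lim : normc (F ((rad R n)%:C * z)) @[n --> \oo] --> normc (F z).
  apply: cvg_normc.
  apply: (cvg_comp (fun n => ((rad R n)%:C * z : C^o)) (F : C^o -> C^o)) (cdiff_continuous (dF z1)).
  have [t _ zE] := polar z; rewrite zE.
  have -> : (fun n => (rad R n)%:C * ((normc z)%:C * expi t) : C^o) =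
      (fun n => (rad R n * normc z)%:C * expi t : C^o).
    by apply/funext => n; rewrite rmorphM/= mulrA.
  apply: cvg_polar; last exact: cvg_cst.
  by rewrite -[X in _ --> X]mul1r; apply: cvgM; [exact: cvg_rad|exact: cvg_cst].
by apply: (ler_cvg_to lim (cvg_cst _)); exact: nearW.
Qed.

End smirnov.

(** * Factorization *)

Section factorization.
Variable R : realType.
Local Notation C := R[i].
Local Notation mu := (@lebesgue_measure R).
Local Notation Ipi := `[- pi, (pi : R)]%classic.
Implicit Types (z w : C) (r s t x y d : R) (u : R -> R) (f I O : C -> C) (U W : C -> R).

Lemma expi_2pi t : expi (t + 2 * pi) = expi t.
Proof. by rewrite /expi mulr_natl cosD2pi sinD2pi. Qed.

Lemma continuous_realC : continuous ((fun x => x%:C) : R -> C^o).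
Proof.
move=> x; apply/cvg_ReIm; split => /=; [exact: cvg_id|exact: cvg_cst].
Qed.

(** [U] lives on the plane because [outer_function] asks for a modulus defined on the circle; a
    function of the angle alone need not be periodic. *)
Lemma oexp_outer U : measurable_fun [set: R] (fun t => U (expi t)) ->
  mu.-integrable Ipi (EFin \o (fun t => U (expi t))) ->
  outer_function (oexp (fun t => U (expi t))).
Proof.
move=> mU iU; exists (fun z => (expR (U z))%:C).
have E : log_modulus (fun z => (expR (U z))%:C) = (fun t => (U (expi t))%:E).
  apply/funext => t; rewrite /log_modulus normc_real ger0_norm ?expR_ge0//.
  by rewrite lne_EFin ?expR_gt0// expRK.
split.
- move=> V oV; rewrite -[X in measurable X]setTI.
  have mE : measurable_fun [set: R] (fun t => expR (U (expi t))).
    by apply: measurableT_comp => //; exact: measurable_expR.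
  apply: (mE measurableT [set x | V x%:C]); apply: open_measurable.
  by apply: (open_comp _ oV) => x _; exact: continuous_realC.
- by rewrite E.
- by move=> z z1; rewrite E.
Qed.

Lemma outer_oexp O : outer_function O -> exists2 u,
  mu.-integrable Ipi (EFin \o u) & forall z, normc z < 1 -> O z = oexp u z.
Proof.
move=> [g [mg ig OE]]; exists (fun t => fine (log_modulus g t)) => //.
have ml := measurable_int mu ig; apply: le_integrable ig => //.
  by apply/measurable_EFinP; apply: measurableT_comp.
by move=> t _ /=; case: (log_modulus g t) => [x||]//=; rewrite ?leey.
Qed.

Lemma near_left1 : \forall r \near (1 : R)^'-, 0 < r < 1.
Proof.
near=> r; apply/andP; split; near: r; last exact: nbhs_left_lt.
exact: nbhs_left_gt.
Unshelve. all: by end_near. Qed.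

Lemma inner_outer_of_majorant f W a :
  (forall z, normc z < 1 -> cdiff f z) ->
  measurable_fun [set: R] (fun t => W (expi t)) ->
  mu.-integrable Ipi (EFin \o (fun t => W (expi t))) ->
  (forall z, normc z < 1 -> normc (f z) <= expR (PI (fun t => W (expi t)) z)) ->
  normc a < 1 -> f a != 0 ->
  exists U I, [/\ measurable_fun [set: R] (fun t => U (expi t)),
    mu.-integrable Ipi (EFin \o (fun t => U (expi t))),
    inner_function I, forall z, normc z < 1 -> normc (I z) <= 1 &
    forall z, normc z < 1 -> f z = I z * oexp (fun t => U (expi t)) z].
Proof.
move=> df mW iW fW a1 fa.
pose w t := W (expi t).
pose h z := f z * (oexp w z)^-1.
have dh z : normc z < 1 -> cdiff h z.
  move=> z1; apply: cdiffM; first exact: df.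
  by apply: cdiffV; [exact: oexp_neq0|exact: cdiff_oexp].
have h1 z : normc z < 1 -> normc (h z) <= 1.
  move=> z1; rewrite normcM normcV normc_oexp ler_pdivrMr ?expR_gt0// mul1r.
  exact: fW.
have ha : h a != 0 by rewrite mulf_neq0// invr_eq0 oexp_neq0.
pose v t := blog h (expi t).
have iv : mu.-integrable Ipi (EFin \o v) by exact: integrable_blog dh h1 a1 ha.
pose I z := h z * (oexp v z)^-1.
have I1 z : normc z < 1 -> normc (I z) <= 1.
  move=> z1; rewrite normcM normcV normc_oexp ler_pdivrMr ?expR_gt0// mul1r.
  exact: bounded_majorant dh h1 a1 ha _ z1.
exists (fun z => blog h z + W z), I; split => //.
- by apply: measurable_funD => //; exact: measurable_blog.
- exact: RintegrableD.
- split.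
  + apply/holomorphic_discP => z z1; apply: cdiffM; first exact: dh.
    by apply: cdiffV; [exact: oexp_neq0|exact: cdiff_oexp].
  + by exists 1 => z; exact: I1.
  + apply: ae_periodic (bounded_inner dh h1 a1 ha) => t.
    by rewrite expi_2pi.
- move=> z z1; rewrite oexpD// /I /h mulrA.
  have nw := oexp_neq0 w z; have nv := oexp_neq0 v z.
  by rewrite (mulfVK nv) (mulfVK nw).
Qed.

Lemma ae_radial_modulus f I u : inner_function I ->
  mu.-integrable Ipi (EFin \o u) ->
  (forall z, normc z < 1 -> f z = I z * oexp u z) ->
  {ae mu, forall t, Ipi t ->
    normc (f (r%:C * expi t)) @[r --> (1 : R)^'-] --> expR (u t)}.
Proof.
move=> [_ _ aI] iu fE; apply: ae_imp2 aI (oexp_fatou iu) => t [l Il l1] h It.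
rewrite -[X in _ --> X]mul1r -[X in X * expR _]l1.
have E : \forall r \near (1 : R)^'-,
    normc (I (r%:C * expi t)) * normc (oexp u (r%:C * expi t)) = normc (f (r%:C * expi t)).
  have := @near_left1; apply: filterS => r /andP[r0 r1].
  have z1 : normc (r%:C * expi t) < 1 by rewrite normc_polar_ge0 ?(ltW r0).
  by rewrite (fE _ z1); symmetry; exact: normcM.
apply: cvg_trans (near_eq_cvg E) _.
exact: (cvgM (cvg_normc Il) (h It)).
Qed.

Lemma inner_outer_unique f I O I' O' :
  inner_function I -> outer_function O ->
  inner_function I' -> outer_function O' ->
  (forall z, normc z < 1 -> f z = I z * O z) ->
  (forall z, normc z < 1 -> f z = I' z * O' z) ->
  forall z, normc z < 1 -> I' z = I z /\ O' z = O z.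
Proof.
move=> iI /outer_oexp[u iu OE] iI' /outer_oexp[u' iu' OE'] fE fE'.
have fE1 z : normc z < 1 -> f z = I z * oexp u z by move=> z1; rewrite fE// OE.
have fE1' z : normc z < 1 -> f z = I' z * oexp u' z by move=> z1; rewrite fE'// OE'.
have c := ae_radial_modulus iI iu fE1; have c' := ae_radial_modulus iI' iu' fE1'.
have uu' : u' = u %[ae mu in Ipi].
  apply: ae_imp2 c c' => t h h' It; apply: expR_inj.
  by rewrite -(cvg_lim (@Rhausdorff R) (h It)) -(cvg_lim (@Rhausdorff R) (h' It)).
move=> z z1; have OO' : O' z = O z by rewrite OE// OE'//; exact: ae_eq_oexp.
split=> //; apply: (mulIf (oexp_neq0 u z)).
by rewrite -fE1// -OE// -OO' -fE'.
Qed.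

End factorization.

(** * Luxemburg norms *)

Section luxemburg.
Variable R : realType.
Local Notation C := R[i].
Local Notation mu := (@lebesgue_measure R).
Local Notation Ipi := `[- pi, (pi : R)]%classic.
Implicit Types (z w : C) (r s t x y d l : R) (u : R -> R) (f I O : C -> C).

Lemma limn_einf_ge (u : (\bar R)^nat) x : (\forall n \near \oo, (x%:E <= u n)%E) ->
  (x%:E <= limn_einf u)%E.
Proof.
move=> [N _ H]; rewrite limn_einf_lim; apply: lime_ge; first exact: is_cvg_einfs.
exists N => // n /= Nn; apply: le_ereal_inf_tmp => _ [k /= nk <-].
by apply: H => /=; exact: leq_trans nk.
Qed.

Lemma limn_einf_le (u : (\bar R)^nat) (b : \bar R) : (forall n, (u n <= b)%E) ->
  (limn_einf u <= b)%E.
Proof.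
move=> H; rewrite limn_einf_lim; apply: lime_le; first exact: is_cvg_einfs.
apply: nearW => n; apply: le_trans (H n).
by apply: ereal_inf_lbound; exists n => /=.
Qed.

Variable Phi : R -> R.
Hypothesis Phi_mono : forall s t : R, 0 <= s -> s <= t -> Phi s <= Phi t.
Hypothesis Phi0 : Phi 0 = 0.

Let pi2 : 0 < 2 * pi :> R. Proof. by rewrite mulr_gt0// pi_gt0. Qed.

Let P0 f z l : 0 < l -> 0 <= Phi (normc (f z) / l).
Proof. by move=> l0; apply: (@Phi_ge0 _ Phi) => //; rewrite divr_ge0 ?normc_ge0 ?ltW. Qed.

Lemma measurable_Phi_circle f r l : (forall z, normc z < 1 -> cdiff f z) ->
  0 <= r < 1 -> 0 < l ->
  measurable_fun [set: R] (fun t => Phi (normc (f (r%:C * expi t)) / l)).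
Proof.
move=> df /andP[r0 r1] l0; apply: (@measurable_Phi _ Phi) => //; last first.
  by move=> t; rewrite divr_ge0 ?normc_ge0 ?ltW.
apply: measurable_funM => //; apply: continuous_measurable_fun => t.
have z1 : normc (r%:C * expi t) < 1 by rewrite normc_polar_ge0.
by have [] := continuous_circle (cdiff_continuous (df _ z1)).
Qed.

Lemma Phi_circle_period f r l : (forall z, normc z < 1 -> cdiff f z) ->
  0 <= r < 1 -> 0 < l ->
  (\int[mu]_(t in `[0%R, (2 * pi)%R]) (Phi (normc (f (r%:C * expi t)) / l))%:E =
   \int[mu]_(t in Ipi) (Phi (normc (f (r%:C * expi t)) / l))%:E)%E.
Proof.
move=> df r01 l0.
rewrite (@integral_2pi_periodic _ (fun t => (Phi (normc (f (r%:C * expi t)) / l))%:E))//.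
- by apply/measurable_EFinP; exact: measurable_Phi_circle.
- by move=> t; rewrite lee_fin P0.
- by move=> t; rewrite expi_2pi.
Qed.

(** The strict inequality provides an admissible constant below [l] on each circle without
    attainment of the infimum; monotonicity of [Phi] carries it to [l]. *)
Lemma hardy_lux_lt f l : (forall z, normc z < 1 -> cdiff f z) ->
  0 < l -> (hardy_lux_norm Phi f < l%:E)%E -> forall r, 0 <= r < 1 ->
  (\int[mu]_(t in Ipi) (Phi (normc (f (r%:C * expi t)) / l))%:E <= (2 * pi)%:E)%E.
Proof.
move=> df l0 fl r r01.
have : (lux_norm Phi (dilation f r) < l%:E)%E.
  by apply: le_lt_trans fl; apply: ereal_sup_ubound; exists r.
move=> /ereal_inf_lt[_ [l' [l'0 H] <-]]; rewrite lte_fin => l'l.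
move: H; rewrite lee_pdivrMl// mule1 /dilation Phi_circle_period//.
apply: le_trans; apply: ge0_le_integral => //.
- by move=> t _; rewrite lee_fin P0.
- by apply/measurable_EFinP; apply: (@measurable_funS _ _ _ _ setT) => //; exact: measurable_Phi_circle.
- by apply/measurable_EFinP; apply: (@measurable_funS _ _ _ _ setT) => //; exact: measurable_Phi_circle.
- move=> t _; rewrite lee_fin; apply: Phi_mono.
    by rewrite divr_ge0 ?normc_ge0 ?ltW.
  by rewrite ler_wpM2l ?normc_ge0// lef_pV2 ?posrE// ltW.
Qed.

Lemma hardy_lux_le f l : (forall z, normc z < 1 -> cdiff f z) -> 0 < l ->
  (forall r, 0 <= r < 1 ->
    (\int[mu]_(t in Ipi) (Phi (normc (f (r%:C * expi t)) / l))%:E <= (2 * pi)%:E)%E) ->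
  (hardy_lux_norm Phi f <= l%:E)%E.
Proof.
move=> df l0 H; apply: ge_ereal_sup => _ [r /= r01 <-].
apply: ereal_inf_lbound; exists l => //; split => //.
by rewrite lee_pdivrMl// mule1 /dilation Phi_circle_period// H.
Qed.

Lemma hardy_lux_ge0 f : (0 <= hardy_lux_norm Phi f)%E.
Proof.
apply: (@le_trans _ _ (lux_norm Phi (dilation f 0))).
  by apply: le_ereal_inf_tmp => _ [l [l0 _] <-]; rewrite lee_fin ltW.
by apply: ereal_sup_ubound; exists 0 => //=; rewrite lexx ltr01.
Qed.

Lemma hardy_lux_mono f g : (forall z, normc z < 1 -> cdiff f z) ->
  (forall z, normc z < 1 -> cdiff g z) ->
  (forall z, normc z < 1 -> normc (f z) <= normc (g z)) ->
  (hardy_lux_norm Phi f <= hardy_lux_norm Phi g)%E.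
Proof.
move=> df dg fg; apply/lee_addgt0Pr => e e0.
have := hardy_lux_ge0 g; case E : (hardy_lux_norm Phi g) => [n||]// n0.
  rewrite lee_fin in n0; rewrite -EFinD.
  have l0 : 0 < n + e by rewrite ltr_wpDl.
  apply: hardy_lux_le => // r r01.
  have gl : (hardy_lux_norm Phi g < (n + e)%:E)%E by rewrite E lte_fin ltrDl.
  apply: le_trans (hardy_lux_lt dg l0 gl r01).
  apply: ge0_le_integral => //.
  - by move=> t _; rewrite lee_fin P0.
  - by apply/measurable_EFinP; apply: (@measurable_funS _ _ _ _ setT) => //; exact: measurable_Phi_circle.
  - by apply/measurable_EFinP; apply: (@measurable_funS _ _ _ _ setT) => //; exact: measurable_Phi_circle.
  - move=> t _; rewrite lee_fin; apply: Phi_mono.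
      by rewrite divr_ge0 ?normc_ge0 ?ltW.
    apply: ler_wpM2r; first by rewrite invr_ge0 ltW.
    by have /andP[r0 r1] := r01; apply: fg; rewrite normc_polar_ge0.
by rewrite addye// leey.
Qed.

(** Without continuity of [Phi], convergence of |f| does not pass through it. With [l'] between the
    norm and [l], however, |f| / l' is eventually at least [expR (u t) / l], so monotonicity alone
    bounds the lower limit and Fatou's lemma applies. *)
Lemma Phi_boundary_le f u l : (forall z, normc z < 1 -> cdiff f z) ->
  measurable_fun [set: R] u ->
  {ae mu, forall t, Ipi t ->
    normc (f (r%:C * expi t)) @[r --> (1 : R)^'-] --> expR (u t)} ->
  0 < l -> (hardy_lux_norm Phi f < l%:E)%E ->
  (\int[mu]_(t in Ipi) (Phi (expR (u t) / l))%:E <= (2 * pi)%:E)%E.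
Proof.
move=> df mu_ lim l0 fl.
have [l' [l'0 l'l fl']] : exists l', [/\ 0 < l', l' < l & (hardy_lux_norm Phi f < l'%:E)%E].
  have := hardy_lux_ge0 f; move: fl; case: (hardy_lux_norm Phi f) => [n||]//.
  rewrite lte_fin lee_fin => nl n0; exists ((n + l) / 2); rewrite lte_fin.
  by split; lra.
pose h n t := (Phi (normc (f ((rad R n)%:C * expi t)) / l'))%:E.
have mh n : measurable_fun Ipi (h n).
  apply/measurable_EFinP; apply: (@measurable_funS _ _ _ _ setT) => //.
  apply: measurable_Phi_circle => //.
  by have /andP[r0 r1] := rad_itv01 R n; rewrite r1 ltW.
have h0 n t : Ipi t -> (0 <= h n t)%E by move=> _; rewrite lee_fin P0.
apply: (@le_trans _ _ (\int[mu]_(t in Ipi) limn_einf (h ^~ t))%E); last first.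
  have F := @fatou _ _ R mu Ipi (measurable_itv _) h mh h0; apply: le_trans F _.
  apply: limn_einf_le => n; apply: hardy_lux_lt => //.
  by have /andP[r0 r1] := rad_itv01 R n; rewrite r1 ltW.
apply: ae_ge0_le_integral => //.
- by move=> t _; rewrite lee_fin; apply: (@Phi_ge0 _ Phi) => //; rewrite divr_ge0 ?expR_ge0 ?ltW.
- apply/measurable_EFinP; apply: (@measurable_funS _ _ _ _ setT) => //.
  apply: (@measurable_Phi _ Phi) => //; last by move=> t; rewrite divr_ge0 ?expR_ge0 ?ltW.
  by apply: measurable_funM => //; apply: measurableT_comp => //; exact: measurable_expR.
- by move=> t It; apply: limn_einf_ge; apply: nearW => n; exact: h0.
- rewrite /limn_einf; apply: measurableT_comp => //.
  apply: measurable_fun_limn_esup => n.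
  by apply: measurableT_comp => //; exact: mh.
- apply: ae_imp lim => t H It; apply: limn_einf_ge.
  have c : normc (f ((rad R n)%:C * expi t)) @[n --> \oo] --> expR (u t).
    by apply: cvg_comp (H It); exact: cvg_rad_left.
  have e0 : 0 < expR (u t) - expR (u t) * (l' / l).
    by rewrite subr_gt0 gtr_pMr ?expR_gt0// ltr_pdivrMr// mul1r.
  move/cvgrPdist_lt : c => /(_ _ e0); apply: filterS => n /= H1.
  rewrite lee_fin; apply: Phi_mono; first by rewrite divr_ge0 ?expR_ge0 ?ltW.
  rewrite ler_pdivlMr// mulrAC -mulrA.
  have := le_lt_trans (ler_norm _) H1; lra.
Qed.

End luxemburg.

(** * Circle means of Poisson integrals *)

Section poisson_mean.
Variable R : realType.
Local Notation C := R[i].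
Local Notation mu := (@lebesgue_measure R).
Local Notation Ipi := `[- pi, (pi : R)]%classic.
Implicit Types (z w : C) (r s t x y d l : R) (u : R -> R) (f I O : C -> C).

Lemma integrable_Ipi_cst x : mu.-integrable Ipi (EFin \o cst x).
Proof. by apply: ccont_integrable => t _; exact: cvg_cst. Qed.

Lemma EFin_Rintegral_Ipi u : mu.-integrable Ipi (EFin \o u) ->
  (\int[mu]_(t in Ipi) (u t)%:E)%E = (\int[mu]_(t in Ipi) u t)%:E.
Proof. by move=> iu; rewrite /Rintegral fineK//; exact: integrable_fin_num. Qed.

Lemma PI_add_cst u x z : normc z < 1 -> mu.-integrable Ipi (EFin \o u) ->
  PI (fun t => u t + x) z = PI u z + x.
Proof.
move=> z1 iu; have pi2 : 2 * pi != 0 :> R by rewrite gt_eqF// mulr_gt0// pi_gt0.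
rewrite /PI; under eq_Rintegral do rewrite mulrDr [pk z _ * x]mulrC.
have ip : mu.-integrable Ipi (EFin \o pk z).
  have := integrable_pkM z1 (integrable_Ipi_cst 1).
  by congr (mu.-integrable Ipi (EFin \o _)); apply/funext => t; rewrite mulr1.
rewrite RintegralD//; first last.
- exact: RintegrableZ.
- exact: integrable_pkM.
by rewrite RintegralZl// integral_pk// mulrDr; congr (_ + _); rewrite mulrCA mulVf ?mulr1.
Qed.

Let indic_integral (k : R -> R) x :
  (\int[mu]_t (k t * \1_Ipi t * \1_Ipi x)%:E =
   ((fun=> \int[mu]_(t in Ipi) (k t)%:E) \_ Ipi) x)%E.
Proof.
rewrite patchE indicE; case: ifP => _.
  rewrite [RHS]integral_mkcond epatch_indic.
  by apply: eq_integral => t _; rewrite mulr1/= EFinM.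
by under eq_integral do rewrite mulr0; rewrite integral0.
Qed.

(* The Poisson kernel at [r e^(is)] depends on [t] and [s] through
   [cos (t - s)] only, so the roles of [s] and [t] can be exchanged. *)
Lemma poisson_mean u r : measurable_fun [set: R] u -> (forall t, 0 <= u t) ->
  mu.-integrable Ipi (EFin \o u) -> 0 <= r < 1 ->
  measurable_fun Ipi (fun s => (PI u (r%:C * expi s))%:E) /\
  (\int[mu]_(s in Ipi) (PI u (r%:C * expi s))%:E = \int[mu]_(t in Ipi) (u t)%:E)%E.
Proof.
move=> mu_ u0 iu r01; have /andP[r0 r1] := r01.
have pi2 : 0 < 2 * pi :> R by rewrite mulr_gt0// pi_gt0.
have z1 t : normc (r%:C * expi t) < 1 by rewrite normc_polar_ge0.
pose q x := pk (r%:C * expi 0) x.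
have mq : measurable_fun [set: R] q by apply: measurable_pk.
have q0 x : 0 <= q x by rewrite ltW// pk_gt0.
have pkq s t : pk (r%:C * expi s) t = q (t - s) by rewrite /q !pk_polarE// subr0.
have qpk s t : q (t - s) = pk (r%:C * expi t) s.
  by rewrite pkq /q !pk_polarE// !subr0 -cosN opprB.
pose k s t := (2 * pi)^-1 * (q (t - s) * u t).
have k0 s t : 0 <= k s t by rewrite !mulr_ge0 ?invr_ge0// ltW.
(* Indicators of the period in both variables make Tonelli's theorem applicable on the whole
   plane. *)
pose F (x : R * R) := (k x.1 x.2 * \1_Ipi x.2 * \1_Ipi x.1)%:E : \bar R.
have i0 x : 0 <= \1_Ipi x :> R by rewrite indicE ler0n.
have F0 (y : R * R) : (0 <= F y)%E.
  by rewrite lee_fin; apply: mulr_ge0 (i0 _); apply: mulr_ge0 (i0 _).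
have m1 : measurable_fun [set: R] (\1_Ipi : R -> R) by exact: measurable_indic.
have mF : measurable_fun [set: R * R] F.
  apply/measurable_EFinP; apply: measurable_funM; last first.
    by apply: (measurableT_comp m1); exact: measurable_fst.
  apply: measurable_funM; last by apply: (measurableT_comp m1); exact: measurable_snd.
  apply: measurable_funM => //; apply: measurable_funM.
    by apply: (measurableT_comp mq); apply: measurable_funB; [exact: measurable_snd|exact: measurable_fst].
  by apply: (measurableT_comp mu_); exact: measurable_snd.
have PIE s : (PI u (r%:C * expi s))%:E = (\int[mu]_(t in Ipi) (k s t)%:E)%E.
  have ik : mu.-integrable Ipi (EFin \o k s).
    apply: RintegrableZ => //.
    have := integrable_pkM (z1 s) iu; congr (mu.-integrable Ipi (EFin \o _)).
    by apply/funext => t; rewrite pkq.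
  rewrite EFin_Rintegral_Ipi// /PI -RintegralZl//; last exact: integrable_pkM.
  by congr (_%:E); apply: eq_Rintegral => t _; rewrite pkq.
have left s : (\int[mu]_t F (s, t))%E = ((fun s => (PI u (r%:C * expi s))%:E) \_ Ipi) s.
  by rewrite indic_integral !patchE PIE.
have right t : (\int[mu]_s F (s, t))%E = ((fun t => (u t)%:E) \_ Ipi) t.
  rewrite /F; under eq_integral do rewrite mulrAC.
  rewrite (indic_integral (fun s => k s t)) !patchE; case: ifP => // _.
  have ip : mu.-integrable Ipi (EFin \o pk (r%:C * expi t)).
    have := integrable_pkM (z1 t) (integrable_Ipi_cst 1).
    by congr (mu.-integrable Ipi (EFin \o _)); apply/funext => s; rewrite mulr1.
  have E : (fun s => (k s t)%:E) = EFin \o (fun s => ((2 * pi)^-1 * u t) * pk (r%:C * expi t) s).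
    by apply/funext => s /=; rewrite /k qpk -mulrA [u t * _]mulrC.
  rewrite E EFin_Rintegral_Ipi; last exact: RintegrableZ.
  rewrite RintegralZl// integral_pk//; congr (_%:E).
  by rewrite mulrAC mulVf ?mul1r// gt_eqF.
split.
  apply/(@measurable_restrictT _ _ _ _ Ipi) => //.
  have := @measurable_fun_fubini_tonelli_F _ _ _ _ _ mu F mF F0.
  by rewrite /fubini_F; congr (measurable_fun setT _); apply/funext => s; exact: left.
rewrite integral_mkcond [RHS]integral_mkcond.
under eq_integral do rewrite -left.
rewrite (@fubini_tonelli _ _ _ _ _ mu mu F mF F0).
by apply: eq_integral => t _; exact: right.
Qed.

End poisson_mean.

(** * The Hardy-Orlicz norm of an outer function *)

Section outer_norm.
Variable R : realType.
Local Notation C := R[i].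
Local Notation mu := (@lebesgue_measure R).
Local Notation Ipi := `[- pi, (pi : R)]%classic.
Implicit Types (z w : C) (r s t x y d l : R) (u : R -> R) (f I O : C -> C).

Variables (Phi : R -> R) (p K : R).
Hypothesis Phi_mono : forall s t : R, 0 <= s -> s <= t -> Phi s <= Phi t.
Hypothesis Phi0 : Phi 0 = 0.
Hypothesis p0 : 0 < p.
Hypothesis K1 : 1 < K.
Hypothesis Phi_low : forall s t : R, 0 <= s -> 0 <= t -> t <= 1 ->
  Phi (s * t) <= K * t `^ p * Phi s.

(** The factor [expR 1] makes up for the shift by 1 in the Jensen inequality, and [k] absorbs its
    factor [K / p]; [poisson_mean] then returns the integral over the boundary. *)
Lemma hardy_oexp_le u k l : 0 < k -> 0 < l ->
  (forall x, 0 <= x -> K / p * Phi (x / k) <= Phi x) ->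
  measurable_fun [set: R] u -> mu.-integrable Ipi (EFin \o u) ->
  (\int[mu]_(t in Ipi) (Phi (expR (u t) / l))%:E <= (2 * pi)%:E)%E ->
  (hardy_lux_norm Phi (oexp u) <= (expR 1 * k * l)%:E)%E.
Proof.
move=> k0 l0 Hk mu_ iu bu.
have Kp : 0 < K / p by rewrite divr_gt0// (lt_trans ltr01).
have c0 : 0 < expR 1 * k * l by rewrite !mulr_gt0 ?expR_gt0.
have dO z : normc z < 1 -> cdiff (oexp u) z by move=> z1; exact: cdiff_oexp.
apply: hardy_lux_le => // r r01.
pose v t := u t + - ln l.
have iv : mu.-integrable Ipi (EFin \o v).
  by apply: RintegrableD => //; exact: integrable_Ipi_cst.
have Ev t : expR (v t) = expR (u t) / l by rewrite expRD expRN lnK.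
pose X t := Phi (expR (v t)).
have X0 t : 0 <= X t by apply: (@Phi_ge0 _ Phi) => //; exact: expR_ge0.
have mX : measurable_fun [set: R] X.
  apply: (@measurable_Phi _ Phi) => //.
  by apply: measurableT_comp; [exact: measurable_expR|exact: measurable_funD].
have bX : (\int[mu]_(t in Ipi) (X t)%:E <= (2 * pi)%:E)%E.
  by apply: le_trans bu; under eq_integral do rewrite /X Ev.
have iX : mu.-integrable Ipi (EFin \o X).
  apply/integrableP; split.
    by apply/measurable_EFinP; apply: (@measurable_funS _ _ _ _ setT).
  under eq_integral do rewrite /= ger0_norm//.
  by apply: le_lt_trans bX _; rewrite ltry.
have [mP P] := poisson_mean mX X0 iX r01.
apply: le_trans bX; rewrite -P; apply: ge0_le_integral => //.
- move=> t _; rewrite lee_fin; apply: (@Phi_ge0 _ Phi) => //.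
  by rewrite divr_ge0 ?normc_ge0 ?ltW.
- apply/measurable_EFinP; apply: (@measurable_funS _ _ _ _ setT) => //.
  exact: measurable_Phi_circle.
move=> t _; rewrite lee_fin.
have z1 : normc (r%:C * expi t) < 1.
  by have /andP[r0 r1] := r01; rewrite normc_polar_ge0.
have E : normc (oexp u (r%:C * expi t)) / (expR 1 * k * l) =
    expR (PI v (r%:C * expi t) - 1) / k.
  rewrite normc_oexp PI_add_cst// !expRD !expRN lnK ?posrE//.
  have e0 : expR 1 != 0 :> R by rewrite gt_eqF// expR_gt0.
  by field; rewrite e0 (gt_eqF k0) (gt_eqF l0).
rewrite E -(ler_pM2l Kp); apply: le_trans (Hk _ (expR_ge0 _)) _.
exact: (PhiE_jensen Phi_mono Phi0 p0 K1 Phi_low z1 iv iX).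
Qed.

End outer_norm.

Theorem theorem1p2 (R : realType) (Phi : R -> R)
  (Phi_growth : growth_function Phi) (Phi_lower : of_lower_type Phi) :
  exists2 c : R, 0 < c & forall G : R[i] -> R[i],
    hardy_orlicz Phi G ->
    (exists2 z, unit_disc z & G z != 0) ->
    exists I O : R[i] -> R[i],
      [/\ inner_outer_factorization Phi G I O,
          forall I' O' : R[i] -> R[i],
            inner_outer_factorization Phi G I' O' ->
            forall z, unit_disc z -> I' z = I z /\ O' z = O z,
          (c^-1%:E * hardy_lux_norm Phi O <= hardy_lux_norm Phi G)%E &
          (hardy_lux_norm Phi G <= c%:E * hardy_lux_norm Phi O)%E].
Proof.
case: Phi_growth => Phi_mono Phi0 _ Phi_gt0 _.
case: Phi_lower => p p0 [K K1 Phi_low].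
have [k k1 Hk] := Phi_absorb Phi_mono Phi0 p0 K1 Phi_low (K / p).
have k0 : 0 < k by exact: lt_le_trans k1.
(* The constant of [hardy_oexp_le]. *)
pose c := expR 1 * k.
have c1 : 1 <= c by rewrite -[leLHS]mul1r ler_pM// -[leLHS]expR0 ler_expR.
have c0 : 0 < c by exact: lt_le_trans c1.
exists c => // G [/holomorphic_discP dG finG] [a a1 Ga].
have [n n0 nG] : exists2 n : R, 0 <= n & hardy_lux_norm Phi G = n%:E.
  have := hardy_lux_ge0 Phi G; move: finG.
  by case: (hardy_lux_norm Phi G) => [n||]// _ n0; exists n; rewrite -?lee_fin.
(* The added 1 makes the divisor positive and strictly larger than the norm, as [hardy_lux_lt]
   requires. *)
have l0 : 0 < n + 1 by rewrite ltr_wpDl.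
have Gl : (hardy_lux_norm Phi G < (n + 1)%:E)%E by rewrite nG lte_fin ltrDl.
pose F z := G z * ((n + 1)^-1)%:C.
have dF z : normc z < 1 -> cdiff F z.
  by move=> z1; apply: cdiffM; [exact: dG|exact: cdiff_cst].
have normF z : normc (F z) = normc (G z) / (n + 1).
  by rewrite normcM normc_real ger0_norm// invr_ge0 ltW.
have bF r : 0 < r < 1 -> (\int[lebesgue_measure]_(t in `[(- pi)%R, (pi : R)%R])
    (Phi (normc (F (r%:C * expi t))))%:E <= (2 * pi)%:E)%E.
  move=> /andP[r0 r1]; under eq_integral do rewrite normF.
  by apply: (hardy_lux_lt Phi_mono Phi0 dG l0 Gl); rewrite r1 ltW.
(* The logarithm undoes the normalization of [G] to [F]. *)
pose W z := sup_logp F z + ln (n + 1).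
have iw : lebesgue_measure.-integrable `[- pi, (pi : R)] (EFin \o (fun t => sup_logp F (expi t))).
  exact: (integrable_sup_logp Phi_mono Phi0 Phi_gt0 p0 K1 Phi_low dF bF).
have mW : measurable_fun [set: R] (fun t => W (expi t)).
  by apply: measurable_funD => //; exact: measurable_sup_logp.
have iW : lebesgue_measure.-integrable `[- pi, (pi : R)] (EFin \o (fun t => W (expi t))).
  by apply: RintegrableD => //; exact: integrable_Ipi_cst.
have GW z : normc z < 1 -> normc (G z) <= expR (PI (fun t => W (expi t)) z).
  move=> z1; rewrite PI_add_cst// expRD lnK ?posrE// -ler_pdivrMr// -normF.
  exact: (smirnov_majorant Phi_mono Phi0 Phi_gt0 p0 K1 Phi_low dF bF).
have [U [I [mU iU iI I1 GE]]] := inner_outer_of_majorant dG mW iW GW a1 Ga.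
pose O := oexp (fun t => U (expi t)).
have dO z : normc z < 1 -> cdiff O z by move=> z1; exact: cdiff_oexp.
have lim := ae_radial_modulus iI iU GE.
have OG : (hardy_lux_norm Phi O <= c%:E * hardy_lux_norm Phi G)%E.
  apply/lee_addgt0Pr => e e0; rewrite nG -EFinM -EFinD.
  (* [n + e / c] is strictly above the norm of [G], and times [c] it is exactly [c * n + e]. *)
  have e1 : 0 < n + e / c by rewrite ltr_wpDl// divr_gt0.
  have -> : c * n + e = expR 1 * k * (n + e / c).
    by rewrite -/c mulrDr [c * (e / c)]mulrC divfK// gt_eqF.
  apply: (hardy_oexp_le Phi_mono Phi0 p0 K1 Phi_low) => //.
  apply: (Phi_boundary_le Phi_mono Phi0 dG mU lim e1).
  by rewrite nG lte_fin ltrDl divr_gt0.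
have oO : outer_function O by exact: oexp_outer.
exists I, O; split.
- split; [exact: iI|exact: oO| |exact: GE].
  split; first by apply/holomorphic_discP; exact: dO.
  by apply: le_lt_trans OG _; rewrite nG -EFinM ltry.
- move=> I' O' [iI' oO' _ GE'].
  exact: inner_outer_unique iI oO iI' oO' GE GE'.
- by rewrite lee_pdivrMl.
- apply: (@le_trans _ _ (hardy_lux_norm Phi O)).
    apply: hardy_lux_mono => // z z1; rewrite GE// normcM ler_piMl ?normc_ge0//.
    exact: I1.
  by rewrite lee_pemull ?hardy_lux_ge0.
Qed.
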